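(* Let $K$ be an imaginary quadratic field, $V$ an $8$-dimensional $\mathbb{Q}$-vector space and $\iota:K\hookrightarrow\mathrm{End}(V)$ an embedding of $\mathbb{Q}$-algebras. Then there exist an imaginary quadratic field $E$, a rational number $a<0$, and a simple (complex) abelian fourfold $A$ of anti-Weil type with $H^1(A,\mathbb{Q})=V$ and $\mathrm{End}_{\mathrm{Hdg}}(V)=K$ (identified with $\iota(K)$), together with a faithful representation of $\mathbb{Q}$-Lie algebras $\mu:E(a,1)^{\circ}\to\mathfrak{gl}(V)$, such that the following hold. (1) Let $V_{\overline{\mathbb{Q}}}=V_\sigma\oplus V_{\bar\sigma}$ be the eigenspace decomposition for the action of $K$ via $\iota$, where $\{\sigma,\bar\sigma\}=\mathrm{Hom}(K,\overline{\mathbb{Q}})$. Then $V_\sigma$ and $V_{\bar\sigma}$ are irreducible subrepresentations of $\mu_{\overline{\mathbb{Q}}}:\mathfrak{sl}(2)\times\mathfrak{sl}(2)\cong E(a,1)^{\circ}\otimes_{\mathbb{Q}}\overline{\mathbb{Q}}\to\mathfrak{gl}(V_{\overline{\mathbb{Q}}})$, and both are isomorphic to $V(1)\boxtimes V(1)$. (2) $V$ is an irreducible $\mathbb{Q}$-representation of $Z(\mathrm{mt}(A))\oplus E(a,1)^{\circ}$ via $\tilde\mu:Z(\mathrm{mt}(A))\oplus E(a,1)^{\circ}\to\mathfrak{gl}(V)$. (3) At least one polarization form $\phi$ on $A$ is preserved infinitesimally by the image of $\tilde\mu^{\mathrm h}:Z(\mathrm{hdg}(A))\oplus E(a,1)^{\circ}\to\mathfrak{gl}(V)$,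 i.e. $\phi(lv,w)+\phi(v,lw)=0$ for all $v,w\in V$ and all $l$ in this image.
   Context: For a quadratic field $E$ and $a,b\in E^\times$, $E(a,b)$ is the quaternion $E$-algebra with basis $1,i,j,k$ and $i^2=a$, $j^2=b$, $ij=-ji=k$; $E(a,b)^{\circ}$ is the $E$-span of $i,j,k$, viewed as a Lie algebra over $\mathbb{Q}$ with bracket $[x,y]=xy-yx$; one has $E(a,b)^{\circ}\otimes_{\mathbb{Q}}\overline{\mathbb{Q}}\cong\mathfrak{sl}(2)\times\mathfrak{sl}(2)$. $V(1)$ is the standard $2$-dimensional representation of $\mathfrak{sl}(2)$ and $\boxtimes$ the external tensor product. A simple abelian fourfold is of anti-Weil type if its endomorphism algebra $\mathrm{End}(A)\otimes\mathbb{Q}$ is an imaginary quadratic field $K$ and the two eigenspaces of $K$ on $H^{1,0}(A)$ (for the two embeddings $K\to\mathbb{C}$) have dimensions $1$ and $3$. $\mathrm{End}_{\mathrm{Hdg}}$ denotes endomorphisms of the Hodge structure. $\mathrm{mt}(A)$ and $\mathrm{hdg}(A)$ are the Lie algebras of the Mumford-Tate group and of the Hodge group of $H^1(A,\mathbb{Q})$ (the smallest $\mathbb{Q}$-subgroups of $\mathrm{GL}(H^1(A,\mathbb{Q}))$ whose real points contain the image of the Deligne torus $\mathbb{C}^\times$, resp. of its subgroup $\{z\bar z=1\}$), and $Z(\cdot)$ denotes the centre. The maps $\tilde\mu$ and $\tilde\mu^{\mathrm h}$ are the sums of $\mu$ with the tautological inclusions $Z(\mathrm{mt}(A))\subset\mathfrak{gl}(V)$,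 $Z(\mathrm{hdg}(A))\subset\mathfrak{gl}(V)$. *)

(* Defs.v *)
From HB Require Import structures.
From mathcomp Require Import all_boot all_order all_algebra all_field.
From mathcomp Require Import complex.
From mathcomp Require Import mpoly.
From mathcomp Require Import reals.

Set Implicit Arguments.
Unset Strict Implicit.
Unset Printing Implicit Defensive.

Import Order.TTheory GRing.Theory Num.Theory.
Local Open Scope ring_scope.
Local Open Scope complex_scope.

(* Quadratic, with no embedding into the real numbers.  Every field embedding
   of a number field into the complex numbers lands in [algC]. *)
Definition imaginary_quadratic (K : fieldExtType rat) : Prop :=
  \dim {:K} = 2%N /\
  forall s : {rmorphism K -> algC}, exists x, s x \isn't Num.real.

(** * Scalar extension *)

(* For a finite dimensional Q-vector space V of dimension n and a field F of
   characteristic 0, the space V (x)_Q F is realised as 'rV[F]_n through the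
   coordinates in the Q-basis [vbasis {:V}].  Vectors are rows, so an
   endomorphism acts by right multiplication by its matrix and subspaces are
   row spaces. *)
Section ScalarExtension.
Variable F : numFieldType.

Definition ext_vec (V : vectType rat) (v : V) : 'rV[F]_(\dim {:V}) :=
  map_mx ratr (passmx.rVof (vbasis {:V}) v).

Definition ext_end (V : vectType rat) (f : 'End(V)) : 'M[F]_(\dim {:V}) :=
  map_mx ratr (passmx.mxof (vbasis {:V}) (vbasis {:V}) f).

(* The F-linear extension L (x)_Q F -> W of a Q-linear map f : L -> W to an
   F-vector space. *)
Definition ext_lin (L : vectType rat) (W : lmodType F) (f : L -> W)
    (u : 'rV[F]_(\dim {:L})) : W :=
  \sum_i u 0 i *: f (vbasis {:L})`_i.

(* The F-bilinear extension of a bracket on L. *)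
Definition ext_bracket (L : vectType rat) (br : L -> L -> L)
    (u v : 'rV[F]_(\dim {:L})) : 'rV[F]_(\dim {:L}) :=
  ext_lin (fun x => ext_lin (fun y => ext_vec (br x y)) v) u.

(* The simultaneous eigenspace, for the character s, of the action of K on
   F^n by the rational matrices j; it suffices to test a Q-basis of K. *)
Definition char_space (K : fieldExtType rat) n (j : K -> 'M[rat]_n)
    (s : K -> F) : 'M[F]_n :=
  (\bigcap_(i < \dim {:K})
     eigenspace (map_mx ratr (j (vbasis {:K})`_i)) (s (vbasis {:K})`_i))%MS.

(* The row space of W is a nonzero subspace, stable under all operators
   satisfying P, and minimal among such subspaces. *)
Definition irreducible_subrep n (P : 'M[F]_n -> Prop) (W : 'M[F]_n) : Prop :=
  [/\ W != 0,
      forall X, P X -> stablemx W X &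
      forall U : 'M[F]_n, (U <= W)%MS -> (forall X, P X -> stablemx U X) ->
        U = 0 \/ (W <= U)%MS].

End ScalarExtension.

(** * Quaternion algebras *)

Section Quaternion.
Variables (E : fieldExtType rat) (a b : E).

(* (x0, x1, x2, x3) stands for x0 + x1 i + x2 j + x3 k. *)
Definition quat : Type := (E * E * E * E)%type.

(* i^2 = a, j^2 = b, ij = -ji = k; hence k^2 = -ab, ik = -ki = aj,
   kj = -jk = bi. *)
Definition quat_mul (x y : quat) : quat :=
  let: (x0, x1, x2, x3) := x in
  let: (y0, y1, y2, y3) := y in
  (x0 * y0 + a * (x1 * y1) + b * (x2 * y2) - a * b * (x3 * y3),
   x0 * y1 + x1 * y0 - b * (x2 * y3) + b * (x3 * y2),
   x0 * y2 + x2 * y0 + a * (x1 * y3) - a * (x3 * y1),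
   x0 * y3 + x3 * y0 + x1 * y2 - x2 * y1).

Definition quat_sub (x y : quat) : quat :=
  let: (x0, x1, x2, x3) := x in
  let: (y0, y1, y2, y3) := y in (x0 - y0, x1 - y1, x2 - y2, x3 - y3).

Definition pure_to_quat (x : (E * E * E)%type) : quat :=
  let: (x1, x2, x3) := x in (0, x1, x2, x3).

Definition quat_to_pure (x : quat) : (E * E * E)%type :=
  let: (_, x1, x2, x3) := x in (x1, x2, x3).

(* The commutator of two pure quaternions is pure, so the projection only
   changes the type. *)
Definition pure_bracket (x y : (E * E * E)%type) : (E * E * E)%type :=
  let x' := pure_to_quat x in
  let y' := pure_to_quat y in
  quat_to_pure (quat_sub (quat_mul x' y') (quat_mul y' x')).

End Quaternion.

(* E(a,b)°, the E-span of i, j, k, as a vector space over Q; its Lie bracket is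
   [pure_bracket a b]. *)
Definition pure_quat (E : fieldExtType rat) : vectType rat := (E * E * E)%type.

(** * Lie algebras *)

Definition lie_comm (V : vectType rat) (f g : 'End(V)) : 'End(V) :=
  (f \o g)%VF - (g \o f)%VF.

Section Lie.
Variables (L V : vectType rat) (br : L -> L -> L).

Definition lie_rep (mu : L -> 'End(V)) : Prop :=
  linear mu /\ forall x y, mu (br x y) = lie_comm (mu x) (mu y).

(* For an abelian Lie algebra Z of endomorphisms of V: the sum of mu and of the
   inclusion of Z, as a map on the direct sum of Z and L. *)
Definition sum_incl (mu : L -> 'End(V)) (z : 'End(V)) (x : L) : 'End(V) :=
  z + mu x.

(* [sum_incl mu] is a representation of the direct sum of Lie algebras, in
   which [(z, x), (z', x')] = (0, [x, x']). *)
Definition sum_rep (Z : 'End(V) -> Prop) (mu : L -> 'End(V)) : Prop :=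
  forall z z' x x', Z z -> Z z' ->
    sum_incl mu 0 (br x x') = lie_comm (sum_incl mu z x) (sum_incl mu z' x').

Definition irreducible_sum_rep (Z : 'End(V) -> Prop) (mu : L -> 'End(V)) :
    Prop :=
  (0 < \dim {:V})%N /\
  forall U : {vspace V},
    (forall z x, Z z -> (sum_incl mu z x @: U <= U)%VS) ->
    U = 0%VS \/ U = fullv.

End Lie.

Definition centre (V : vectType rat) (g : 'End(V) -> Prop) (z : 'End(V)) :
    Prop :=
  g z /\ forall x, g x -> lie_comm z x = 0.

Section Sl2.
Variable F : numFieldType.

Definition sl2xsl2 (p : ('M[F]_2 * 'M[F]_2)%type) : Prop :=
  \tr p.1 = 0 /\ \tr p.2 = 0.

Definition sl2xsl2_bracket (p q : ('M[F]_2 * 'M[F]_2)%type) :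
    ('M[F]_2 * 'M[F]_2)%type :=
  (p.1 *m q.1 - q.1 *m p.1, p.2 *m q.2 - q.2 *m p.2).

(* An isomorphism of F-Lie algebras from L (x)_Q F onto sl(2) x sl(2). *)
Definition iso_sl2xsl2 (L : vectType rat) (br : L -> L -> L)
    (Phi : 'rV[F]_(\dim {:L}) -> ('M[F]_2 * 'M[F]_2)%type) : Prop :=
  [/\ linear Phi,
      injective Phi,
      forall p, sl2xsl2 p <-> exists u, Phi u = p &
      forall u v,
        Phi (ext_bracket br u v) = sl2xsl2_bracket (Phi u) (Phi v)].

(* V(1) [x] V(1): the space F^2 (x) F^2 is identified with 'M[F]_2, the tensor
   e_i (x) e_j being the elementary matrix [delta_mx i j]; then (X, Y) acts by
   X (x) 1 + 1 (x) Y. *)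
Definition V1V1_act (p : ('M[F]_2 * 'M[F]_2)%type) (T : 'M[F]_2) : 'M[F]_2 :=
  p.1 *m T + T *m p.2^T.

(* The subspace W of F^n, on which u : L acts by rho u, is isomorphic to
   V(1) [x] V(1) via Phi. *)
Definition iso_V1V1 (L : Type) n (Phi : L -> ('M[F]_2 * 'M[F]_2)%type)
    (rho : L -> 'M[F]_n) (W : 'M[F]_n) : Prop :=
  exists eta : {linear 'M[F]_2 -> 'rV[F]_n},
    [/\ injective eta,
        forall v : 'rV[F]_n, (v <= W)%MS <-> exists T, eta T = v &
        forall u T, eta (V1V1_act (Phi u) T) = eta T *m rho u].

End Sl2.

(** * Linear algebraic groups over Q *)

Section AlgGroup.
Variable n : nat.

(* A set of polynomials in the n * n matrix entries. *)
Definition mx_equations := {mpoly rat[n * n]} -> Prop.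

Definition mx_eval (F : numFieldType) (p : {mpoly rat[n * n]}) (M : 'M[F]_n) :
    F :=
  mmap ratr (fun k => mxvec M 0 k) p.

(* The F-points of the closed subset of GL_n cut out by S. *)
Definition points (F : numFieldType) (S : mx_equations) (M : 'M[F]_n) : Prop :=
  M \in unitmx /\ forall p, S p -> mx_eval p M = 0.

Variable R : realType.

(* S cuts out a Q-subgroup of GL_n; it is enough to test complex points, as
   algebraic groups in characteristic 0 are reduced. *)
Definition q_subgroup (S : mx_equations) : Prop :=
  [/\ points S (1%:M : 'M[R[i]]_n),
      forall M N : 'M[R[i]]_n, points S M -> points S N -> points S (M *m N) &
      forall M : 'M[R[i]]_n, points S M -> points S (invmx M)].

(* The smallest Q-subgroup whose real points contain X, given by the union of
   the equations of all such subgroups. *)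
Definition smallest_q_subgroup (X : 'M[R]_n -> Prop) : mx_equations :=
  fun p => exists S : mx_equations,
    [/\ q_subgroup S, forall M, X M -> points S M & S p].

(* The Lie algebra, i.e. the tangent space at the identity, over Q.  The
   differentials are those of all the polynomials vanishing on the group: S
   itself need not generate a radical ideal. *)
Definition lie_alg (S : mx_equations) (X : 'M[rat]_n) : Prop :=
  forall p : {mpoly rat[n * n]},
    (forall M : 'M[R[i]]_n, points S M -> mx_eval p M = 0) ->
    \sum_k mxvec X 0 k * mx_eval (mderiv k p) (1%:M : 'M[rat]_n) = 0.

End AlgGroup.

(** * Complex abelian varieties *)

Section AbelianVariety.
Variable R : realType.
Local Notation C := R[i].

Definition real_mx m n (M : 'M[R]_(m, n)) : 'M[C]_(m, n) :=
  map_mx (real_complex R) M.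
Definition rat_mx m n (M : 'M[rat]_(m, n)) : 'M[C]_(m, n) := map_mx ratr M.
Definition conj_mx m n (M : 'M[C]_(m, n)) : 'M[C]_(m, n) :=
  map_mx (fun z => (z^*)%R) M.

Section PeriodMatrix.
Variable g : nat.

(* The columns of Pi are a basis of a lattice in C^g, and Q is the matrix in
   this basis of an alternating form, integral on the lattice, such that
   Q(ix, iy) = Q(x, y) and Q(ix, x) > 0 for x != 0.  Vectors of C^g are written
   Pi *m x, with x real. *)
Definition riemann_form (Pi : 'M[C]_(g, g.*2)) (Q : 'M[int]_(g.*2)) : Prop :=
  let Q_R : 'M[R]_(g.*2) := map_mx intr Q in
  let mul_i (x ix : 'cV[R]_(g.*2)) :=
    Pi *m real_mx ix = 'i *: (Pi *m real_mx x) in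
  [/\ Q^T = - Q,
      forall x y ix iy, mul_i x ix -> mul_i y iy ->
        ix^T *m Q_R *m iy = x^T *m Q_R *m y &
      forall x ix, mul_i x ix -> x != 0 -> 0 < (ix^T *m Q_R *m x) 0 0].

(* The quotient of C^g by the lattice spanned by the columns of [period], these
   being linearly independent over R, with a Riemann form. *)
Record abelian_variety := AbelianVariety {
  period : 'M[C]_(g, g.*2);
  period_free : forall x : 'cV[R]_(g.*2), period *m real_mx x = 0 -> x = 0;
  polarizable : exists Q, riemann_form period Q
}.

Variable A : abelian_variety.
Local Notation Pi := (period A).

(* W is spanned over R by the lattice vectors it contains, so that its image in
   A is an abelian subvariety.  All abelian subvarieties are of this form. *)
Definition abelian_subvariety (W : {vspace 'cV[C]_g}) : Prop :=
  forall w, w \in W ->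
    exists m (N : 'M[int]_(g.*2, m)) (c : 'cV[R]_m),
      (forall k, Pi *m map_mx intr (col k N) \in W) /\
      w = Pi *m map_mx intr N *m real_mx c.

Definition simple_av : Prop :=
  (0 < g)%N /\
  forall W, abelian_subvariety W -> W = 0%VS \/ W = fullv.

(* Endomorphisms of A, through their matrices on the lattice. *)
Definition av_end (M : 'M[int]_(g.*2)) : Prop :=
  exists f : 'M[C]_g, f *m Pi = Pi *m map_mx intr M.

(* End(A) (x) Q. *)
Definition av_end_rat (M : 'M[rat]_(g.*2)) : Prop :=
  exists d N, [/\ d != 0 :> int, av_end N & d%:~R *: M = map_mx intr N].

End PeriodMatrix.

(* H^1(A,Q) is 'rV[rat]_(2g), in coordinates in the dual basis of the lattice
   basis.  The holomorphic 1-forms dz_1, ..., dz_g are the rows of the period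
   matrix, so that H^{1,0}(A) is its row space.  An endomorphism with matrix M
   on the lattice acts on H^1 by u |-> u *m M. *)

(* The endomorphism algebra is the image of an imaginary quadratic field K, and
   the two eigenspaces of K on H^{1,0}(A) have dimensions 1 and 3. *)
Definition anti_weil (A : abelian_variety 4) : Prop :=
  exists (K : fieldExtType rat) (j : {linear K -> 'M[rat]_(4.*2)}),
    [/\ imaginary_quadratic K,
        j 1 = 1%:M,
        forall x y, j (x * y) = j x *m j y,
        forall M, av_end_rat A M <-> exists x, j x = M &
        exists s t : {rmorphism K -> C},
          \rank (period A :&: char_space j s)%MS = 1%N /\
          \rank (period A :&: char_space j t)%MS = 3%N].

Section Marked.
Variables (g : nat) (A : abelian_variety g) (V : vectType rat).

(* theta identifies H^1(A,Q) with V. *)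
Variable theta : {linear 'rV[rat]_(g.*2) -> V}.
Local Notation n := (\dim {:V}).

(* Bases, as rows, of the Hodge summands of V (x) C. *)
Definition H10 : 'M[C]_(g, n) :=
  period A *m rat_mx (lin1_mx (passmx.rVof (vbasis {:V}) \o theta)).
Definition H01 : 'M[C]_(g, n) := conj_mx H10.

Definition hodge_end (f : 'End(V)) : Prop :=
  stablemx H10 (ext_end C f) /\ stablemx H01 (ext_end C f).

(* M is the action on V (x) R of the element z of the Deligne torus: z on
   H^{1,0} and its conjugate on H^{0,1}.  (With the convention that inverts z,
   the images of the torus and of its norm one subgroup are the same.) *)
Definition deligne_action (z : C) (M : 'M[R]_n) : Prop :=
  H10 *m real_mx M = z *: H10 /\ H01 *m real_mx M = (z^*)%R *: H01.

Definition mumford_tate_group : mx_equations n :=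
  smallest_q_subgroup (fun M => exists z, z != 0 /\ deligne_action z M).

Definition hodge_group : mx_equations n :=
  smallest_q_subgroup (fun M => exists z, z * (z^*)%R = 1 /\ deligne_action z M).

Definition mt_alg (f : 'End(V)) : Prop :=
  lie_alg R mumford_tate_group
    (passmx.mxof (vbasis {:V}) (vbasis {:V}) f).

Definition hdg_alg (f : 'End(V)) : Prop :=
  lie_alg R hodge_group (passmx.mxof (vbasis {:V}) (vbasis {:V}) f).

(* The form on V induced by a polarization of A: a Riemann form Q identifies
   H_1(A,Q) with H^1(A,Q) via x |-> Q(x, -), and phi is Q transported by this
   identification. *)
Definition polarization_form (phi : V -> V -> rat) : Prop :=
  exists Q, riemann_form (period A) Q /\
    let Q_Q : 'M[rat]_(g.*2) := map_mx intr Q in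
    forall x y : 'cV[rat]_(g.*2),
      phi (theta (x^T *m Q_Q)) (theta (y^T *m Q_Q)) = (x^T *m Q_Q *m y) 0 0.

End Marked.
End AbelianVariety.

(* Main.v *)
(** Write K = Q(w) with w^2 = -d and V = K^4.  Take E = K and a = -1: then E(-1, 1)
    is M_2(K), and its trace zero part acts by h |-> X h + h X^* on the 4-dimensional
    Q-space of Hermitian 2 x 2 matrices over K, preserving the determinant form
    H = diag(1, -1, -1, -1/d).  Extending scalars, mu acts K-linearly on V, preserves
    the Hermitian extension of H, and becomes V(1) [x] V(1) on both eigenspaces
    of K.

    A Hodge structure of anti-Weil type on V, polarized by H, amounts to an H-positive
    line in V (x) R = C^4.  Choose it spanned by a real vector v = (1, b, b^4, b^6),
    where b is a small real algebraic number of degree 13.  Up to a real factor the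
    complex structure is J = w (2 v^T H v - H(v, v)), whose entries are polynomials of
    degree at most 12 in b; the products of two coordinates of v being linearly
    independent over Q, the smallest rational subspace of End(V) whose real
    points contain J contains w and the w (E_0j + h_j E_j0), with h_j = H(e_j, e_j),
    and these generate M_4(K).
    This gives at once that the endomorphism algebra is K and that A is simple; and as
    the Lie algebras of the Hodge and Mumford-Tate groups are rational and contain J over
    the reals, they contain these matrices, so that their centres lie in K and the
    latter centre contains w. *)

Require Import Defs.
From HB Require Import structures.
From mathcomp Require Import all_boot all_order all_algebra all_field.
From mathcomp Require Import complex mpoly reals ring lra.
Import Order.TTheory GRing.Theory Num.Theory.
Import passmx.
Local Open Scope ring_scope.

Set Implicit Arguments.
Unset Strict Implicit.
Unset Printing Implicit Defensive.

(** The Lie algebras of the Hodge and Mumford-Tate groups are never computed but squeezed. From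
    below, the rational subspace argument is used in dual form: [X] lies in the smallest rational
    subspace around [J] once every rational functional [\tr (L *m _)] that kills [J] kills [X]. This
    one criterion, [kmx_moments], serves the endomorphism algebra, simplicity and the Lie algebras
    alike. From above, two explicit Q-groups containing the images of the torus suffice: the
    centralizer of w for Mumford-Tate, the isometry group of the polarization for Hodge. The image
    of mu is not obtained from the Hodge group; the two are linked only through K-linearity and the
    form H. The coefficient -1/d of H comes from w^2 = -d in the off-diagonal entries c2 + c3 w / d
    of a Hermitian matrix. Smallness of b makes H(v, v) positive. Taking v real makes one block of
    the period matrix real and the other i times real, so that freeness over R splits into real and
    imaginary parts. *)

(** * A small real algebraic number of degree 13 *)

(** Eisenstein at 2. The coefficient 8 is large enough to push a real root below 1/2. *)
Lemma irreducible_trinomial :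
  irreducible_poly ('X^13 + 8 *: 'X - 2%:P : {poly rat}).
Proof.
pose q : {poly int} := 'X^13 + (8 *: 'X - 2%:P).
have -> : 'X^13 + 8 *: 'X - 2%:P = map_poly intr q :> {poly rat}.
  apply/polyP => i; rewrite coef_map !coefE /= -addrA.
  by case: i => [|[|i]] //; case: (_ == 13%N).
have sr : (size (8 *: 'X - 2%:P : {poly int})%R <= 2)%N.
  rewrite (leq_trans (size_polyD _ _)) // geq_max size_polyN size_polyC /=.
  by rewrite (leq_trans (size_scale_leq _ _)) ?size_polyX.
have sq : size q = 14%N.
  by rewrite size_polyDl ?size_polyXn // (leq_ltn_trans sr).
apply/irreducible_rat_int; apply: (@eisenstein_crit 2) => //.
- by rewrite sq.
- by rewrite lead_coefE sq !coefE.
- by rewrite !coefE.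
- move=> i; rewrite sq /= => hi; rewrite !coefE (ltn_eqF hi) add0r.
  by case: i hi => [|[|i]] _; rewrite ?mulr0 ?mulr1.
Qed.

(** The trinomial changes sign between 0 and 1/2, which gives b. A rational polynomial vanishing at
    b has a common factor with the irreducible trinomial, so is divisible by it and has degree at
    least 13 unless it is 0. *)
Lemma small_real_independent (R : rcfType) : exists b : R,
  [/\ 0 < b, b < 1 / 2 & forall p : {poly rat}, (size p <= 13)%N ->
      (map_poly ratr p).[b] = 0 -> p = 0].
Proof.
pose q : {poly rat} := 'X^13 + 8 *: 'X - 2%:P.
pose qR : {poly R} := 'X^13 + 8 *: 'X - 2%:P.
have qE : map_poly ratr q = qR.
  rewrite /q /qR rmorphB rmorphD /= map_polyXn map_polyZ /= map_polyX.
  by rewrite map_polyC /= !ratr_nat.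
have q0 : qR.[0] < 0 by rewrite !hornerE; lra.
have qh : 0 < qR.[1 / 2].
  rewrite !hornerE.
  have h : 0 < (1 / 2 : R) ^+ 13 by rewrite exprn_gt0 //; lra.
  by move: h; set z := _ ^+ 13; lra.
have h01 : (0 : R) <= 1 / 2 by lra.
have [|b /andP[b0 b1] rb] := poly_ivt (p := qR) h01; first by rewrite !ltW.
exists b; split.
- rewrite lt_neqAle b0 andbT eq_sym; apply: contraTneq rb => ->.
  by rewrite /root lt_eqF.
- rewrite lt_neqAle b1 andbT; apply: contraTneq rb => ->.
  by rewrite /root gt_eqF.
move=> p sp pb.
have sq : size q = 14%N.
  rewrite /q -addrA size_polyDl ?size_polyXn // (leq_ltn_trans (size_polyD _ _)) //.
  rewrite gtn_max size_polyN size_polyC /= andbT.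
  by rewrite (leq_ltn_trans (size_scale_leq _ _)) ?size_polyX.
apply: contraTeq sp => p0; rewrite -ltnNge.
have [_ irr] := irreducible_trinomial; rewrite -/q in irr.
have rg : root (map_poly ratr (gcdp p q)) b.
  by rewrite gcdp_map root_gcd qE rb andbT /root pb.
have sg : size (gcdp p q) != 1%N.
  apply: contraL rg => /size_poly1P[c c0 ->].
  by rewrite map_polyC rootC fmorph_eq0.
have /eqp_dvdl e := irr _ sg (dvdp_gcdr _ _).
have : q %| p by rewrite -e dvdp_gcdl.
by move/(dvdp_leq p0); rewrite sq.
Qed.

(** * Quadratic fields *)

Section QuadraticField.
Variables (K : fieldExtType rat) (d : rat) (w : K).
Hypotheses (wB : basis_of {:K} [:: 1; w]) (wsq : w * w = - d%:A).

Definition q_re (x : K) : rat := coord [tuple 1; w] 0 x.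
Definition q_im (x : K) : rat := coord [tuple 1; w] 1 x.

Lemma q_reE x : x = q_re x *: 1 + q_im x *: w.
Proof.
have := coord_basis wB (memvf x); rewrite big_ord_recl big_ord1 /=.
by move=> {1}->; congr (coord _ _ _ *: _ + coord _ _ _ *: _); apply/val_inj.
Qed.

Lemma q_reD x y : q_re (x + y) = q_re x + q_re y.
Proof. exact: linearD. Qed.
Lemma q_imD x y : q_im (x + y) = q_im x + q_im y.
Proof. exact: linearD. Qed.
Lemma q_reN x : q_re (- x) = - q_re x.
Proof. exact: linearN. Qed.
Lemma q_imN x : q_im (- x) = - q_im x.
Proof. exact: linearN. Qed.
Lemma q_reZ c x : q_re (c *: x) = c * q_re x.
Proof. exact: linearZ. Qed.
Lemma q_imZ c x : q_im (c *: x) = c * q_im x.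
Proof. exact: linearZ. Qed.

Let coordB (i j : 'I_2) :
  coord [tuple 1; w] j [tuple 1; w]`_i = (i == j)%:R.
Proof. exact: coord_free (basis_free wB). Qed.

Lemma q_re1 : q_re 1 = 1. Proof. exact: (coordB 0 0). Qed.
Lemma q_im1 : q_im 1 = 0. Proof. exact: (coordB 0 1). Qed.
Lemma q_rew : q_re w = 0. Proof. exact: (coordB 1 0). Qed.
Lemma q_imw : q_im w = 1. Proof. exact: (coordB 1 1). Qed.

Lemma q_coords (p q : rat) :
  q_re (p *: 1 + q *: w) = p /\ q_im (p *: 1 + q *: w) = q.
Proof.
rewrite q_reD q_imD !q_reZ !q_imZ q_re1 q_im1 q_rew q_imw.
by rewrite !mulr1 !mulr0 addr0 add0r.
Qed.

Lemma q_mulE x y : x * y =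
  (q_re x * q_re y - d * (q_im x * q_im y)) *: 1
  + (q_re x * q_im y + q_im x * q_re y) *: w.
Proof.
have AE c (z : K) : c *: z = in_alg K c * z by rewrite mulr_algl.
rewrite {1}(q_reE x) {1}(q_reE y) !AE !(rmorphB, rmorphD, rmorphM) /= !mulr1.
set a := (_%:A); set b := (_%:A); set e := (_%:A); set f := (_%:A).
by rewrite -[d%:A]opprK -wsq; ring.
Qed.

Lemma q_reM x y : q_re (x * y) = q_re x * q_re y - d * (q_im x * q_im y).
Proof. by rewrite q_mulE; apply: (q_coords _ _).1. Qed.
Lemma q_imM x y : q_im (x * y) = q_re x * q_im y + q_im x * q_re y.
Proof. by rewrite q_mulE; apply: (q_coords _ _).2. Qed.

Lemma q_morphE (F : numFieldType) (s : {rmorphism K -> F}) x :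
  s x = ratr (q_re x) + ratr (q_im x) * s w.
Proof.
have sZ q y : s (q *: y) = ratr q * s y.
  rewrite -mulr_algl rmorphM; congr (_ * _).
  exact: (fmorph_eq_rat (s \o in_alg K)).
by rewrite {1}(q_reE x) rmorphD /= !sZ rmorph1 mulr1.
Qed.

Lemma q_morph_sqr (F : numFieldType) (s : {rmorphism K -> F}) :
  s w * s w = - ratr d.
Proof.
rewrite -rmorphM wsq rmorphN; congr (- _).
exact: (fmorph_eq_rat (s \o in_alg K)).
Qed.

Section Embedding.
Variables (F : numFieldType) (l : F).
Hypothesis lsq : l * l = - ratr d.

Definition q_emb (x : K) : F := ratr (q_re x) + ratr (q_im x) * l.

Lemma q_embD x y : q_emb (x + y) = q_emb x + q_emb y.
Proof. by rewrite /q_emb q_reD q_imD !rmorphD /=; ring. Qed.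

Lemma q_embM x y : q_emb (x * y) = q_emb x * q_emb y.
Proof.
rewrite /q_emb q_reM q_imM !(rmorphB, rmorphD, rmorphM) /=.
by rewrite -[ratr d]opprK -lsq; ring.
Qed.

Lemma q_emb_ex : exists s : {rmorphism K -> F}, s w = l /\ s =1 q_emb.
Proof.
have zm : zmod_morphism q_emb.
  by move=> x y; apply: (addIr (q_emb y)); rewrite -q_embD !subrK.
have mm : monoid_morphism q_emb.
  split; first by rewrite /q_emb q_re1 q_im1 rmorph1 rmorph0 mul0r addr0.
  exact: q_embM.
pose m1 := GRing.isZmodMorphism.Build K F q_emb zm.
pose m2 := GRing.isMonoidMorphism.Build K F q_emb mm.
pose s : {rmorphism K -> F} := HB.pack q_emb m1 m2.
exists s; split=> //.
by rewrite /= /q_emb q_rew q_imw rmorph0 rmorph1 mul1r add0r.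
Qed.

End Embedding.

End QuadraticField.

(** Completing the square and clearing a denominator turns any irrational element into a square root
    of an integer. A nonnegative integer would have a real square root, hence give a real embedding
    of K. *)
Lemma imaginary_quadratic_gen (K : fieldExtType rat) :
  imaginary_quadratic K -> exists (d : nat) (w : K),
    [/\ (0 < d)%N, basis_of {:K} [:: 1; w] & w * w = - (d%:R : rat)%:A].
Proof.
move=> [dK im].
have [w0 w0N1] : exists w0 : K, w0 \notin <[1 : K]>%VS.
  have /subvPn[w0 _ w0N] : ~~ ({:K} <= <[1%R]>)%VS; last by exists w0.
  by apply/negP => /dimvS; rewrite dK dim_vline oner_eq0.
have basis_w (w : K) : w \notin <[1 : K]>%VS -> basis_of {:K} [:: 1; w].
  move=> wN; rewrite basisEfree subvf dK leqnn andbT /=.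
  rewrite (perm_free (permEl (perm_catC [:: 1] [:: w]))) free_cons.
  by rewrite span_seq1 wN seq1_free oner_eq0.
have B0 := basis_w _ w0N1.
have wN (c e : rat) : c != 0 -> c *: w0 + e%:A \notin <[1 : K]>%VS.
  move=> c0; apply: contra w0N1 => h.
  have -> : w0 = c^-1 *: (c *: w0 + e%:A - e%:A) by rewrite addrK scalerK.
  by rewrite rpredZ // rpredB // memvZ // memv_line.
pose q := q_im w0 (w0 * w0); pose r := q_re w0 (w0 * w0) + q ^+ 2 / 4.
pose w1 := w0 - (q / 2)%:A.
have w1sq : w1 * w1 = r%:A.
  have -> : w1 * w1 = w0 * w0 - (2 * (q / 2)) *: w0 + ((q / 2) ^+ 2)%:A.
    have AE c (t : K) : c *: t = in_alg K c * t by rewrite mulr_algl.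
    rewrite /w1 !AE expr2 !(rmorphM (in_alg K)) rmorph_nat /= !mulr1.
    by ring.
  rewrite {1}(q_reE B0 (w0 * w0)) -/q mulrCA divff // mulr1 addrK -scalerDl.
  by congr (_ *: _); rewrite /r; field.
(* The square of [w2] is r (denq r)^2, that is, the integer [z]. *)
pose z := numq r * denq r; pose w2 := (denq r)%:~R *: w1.
have w2sq : w2 * w2 = (z%:~R : rat)%:A.
  rewrite /w2 -scalerAl -scalerAr w1sq !scalerA; congr (_ *: _).
  by rewrite /z intrM numqE; ring.
have w2N : w2 \notin <[1 : K]>%VS.
  by rewrite /w2 /w1 scalerBr scalerA -scaleNr wN // intr_eq0 denq_neq0.
have B2 := basis_w _ w2N.
have z0 : z < 0.
  rewrite ltNge; apply/negP => z0.
  have sq : sqrtC (z%:~R : algC) * sqrtC z%:~R = - ratr (- z%:~R).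
    by rewrite -expr2 sqrtCK -mulrNz ratr_int mulrNz opprK.
  have w2sq' : w2 * w2 = - (- z%:~R : rat)%:A by rewrite scaleNr opprK.
  have [s [_ sE]] := q_emb_ex B2 w2sq' sq.
  have [x /negP[]] := im s.
  have realQ (t : rat) : (ratr t : algC) \is Num.real.
    by rewrite realE ler0q lerq0 le_total.
  rewrite sE /q_emb; apply: realD => //; apply: realM => //.
  by rewrite realE sqrtC_ge0 ler0z z0.
exists `|z|%N, w2; split=> //; first by rewrite absz_gt0 lt_eqF.
rewrite w2sq -scaleNr natr_absz ltr0_norm //; congr (_ *: _).
by rewrite mulrNz opprK.
Qed.

(** * The algebra M_4(K) in 4 + 4 blocks: generation, commutant, simple module *)

Lemma ord4P (P : 'I_4 -> Prop) : P 0 -> P 1 -> P 2 -> P 3 -> forall i, P i.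
Proof.
move=> p0 p1 p2 p3 [[|[|[|[|i]]]] hi] //.
- by rewrite (_ : Ordinal hi = 0) //; apply/val_inj.
- by rewrite (_ : Ordinal hi = 1) //; apply/val_inj.
- by rewrite (_ : Ordinal hi = 2) //; apply/val_inj.
- by rewrite (_ : Ordinal hi = 3) //; apply/val_inj.
Qed.

Lemma big_ord4 (V : nmodType) (F : 'I_4 -> V) :
  \sum_i F i = F 0 + F 1 + F 2 + F 3.
Proof.
rewrite !big_ord_recl big_ord0 addr0 !addrA.
by congr (F _ + F _ + F _ + F _); apply/val_inj.
Qed.

(* A row (u1, u2) of length 4 + 4 stands for the vector u1 + u2 w of K^4, where
   w^2 = -d.  On such rows, right multiplication by [dmx X] is X, and right
   multiplication by [kmx d X] is w X. *)
Section Blocks.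
Variables (F : comNzRingType) (d : nat).
Implicit Types X Y : 'M[F]_4.

Definition dmx X : 'M[F]_(4 + 4) := block_mx X 0 0 X.
Definition kmx X : 'M[F]_(4 + 4) := block_mx 0 X (- d%:R *: X) 0.

Lemma dmxM X Y : dmx X *m dmx Y = dmx (X *m Y).
Proof.
by rewrite /dmx mulmx_block !(mulmx0, mul0mx) !(addr0, add0r).
Qed.
Lemma dkmxM X Y : dmx X *m kmx Y = kmx (X *m Y).
Proof.
by rewrite /dmx mulmx_block !(mulmx0, mul0mx) !(addr0, add0r) -scalemxAr.
Qed.
Lemma kdmxM X Y : kmx X *m dmx Y = kmx (X *m Y).
Proof.
by rewrite /dmx mulmx_block !(mulmx0, mul0mx) !(addr0, add0r) -scalemxAl.
Qed.
Lemma kmxM X Y : kmx X *m kmx Y = - d%:R *: dmx (X *m Y).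
Proof.
rewrite /dmx mulmx_block !(mulmx0, mul0mx) !(addr0, add0r).
by rewrite -scalemxAl -scalemxAr scale_block_mx !scaler0.
Qed.
Lemma dmxD X Y : dmx (X + Y) = dmx X + dmx Y.
Proof. by rewrite /dmx add_block_mx !addr0. Qed.
Lemma dmxZ c X : dmx (c *: X) = c *: dmx X.
Proof. by rewrite /dmx scale_block_mx !scaler0. Qed.
Lemma dmx1 : dmx 1%:M = 1%:M.
Proof. by rewrite /dmx -scalar_mx_block. Qed.

End Blocks.

Lemma map_kmx (F G : comNzRingType) (f : {rmorphism F -> G}) d (X : 'M[F]_4) :
  map_mx f (kmx d X) = kmx d (map_mx f X).
Proof.
by rewrite /kmx map_block_mx !map_mx0 map_mxZ /= rmorphN rmorph_nat.
Qed.

Lemma map_dmx (F G : comNzRingType) (f : {rmorphism F -> G}) (X : 'M[F]_4) :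
  map_mx f (dmx X) = dmx (map_mx f X).
Proof. by rewrite /dmx map_block_mx !map_mx0. Qed.

Lemma delta_mxM (F : fieldType) m n p (i : 'I_m) (j : 'I_n) (k : 'I_n) (l : 'I_p) :
  delta_mx i j *m delta_mx k l = (j == k)%:R *: delta_mx i l :> 'M[F]_(m, p).
Proof.
have [<-|jk] := eqVneq j k; first by rewrite mul_delta_mx scale1r.
by rewrite mul_delta_mx_0 ?scale0r.
Qed.

(** For a = b = 1 this is the infinitesimal Lorentz boost in the plane of e_0 and e_j; for a = 1 and
    b = h_j it is E_0j + h_j E_j0. *)
Definition boost (F : fieldType) (a b : F) (j : 'I_4) : 'M[F]_4 :=
  a *: delta_mx 0 j + b *: delta_mx j 0.

(* The squares of the boosts along 1 and 2 have product [delta_mx 0 0]. *)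
Lemma boosts_generate (F : fieldType) (A : 'M[F]_4 -> Prop) (a b : 'I_4 -> F) :
    (forall X Y, A X -> A Y -> A (X *m Y)) -> (forall c X, A X -> A (c *: X)) ->
    (forall j, j != 0 -> a j != 0) -> (forall j, j != 0 -> b j != 0) ->
    (forall j, j != 0 -> A (boost (a j) (b j) j)) ->
  forall i j, A (delta_mx i j).
Proof.
move=> AM AZ a0 b0 AB.
have div c X : c != 0 -> A (c *: X) -> A X.
  by move=> c0 /(AZ c^-1); rewrite scalerA mulVf // scale1r.
have sq j : j != 0 -> A (delta_mx 0 0 + delta_mx j j).
  move=> j0; apply: (@div (a j * b j)); first by rewrite mulf_neq0 ?a0 ?b0.
  have := AM _ _ (AB _ j0) (AB _ j0).
  rewrite /boost mulmxDl !mulmxDr -!scalemxAl -!scalemxAr !delta_mxM !eqxx.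
  rewrite (eq_sym 0 j) (negPf j0) !scale0r !scaler0 !scale1r add0r addr0.
  by rewrite !scalerA (mulrC (b j)) -scalerDr.
have A00 : A (delta_mx 0 0).
  have := AM _ _ (sq 1 isT) (sq 2 isT).
  by rewrite mulmxDl !mulmxDr !delta_mxM /= !scale0r scale1r !addr0.
have A0j j : A (delta_mx 0 j).
  have [->//|j0] := eqVneq j 0; apply: (div _ _ (a0 _ j0)).
  have := AM _ _ A00 (AB _ j0).
  rewrite /boost mulmxDr -!scalemxAr !delta_mxM !eqxx.
  by rewrite (eq_sym 0 j) (negPf j0) scale0r scaler0 addr0 scale1r.
have Aj0 j : A (delta_mx j 0).
  have [->//|j0] := eqVneq j 0; apply: (div _ _ (b0 _ j0)).
  have := AM _ _ (AB _ j0) A00.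
  rewrite /boost mulmxDl -!scalemxAl !delta_mxM !eqxx.
  by rewrite (negPf j0) scale0r scaler0 add0r scale1r.
by move=> i j; have := AM _ _ (Aj0 i) (A0j j); rewrite mul_delta_mx.
Qed.

Lemma comm_delta_scalar (F : fieldType) n (A : 'M[F]_n.+1) :
  (forall i j, A *m delta_mx i j = delta_mx i j *m A) -> A = (A 0 0)%:M.
Proof.
move=> cA; apply/matrixP => i j.
have /matrixP/(_ i 0) := cA j 0; rewrite !mxE.
rewrite (bigD1 j) //= big1 => [|k /negPf kj]; last by rewrite !mxE kj /= mulr0.
rewrite (bigD1 0) //= big1 => [|k /negPf kj]; last by rewrite !mxE kj andbF mul0r.
by rewrite !mxE !eqxx /= andbT mulr1 !addr0 => ->; rewrite mulr_natl.
Qed.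

(** Commuting with the elementary matrices makes the two upper blocks scalar, and commuting with w
    expresses the lower blocks through the upper ones. Over Q: the commutant of M_4(K) is K. *)
Lemma commutant_scalar (F : fieldType) d (M : 'M[F]_(4 + 4)) :
    M *m kmx d 1%:M = kmx d 1%:M *m M ->
    (forall i j, M *m dmx (delta_mx i j) = dmx (delta_mx i j) *m M) ->
  exists p q, M = p%:M + q *: kmx d 1%:M.
Proof.
rewrite -[M]submxK; set A := ulsubmx M; set B := ursubmx M.
set C := dlsubmx M; set D := drsubmx M => ck cd.
have cb i j : [/\ A *m delta_mx i j = delta_mx i j *m A &
                  B *m delta_mx i j = delta_mx i j *m B].
  have := cd i j; rewrite !mulmx_block !(mulmx0, mul0mx) !(addr0, add0r).
  by case/eq_block_mx.
have eA := comm_delta_scalar (fun i j => (cb i j).1).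
have eB := comm_delta_scalar (fun i j => (cb i j).2).
move: ck; rewrite !mulmx_block !(mulmx0, mul0mx) !(addr0, add0r).
rewrite -!scalemxAr -!scalemxAl !mulmx1 !mul1mx => /eq_block_mx[eC eD _ _].
exists (A 0 0), (B 0 0); rewrite -eC -eD /kmx scale_block_mx !scaler0.
rewrite (scalar_mx_block 4 4) add_block_mx !(addr0, add0r) -eA scalerA mulrC -scalerA.
by rewrite scalemx1 -eB.
Qed.

(** By anisotropy of a x^2 - b y^2 the block matrix, of square ab, generates a quadratic field, and
    F^8 is the simple module of the 4 x 4 matrices over that field. A predicate [P] is used because
    the lemma is applied both to subspaces of V and to the rational vectors of a complex
    subspace. *)
Lemma transitive_rows (F : fieldType) (a b : F) (P : 'rV[F]_(4 + 4) -> Prop) :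
    (forall x y, a * x ^+ 2 = b * y ^+ 2 -> x = 0 /\ y = 0) ->
    (forall c u v, P u -> P v -> P (c *: u + v)) ->
    (forall u, P u -> P (u *m block_mx 0 a%:M b%:M 0)) ->
    (forall i j u, P u -> P (u *m dmx (delta_mx i j))) ->
  forall u, P u -> u != 0 -> forall v, P v.
Proof.
move=> ab PL PW PD u Pu u0.
have P0 : P 0 by have := PL (-1) _ _ Pu Pu; rewrite scaleN1r addNr.
have PZ c v : P v -> P (c *: v) by move=> line_coef; rewrite -[c *: v]addr0; apply: PL.
have [j [x [y [uE xy]]]] : exists j x y,
    (forall k, u *m dmx (delta_mx j k) = row_mx (x *: delta_mx 0 k) (y *: delta_mx 0 k))
    /\ (x != 0) || (y != 0).
  have [/existsP[j xy]|/existsPn n0] :=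
    boolP [exists j, (lsubmx u 0 j != 0) || (rsubmx u 0 j != 0)].
    exists j, (lsubmx u 0 j), (rsubmx u 0 j); split=> // k.
    rewrite -{1}[u]hsubmxK mul_row_block !mulmx0 addr0 add0r.
    by congr row_mx; rewrite -(mul_delta_mx (0 : 'I_1) j k) mulmxA -colE
      (mx11_scalar (col _ _)) mul_scalar_mx !mxE.
  case/eqP: u0; rewrite -[u]hsubmxK; apply/rowP => k.
  rewrite !mxE; case: (split k) => l; have := n0 l; rewrite negb_or !negbK !mxE.
    by case/andP=> /eqP.
  by case/andP=> _ /eqP.
have Pk k : P (row_mx (delta_mx 0 k) 0) /\ P (row_mx 0 (delta_mx 0 k)).
  have P1 : P (row_mx (x *: delta_mx 0 k) (y *: delta_mx 0 k)).
    by rewrite -uE; apply: PD.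
  (* The pairs (x, y) and (b y, a x) have determinant a x^2 - b y^2 up to sign, so both unit vectors
     at k follow by Cramer's rule. *)
  have P2 : P (row_mx (b * y *: delta_mx 0 k) (a * x *: delta_mx 0 k)).
    have := PW _ P1; rewrite mul_row_block !mulmx0 add0r addr0 !mul_mx_scalar.
    by rewrite !scalerA.
  have D0 : a * x ^+ 2 - b * y ^+ 2 != 0.
    apply/eqP => /eqP; rewrite subr_eq0 => /eqP/ab[x0 y0].
    by move: xy; rewrite x0 y0 eqxx.
  split.
    have := PL (- y) _ _ P2 (PZ (a * x) _ P1).
    rewrite !scale_row_mx add_row_mx !scalerA -!scalerDl.
    rewrite (_ : - y * (a * x) + _ = 0) ?scale0r; last by ring.
    move/(PZ (a * x ^+ 2 - b * y ^+ 2)^-1); rewrite scale_row_mx scaler0 scalerA.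
    by rewrite (_ : _ * _ = 1) ?scale1r //; field.
  have := PL x _ _ P2 (PZ (- (b * y)) _ P1).
  rewrite !scale_row_mx add_row_mx !scalerA -!scalerDl.
  rewrite (_ : x * (b * y) + _ = 0) ?scale0r; last by ring.
  move/(PZ (a * x ^+ 2 - b * y ^+ 2)^-1); rewrite scale_row_mx scaler0 scalerA.
  by rewrite (_ : _ * _ = 1) ?scale1r //; field.
move=> v; rewrite -[v]hsubmxK; set v1 := lsubmx v; set v2 := rsubmx v.
have PD2 u' v' : P u' -> P v' -> P (u' + v').
  by move=> pu /(PL 1 _ _ pu); rewrite scale1r.
have -> : row_mx v1 v2 = row_mx v1 0 + row_mx 0 v2.
  by rewrite add_row_mx addr0 add0r.
apply: (PD2).
  rewrite [v1]row_sum_delta; apply: (big_ind (fun x => P (row_mx x 0))) => [|x1 x2 p1 p2|k _].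
  - by rewrite row_mx0.
  - by rewrite -[0]addr0 -add_row_mx; apply: PD2.
  - by rewrite -(scaler0 _ (v1 0 k)) -scale_row_mx; apply/PZ/(Pk k).1.
rewrite [v2]row_sum_delta; apply: (big_ind (fun x => P (row_mx 0 x))) => [|x1 x2 p1 p2|k _].
- by rewrite row_mx0.
- by rewrite -[0]addr0 -add_row_mx; apply: PD2.
- by rewrite -(scaler0 _ (v2 0 k)) -scale_row_mx; apply/PZ/(Pk k).2.
Qed.

(** * Period matrix *)

Definition form_coef (F : fieldType) (d : nat) (r : 'I_4) : F :=
  if r == 0 then 1 else if r == 3 then - d%:R^-1 else -1.

(* A Sidon set: the 10 sums of two elements are distinct, and at most 12. *)
Definition sidon (r : 'I_4) : nat := nth 0%N [:: 0; 1; 4; 6]%N r.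

Section Moment.
Variables (R : rcfType) (d : nat) (b : R).
Hypothesis d0 : (0 < d)%N.
Hypothesis b_indep : forall p : {poly rat}, (size p <= 13)%N ->
  (map_poly ratr p).[b] = 0 -> p = 0.

Definition line_coef (r : 'I_4) : R := b ^+ sidon r.
Definition line_norm : R := \sum_r form_coef R d r * line_coef r ^+ 2.
(* N (2 P - 1), with P the projection on the line of v = [line_coef], orthogonal
   for the form H = diag(1, -1, -1, -1/d), and N = H(v, v) = [line_norm]. *)
Definition refl_mx : 'M[R]_4 :=
  \matrix_(i, j) (2 * form_coef R d i * line_coef i * line_coef j - (i == j)%:R * line_norm).

Definition refl_poly i j : {poly rat} :=
  (2 * form_coef rat d i) *: 'X^(sidon i + sidon j)
  - (i == j)%:R *: \sum_r form_coef rat d r *: 'X^(2 * sidon r).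

Lemma ratr_form_coef i : ratr (form_coef rat d i) = form_coef R d i.
Proof.
rewrite /form_coef; case: ifP => _; first by rewrite rmorph1.
by case: ifP => _; rewrite rmorphN ?fmorphV ?rmorph1 ?rmorph_nat.
Qed.

Lemma refl_polyE i j : (map_poly ratr (refl_poly i j)).[b] = refl_mx i j.
Proof.
rewrite mxE rmorphB /= !map_polyZ /= rmorph_sum /= map_polyXn.
rewrite hornerD hornerN !hornerZ hornerXn rmorphM /= !ratr_nat ratr_form_coef exprD mulrA.
congr (_ - _ * _); rewrite horner_sum; apply: eq_bigr => r _.
by rewrite map_polyZ /= map_polyXn hornerZ hornerXn ratr_form_coef mulnC exprM.
Qed.

(* The entries of [refl_mx] are combinations of 1, b, ..., b^12; each coefficient
   of a rational relation between them must vanish. *)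
Lemma moment_independent (L : 'M[rat]_4) :
    \sum_i \sum_j ratr (L i j) * refl_mx i j = 0 ->
  \tr L = 0 /\ forall j, j != 0 -> L 0 j + form_coef rat d j * L j 0 = 0.
Proof.
pose p := \sum_i \sum_j L i j *: refl_poly i j => eL.
have cp k : p`_k = \sum_i \sum_j L i j * ((2 * form_coef rat d i) * (k == sidon i + sidon j)%:R
    - (i == j)%:R * \sum_r form_coef rat d r * (k == 2 * sidon r)%:R).
  rewrite /p coef_sum; apply: eq_bigr => i _; rewrite coef_sum.
  apply: eq_bigr => j _; rewrite coefZ coefB !coefZ coefXn coef_sum; congr (_ * (_ - _ * _)).
  by apply: eq_bigr => r _; rewrite coefZ coefXn.
have sidon_le i : (sidon i <= 6)%N by elim/ord4P: i.
have p0 : p = 0.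
  apply: b_indep.
    apply/leq_sizeP => k hk; rewrite cp big1 // => i _; rewrite big1 // => j _.
    rewrite gtn_eqF; last first.
      by rewrite (leq_trans _ hk) // ltnS (leq_add (sidon_le i) (sidon_le j)).
    rewrite big1 ?mulr0 ?subrr ?mulr0 // => r _.
    by rewrite gtn_eqF ?mulr0 // (leq_trans _ hk) // ltnS (leq_mul (leqnn 2) (sidon_le r)).
  rewrite /p -[RHS]eL rmorph_sum horner_sum; apply: eq_bigr => i _.
  rewrite rmorph_sum horner_sum; apply: eq_bigr => j _.
  by rewrite /= map_polyZ hornerZ refl_polyE.
have c k : p`_k = 0 by rewrite p0 coef0.
have dr0 : d%:R != 0 :> rat by rewrite pnatr_eq0 -lt0n.
(* The exponents 1, 4, 6 arise only as 0 + 1, 0 + 4, 0 + 6 and give the conditions on L 0 j and L j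
   0. The doubled exponents 0, 2, 8, 12 give h_r (2 L r r - tr L) = 0; summing 2 L r r = tr L over r
   yields tr L = 0. *)
move: (c 0) (c 1) (c 2) (c 4) (c 6) (c 8) (c 12)%N.
rewrite !cp !big_ord4 /form_coef /=; set e := d%:R^-1 => c0 c1 c2 c4 c6 c8 c12.
have e0 : e != 0 by rewrite invr_eq0.
have {}c12 : 2 * L 3 3 = L 0 0 + L 1 1 + L 2 2 + L 3 3.
  by apply/(mulfI e0)/eqP; rewrite -subr_eq0 -oppr_eq0 -c12; apply/eqP; ring.
split; first by rewrite /mxtrace big_ord4; lra.
apply: ord4P => //= _; first by lra.
- by lra.
- have : 2 * (L 0 3 - e * L 3 0) = 0 by rewrite -[RHS]c6; ring.
  by move/eqP; rewrite mulf_eq0 pnatr_eq0 /= => /eqP <-; ring.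
Qed.
End Moment.

Section Period.
Variables (R : realType) (d : nat) (b : R).
Hypothesis d0 : (0 < d)%N.
Hypothesis b_gt0 : 0 < b.
Hypothesis b_lt : b < 1 / 2.
Local Notation C := R[i].
Local Notation N := (line_norm d b).
Local Notation S := (refl_mx d b).

(** The inverses of the h_r: the form on the lattice is dual to the one on H^1, and this dual is
    integral. *)
Definition dual_coef (r : 'I_4) : int := if r == 0 then 1 else if r == 3 then - d%:Z else -1.
Definition Gmx : 'M[int]_4 := diag_mx (\row_r dual_coef r).
Definition GR : 'M[R]_4 := map_mx intr Gmx.
Definition HR : 'M[R]_4 := diag_mx (\row_r form_coef R d r).
Definition vR : 'rV[R]_4 := \row_r line_coef b r.
(** The signs with which [refl_mx] acts on the rows of [UR], and w on the rows of the period
    matrix. *)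
Definition DR : 'M[R]_4 := diag_mx (\row_r (if r == 0 then 1 else -1)).
(* The rows are v and a basis of its H-orthogonal complement. *)
Definition UR : 'M[R]_4 := \matrix_(i, j) if i == 0 then line_coef b j
  else (i == j)%:R - (j == 0)%:R * (form_coef R d i * line_coef b i).

Lemma dR0 : d%:R != 0 :> R. Proof. by rewrite pnatr_eq0 -lt0n. Qed.

Lemma line_coef0 : line_coef b 0 = 1. Proof. by []. Qed.
Lemma form_coef0 : form_coef R d 0 = 1. Proof. by []. Qed.

Lemma N_E : N = 1 - (line_coef b 1 ^+ 2 + line_coef b 2 ^+ 2 + line_coef b 3 ^+ 2 / d%:R).
Proof. by rewrite /line_norm big_ord4 line_coef0 /form_coef /=; ring. Qed.

(** Each of the three positive terms subtracted from 1 is below 1/4, as b < 1/2. *)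
Lemma N_bounds : 0 < N /\ N < 1.
Proof.
rewrite N_E; set x := line_coef b 1; set y := line_coef b 2; set z := line_coef b 3.
have b1 : b < 1 by move: b_lt; lra.
have pvb (k : nat) : 0 < b ^+ k.+1 <= b.
  by rewrite exprn_gt0 // exprS ger_pMr // exprn_ile1 // ltW.
have sq (t : R) : 0 < t <= b -> 0 < t ^+ 2 < 1 / 4.
  move=> /andP[t0 tb]; rewrite exprn_gt0 //= expr2.
  have -> : 1 / 4 = (1 / 2) * (1 / 2) :> R by field.
  by rewrite ltr_pM ?ltW // (le_lt_trans tb).
have /andP[x0 x1] : 0 < x ^+ 2 < 1 / 4 by apply/sq/(pvb 0%N).
have /andP[y0 y1] : 0 < y ^+ 2 < 1 / 4 by apply/sq/(pvb 3%N).
have /andP[z0 z1] : 0 < z ^+ 2 < 1 / 4 by apply/sq/(pvb 5%N).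
have d1 : (1 : R) <= d%:R by rewrite ler1n.
have zd : 0 < z ^+ 2 / d%:R by rewrite divr_gt0 // ltr0n.
have zd1 : z ^+ 2 / d%:R <= z ^+ 2.
  by rewrite ler_pdivrMr ?ltr0n // ler_peMr // ltW.
by split; lra.
Qed.
Lemma N_gt0 : 0 < N. Proof. by have [] := N_bounds. Qed.
Lemma N_neq0 : N != 0. Proof. by rewrite gt_eqF // N_gt0. Qed.

Lemma vHv : vR *m HR *m vR^T = N%:M.
Proof.
apply/rowP => i; rewrite ord1 mul_mx_diag !mxE /= mulr1n.
by apply: eq_bigr => r _; rewrite !mxE; ring.
Qed.

Lemma refl_mxE : S = 2 *: (HR *m vR^T *m vR) - N%:M.
Proof.
apply/matrixP => i j; rewrite mul_diag_mx !mxE big_ord1 !mxE.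
by case: eqP => _ /=; rewrite ?mulr1n ?mulr0n; ring.
Qed.

Lemma HG : HR *m GR = 1%:M.
Proof.
rewrite /GR map_diag_mx mul_diag_mx; apply/matrixP => i j.
rewrite !mxE; case: (i == j); last by rewrite !mulr0n mulr0.
rewrite !mulr1n /form_coef /dual_coef; case: ifP => _; first by rewrite mulr1.
by case: ifP => _; rewrite ?mulrN1 ?opprK // rmorphN mulrNN mulVf // dR0.
Qed.

(** The rows of [UR] other than v are H-orthogonal to v, so the rank one part of S kills them and
    sends v to 2 N v. *)
Lemma US : UR *m S = N *: (DR *m UR).
Proof.
rewrite refl_mxE mulmxBr -scalemxAr mul_mx_scalar.
have -> : UR *m (HR *m vR^T *m vR) = N *: (delta_mx 0 0 *m UR).
  have -> : UR *m (HR *m vR^T *m vR) = UR *m (HR *m vR^T) *m vR.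
    by rewrite !mulmxA.
  have -> : UR *m (HR *m vR^T) = N *: delta_mx 0 0.
    apply/colP => i; rewrite mul_diag_mx !mxE eqxx andbT.
    have [->|i0] := eqVneq i 0.
      by rewrite mulr1; apply: eq_bigr => r _; rewrite !mxE /=; ring.
    rewrite mulr0 (bigD1 i) //= (bigD1 0) ?(eq_sym 0 i) //= big1.
      by rewrite !mxE /= (negPf i0) eqxx line_coef0 form_coef0 /=; ring.
    move=> r /andP[ri r0]; rewrite !mxE (negPf i0) (eq_sym i r) (negPf ri) (negPf r0) /=.
    by ring.
  rewrite -!scalemxAl; congr (_ *: _); apply/matrixP => i j.
  rewrite !mxE big_ord1 !mxE (bigD1 0) //= big1 => [|k k0]; last first.
    by rewrite mxE (negPf k0) andbF mul0r.
  by rewrite !mxE /= andbT addr0.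
rewrite scalerA mulrC -scalerA -scalerBr; congr (_ *: _).
apply/matrixP => i j; rewrite mul_diag_mx.
rewrite !mxE (bigD1 0) //= big1 => [|k k0]; last first.
  by rewrite mxE (negPf k0) andbF mul0r.
by rewrite !mxE /= andbT addr0; case: (i == 0); rewrite ?mulr1n ?mulr0n; ring.
Qed.

(** The rows i > 0 express x_i through x_0; row 0 then reads N x_0 = 0. *)
Lemma UR_free (x : 'cV[R]_4) : UR *m x = 0 -> x = 0.
Proof.
move=> e; have e' i : \sum_j UR i j * x j 0 = 0.
  by have /colP/(_ i) := e; rewrite !mxE.
have xr i : i != 0 -> x i 0 = form_coef R d i * line_coef b i * x 0 0.
  move=> i0; have := e' i; rewrite (bigD1 i) //= (bigD1 0) ?(eq_sym 0 i) //= big1.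
    by rewrite !mxE /= (negPf i0) eqxx => h; apply/eqP; rewrite -subr_eq0 -h; apply/eqP => /=; ring.
  move=> r /andP[ri r0]; rewrite !mxE (negPf i0) (eq_sym i r) (negPf ri) (negPf r0) /=.
  by ring.
have x0 : x 0 0 = 0.
  have : N * x 0 0 = 0.
    rewrite -[RHS](e' 0) /line_norm mulr_suml; apply: eq_bigr => r _; rewrite !mxE /=.
    have [->|r0] := eqVneq r 0; first by rewrite form_coef0 line_coef0; ring.
    by rewrite (xr _ r0); ring.
  by move/eqP; rewrite mulf_eq0 (negPf N_neq0) => /eqP.
apply/colP => i; rewrite mxE; have [->//|i0] := eqVneq i 0.
by rewrite xr // x0 mulr0.
Qed.

Lemma SG : S^T *m GR = 2 *: (vR^T *m vR) - N *: GR.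
Proof.
rewrite refl_mxE linearB linearZ /= !trmx_mul trmxK tr_scalar_mx mulmxBl mul_scalar_mx.
rewrite -scalemxAl -!mulmxA (_ : HR^T *m GR = 1%:M) ?mulmx1 //.
by rewrite tr_diag_mx HG.
Qed.

(** S / N is a reflection, hence an isometry; on columns, of the dual form G. *)
Lemma SGS : S^T *m GR *m S = N ^+ 2 *: GR.
Proof.
rewrite SG refl_mxE mulmxBl !mulmxBr -!scalemxAl -!scalemxAr !mul_mx_scalar.
have GH : GR *m HR = 1%:M by apply: mulmx1C; exact: HG.
have -> : vR^T *m vR *m (HR *m vR^T *m vR) = N *: (vR^T *m vR).
  rewrite (_ : _ *m _ = vR^T *m (vR *m HR *m vR^T) *m vR) ?mulmxA //.
  by rewrite -(mulmxA _ vR) -(mulmxA _ (vR *m HR)) vHv mul_mx_scalar scalemxAl.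
have -> : GR *m (HR *m vR^T *m vR) = vR^T *m vR by rewrite !mulmxA GH mul1mx.
apply/matrixP => i j; rewrite !mxE; ring.
Qed.

(* The reverse Cauchy-Schwarz inequality for a form of signature (1, 3). *)
Lemma SG_pos (x : 'cV[R]_4) : x != 0 -> 0 < (x^T *m (S^T *m GR) *m x) 0 0.
Proof.
move=> x0.
set m := line_coef b 1 ^+ 2 + line_coef b 2 ^+ 2 + line_coef b 3 ^+ 2 / d%:R.
have Nm : N = 1 - m by rewrite N_E.
have [] := N_bounds; rewrite Nm => m1 m0.
set v1 := line_coef b 1 in m Nm m1 m0 *; set v2 := line_coef b 2 in m Nm m1 m0 *.
set v3 := line_coef b 3 in m Nm m1 m0 *.
have dp : 0 < d%:R :> R by rewrite ltr0n.
pose y i := x i 0.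
pose s := v1 * y 1 + v2 * y 2 + v3 * y 3.
pose q := y 1 ^+ 2 + y 2 ^+ 2 + d%:R * y 3 ^+ 2.
(* Cauchy-Schwarz by Lagrange's identity, the last coordinate being weighted by d. *)
have CS : s ^+ 2 <= m * q.
  rewrite -subr_ge0.
  have -> : m * q - s ^+ 2 = (v1 * y 2 - v2 * y 1) ^+ 2
     + ((v1 * y 3 * d%:R - v3 * y 1) ^+ 2 + (v2 * y 3 * d%:R - v3 * y 2) ^+ 2) / d%:R.
    by rewrite /m /q /s; field; rewrite dR0.
  by rewrite addr_ge0 ?sqr_ge0 // divr_ge0 ?(ltW dp) // addr_ge0 ?sqr_ge0.
have -> : (x^T *m (S^T *m GR) *m x) 0 0 =
    (1 + m) * y 0 ^+ 2 + 4 * y 0 * s + 2 * s ^+ 2 + (1 - m) * q.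
  rewrite SG Nm mulmxBr mulmxBl -!scalemxAr -!scalemxAl.
  have -> : x^T *m (vR^T *m vR) *m x = ((y 0 + s) ^+ 2)%:M.
    have -> : x^T *m (vR^T *m vR) *m x = (vR *m x)^T *m (vR *m x).
      by rewrite trmx_mul !mulmxA.
    have -> : vR *m x = (y 0 + s)%:M.
      by apply/rowP => i;
        rewrite ord1 !mxE /= mulr1n big_ord4 !mxE line_coef0 /s /y /v1 /v2 /v3; ring.
    by rewrite tr_scalar_mx -scalar_mxM.
  have -> : x^T *m GR *m x = (y 0 ^+ 2 - q)%:M.
    apply/rowP => i; rewrite ord1 /GR map_diag_mx mul_mx_diag !mxE /= mulr1n big_ord4 !mxE /=.
    by rewrite /q /y /dual_coef /= !rmorphN /=; ring.
  by rewrite !mxE /= !mulr1n; ring.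
have q0 : 0 <= q.
  by rewrite /q !addr_ge0 ?sqr_ge0 // mulr_ge0 ?sqr_ge0 ?(ltW dp).
have mp : 0 <= m by rewrite /m !addr_ge0 ?sqr_ge0 // divr_ge0 ?sqr_ge0 ?(ltW dp).
have m1p : 0 < 1 + m by lra.
rewrite -(pmulr_rgt0 _ m1p).
(* Completing the square in y 0; the remainder is nonnegative by [CS], and positive unless q = 0. *)
have -> : (1 + m) * ((1 + m) * y 0 ^+ 2 + 4 * y 0 * s + 2 * s ^+ 2 + (1 - m) * q) =
   ((1 + m) * y 0 + 2 * s) ^+ 2 + ((1 - m) ^+ 2 * q + 2 * (1 - m) * (m * q - s ^+ 2)).
  by ring.
have t2 : 0 <= 2 * (1 - m) * (m * q - s ^+ 2) by rewrite mulr_ge0 ?subr_ge0 // mulr_ge0 // ltW.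
have [q1|qn] := eqVneq q 0; last first.
  have qp : 0 < q by rewrite lt_neqAle eq_sym qn.
  apply: ltr_wpDl; first exact: sqr_ge0.
  by apply: ltr_pwDl; rewrite ?mulr_gt0 // exprn_gt0.
have : (y 1 ^+ 2 == 0) && (y 2 ^+ 2 == 0) && (d%:R * y 3 ^+ 2 == 0).
  rewrite -paddr_eq0 ?sqr_ge0 // -paddr_eq0 ?addr_ge0 ?sqr_ge0 //.
    by rewrite -/q q1.
  by rewrite mulr_ge0 ?sqr_ge0 ?ltW.
rewrite !sqrf_eq0 mulf_eq0 (negPf dR0) sqrf_eq0 /= => /andP[/andP[/eqP y1 /eqP y2] /eqP y3].
have s0 : s = 0 by rewrite /s y1 y2 y3; ring.
have y0 : y 0 != 0.
  apply: contraNneq x0 => y0; apply/eqP/colP; apply: ord4P; by rewrite mxE.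
apply: ltr_pwDl; last by rewrite addr_ge0 // mulr_ge0 ?sqr_ge0.
by rewrite s0 mulr0 addr0 exprn_even_gt0 //= mulf_neq0 // gt_eqF.
Qed.

End Period.

Lemma real_imag_eq0 (R : realType) m n (A B : 'M[R]_(m, n)) :
  real_mx A + 'i%C *: real_mx B = 0 -> A = 0 /\ B = 0.
Proof.
move=> e; have e' i j : A i j = 0 /\ B i j = 0.
  have /matrixP/(_ i j) := e; rewrite !mxE.
  by have /= <- := complexE (Complex (A i j) (B i j)) => -[].
by split; apply/matrixP => i j; rewrite mxE; case: (e' i j).
Qed.

Section Period.
Local Open Scope complex_scope.
Variables (R : realType) (d : nat) (b : R).
Hypothesis d0 : (0 < d)%N.
Hypothesis b_gt0 : 0 < b.
Hypothesis b_lt : b < 1 / 2.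
Local Notation C := R[i].
Local Notation N := (line_norm d b).
Local Notation S := (refl_mx d b).

Definition sqrt_disc : R := Num.sqrt d%:R.
(* H^{1,0} is spanned by v in the eigenspace of K where w acts by i sqrt d and by
   the H-orthogonal complement of v in the other one. *)
Definition Pimx : 'M[C]_(4, 4 + 4) :=
  row_mx (('i * sqrt_disc%:C) *: real_mx (DR R *m UR d b)) (real_mx (UR d b)).
(** Multiplication by i: as S^2 = N^2 and w^2 = -d, the factor normalizes the square to -1. *)
Definition Jmx : 'M[R]_(4 + 4) := (sqrt_disc * N)^-1 *: kmx d S.
(** The coefficient of w in the Hermitian extension of G to K^4, a column (x1, x2) standing for x2 +
    x1 w. *)
Definition Qmx : 'M[int]_(4 + 4) := block_mx 0 (Gmx d) (- Gmx d) 0.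

Lemma sqrt_disc_sqr : sqrt_disc * sqrt_disc = d%:R.
Proof. by rewrite -expr2 sqr_sqrtr ?ler0n. Qed.
Lemma sqrt_disc_gt0 : 0 < sqrt_disc.
Proof. by rewrite sqrtr_gt0 ltr0n. Qed.
Lemma deltaN_gt0 : 0 < sqrt_disc * N.
Proof. by rewrite mulr_gt0 ?sqrt_disc_gt0 // N_gt0. Qed.

Lemma DR2 : DR R *m DR R = 1%:M.
Proof.
rewrite mulmx_diag -diag_const_mx; congr diag_mx; apply/rowP => i; rewrite !mxE.
by case: (i == 0); rewrite ?mulrNN mulr1.
Qed.

(** The product is U x2 + i sqrt(d) D U x1 with real U, D, x1, x2, so its two parts vanish
    separately and [UR_free] applies to each. *)
Lemma Pimx_free (x : 'cV[R]_(4 + 4)) : Pimx *m real_mx x = 0 -> x = 0.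
Proof.
rewrite -[x]vsubmxK; set x1 := usubmx x; set x2 := dsubmx x.
rewrite /real_mx map_col_mx mul_row_col -scalemxAl -!map_mxM addrC -scalerA.
rewrite -(map_mxZ (real_complex R)).
case/real_imag_eq0 => /(UR_free d0 b_gt0 b_lt) -> e.
suff -> : x1 = 0 by rewrite col_mx0.
apply: (UR_free d0 b_gt0 b_lt).
have : sqrt_disc *: (UR d b *m x1) = 0.
  rewrite -[UR d b *m x1]mul1mx -DR2 -!mulmxA (mulmxA (DR R) (UR _ _)) scalemxAr e.
  by rewrite mulmx0.
by move/eqP; rewrite scaler_eq0 gt_eqF ?sqrt_disc_gt0 //= => /eqP.
Qed.

Lemma Pimx_free_mx m (X : 'M[R]_(4 + 4, m)) : Pimx *m real_mx X = 0 -> X = 0.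
Proof.
move=> e; apply/matrixP => i j; rewrite mxE.
have /colP/(_ i) : col j X = 0; last by rewrite !mxE.
apply: Pimx_free.
by rewrite colE /real_mx map_mxM mulmxA -/(real_mx X) e mul0mx.
Qed.

Lemma PiJ : Pimx *m real_mx Jmx = 'i *: Pimx.
Proof.
have e : Pimx *m real_mx (kmx d S) = ('i * (sqrt_disc * N)%:C) *: Pimx.
  rewrite /real_mx map_block_mx !map_mx0 mul_row_block !mulmx0 add0r addr0.
  rewrite -scalemxAl -!map_mxM -mulmxA US // -!scalemxAr mulmxA DR2 mul1mx US //.
  rewrite scale_row_mx scalerA !map_mxZ /= !scalerA; congr row_mx; last first.
    by congr (_ *: _); rewrite rmorphM mulrA.
  congr (_ *: _); rewrite [RHS]mulrACA -['i * 'i]expr2 sqr_i mulN1r -!rmorphM -rmorphN.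
  by rewrite -sqrt_disc_sqr; congr (_%:C); ring.
rewrite /Jmx /real_mx map_mxZ -scalemxAr -/(real_mx _) e scalerA.
congr (_ *: _); rewrite mulrCA -rmorphM mulVf ?mulr1 //.
by rewrite gt_eqF // deltaN_gt0.
Qed.

(** Turns the relation by which [riemann_form] describes multiplication by i into the matrix J. *)
Lemma Jmx_uniq (x ix : 'cV[R]_(4 + 4)) :
  Pimx *m real_mx ix = 'i *: (Pimx *m real_mx x) -> ix = Jmx *m x.
Proof.
move=> e; apply/eqP; rewrite -subr_eq0; apply/eqP/Pimx_free.
rewrite /real_mx map_mxB map_mxM mulmxBr e mulmxA -[map_mx _ Jmx]/(real_mx _).
by rewrite PiJ scalemxAl subrr.
Qed.

Lemma Jmx2 : Jmx *m Jmx = - 1%:M.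
Proof.
apply/eqP; rewrite -subr_eq0; apply/eqP/Pimx_free_mx.
rewrite opprK /real_mx map_mxD map_mxM map_mx1 mulmxDr mulmxA mulmx1.
rewrite -[map_mx _ Jmx]/(real_mx _) PiJ -scalemxAl PiJ scalerA.
by rewrite -expr2 sqr_i scaleN1r addNr.
Qed.

Lemma QT : Qmx^T = - Qmx.
Proof.
rewrite /Qmx tr_block_mx !trmx0 linearN /= opp_block_mx !oppr0 opprK.
by rewrite /Gmx tr_diag_mx.
Qed.

Local Notation QR := (map_mx intr Qmx : 'M[R]_(4 + 4)).

Lemma QRE : QR = block_mx 0 (GR R d) (- GR R d) 0.
Proof. by rewrite /Qmx map_block_mx !map_mx0 map_mxN. Qed.

Lemma JQ : Jmx^T *m QR = (sqrt_disc * N)^-1 *: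
  block_mx (d%:R *: (S^T *m GR R d)) 0 0 (S^T *m GR R d).
Proof.
rewrite /Jmx linearZ /= -scalemxAl; congr (_ *: _).
rewrite /kmx tr_block_mx !trmx0 QRE mulmx_block !(mulmx0, mul0mx, addr0, add0r).
by rewrite linearZ /= -scalemxAl mulmxN scaleNr scalerN opprK.
Qed.

Lemma JQJ : Jmx^T *m QR *m Jmx = QR.
Proof.
rewrite JQ /Jmx -scalemxAl -scalemxAr scalerA /kmx.
rewrite mulmx_block !(mulmx0, mul0mx, addr0, add0r).
rewrite -scalemxAl -scalemxAr SGS // QRE scale_block_mx !scaler0 !scalerA.
have nz : sqrt_disc * N != 0 by rewrite gt_eqF // deltaN_gt0.
have nN : N != 0 by rewrite N_neq0.
have nd : sqrt_disc != 0 by rewrite gt_eqF // sqrt_disc_gt0.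
have k1 : (sqrt_disc * N)^-1 / (sqrt_disc * N) * d%:R * N ^+ 2 = 1.
  by rewrite -sqrt_disc_sqr; field; rewrite nd nN.
have k2 : (sqrt_disc * N)^-1 / (sqrt_disc * N) * (- d%:R) * N ^+ 2 = -1.
  by rewrite mulrN mulNr k1.
by rewrite k1 k2 scale1r scaleN1r.
Qed.

(** J^T Q is block diagonal with positive multiples of S^T G, so [SG_pos] applies to both halves of
    x. *)
Lemma Q_pos (x : 'cV[R]_(4 + 4)) : x != 0 -> 0 < ((Jmx *m x)^T *m QR *m x) 0 0.
Proof.
rewrite trmx_mul -(mulmxA _ _ QR) JQ -scalemxAr -scalemxAl mxE => x0.
rewrite pmulr_rgt0 ?invr_gt0 ?deltaN_gt0 //.
rewrite -[x]vsubmxK; set x1 := usubmx x; set x2 := dsubmx x.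
rewrite tr_col_mx mul_row_block !mulmx0 addr0 add0r mul_row_col mxE.
rewrite -scalemxAr -scalemxAl mxE.
have p (y : 'cV[R]_4) : 0 <= (y^T *m (S^T *m GR R d) *m y) 0 0.
  have [->|y0] := eqVneq y 0; first by rewrite mulmx0 mxE.
  by rewrite ltW // SG_pos.
have dp : 0 < d%:R :> R by rewrite ltr0n.
have [z1|n1] := eqVneq x1 0.
  have n2 : x2 != 0.
    by apply: contraNneq x0 => z2; rewrite -[x]vsubmxK -/x1 -/x2 z1 z2 col_mx0.
  by apply: ltr_wpDl; rewrite ?mulr_ge0 ?p ?(ltW dp) // SG_pos.
by apply: ltr_pwDl; rewrite ?p // mulr_gt0 // SG_pos.
Qed.

Lemma Qmx_riemann : @riemann_form R 4 Pimx Qmx.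
Proof.
split; first exact: QT.
  move=> x y ix iy /Jmx_uniq -> /Jmx_uniq ->.
  by rewrite trmx_mul mulmxA -!(mulmxA x^T) -[X in _ *m X *m _]/(_) ?JQJ.
by move=> x ix /Jmx_uniq -> /Q_pos.
Qed.

Definition prop_av : abelian_variety R 4 :=
  @AbelianVariety R 4 Pimx Pimx_free (ex_intro _ Qmx Qmx_riemann).

End Period.

(** * Endomorphisms and abelian subvarieties *)

(** The operator j x - s x is the w-coordinate of x times j w - s w, so a basis element with nonzero
    w-coordinate tests all of K; one exists since the basis spans w. *)
Lemma char_spaceP (F : numFieldType) (K : fieldExtType rat) (d : rat) (w : K) n
    (j : K -> 'M[rat]_n) (s : {rmorphism K -> F}) (u : 'rV[F]_n) :
    basis_of {:K} [:: 1; w] -> w * w = - d%:A ->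
    linear j -> j 1 = 1%:M ->
  (u <= char_space j s)%MS = (u *m map_mx ratr (j w) == s w *: u).
Proof.
move=> wB wsq jl j1.
have sE := q_morphE wB s.
have j0 : j 0 = 0.
  by have /eqP := jl 1 0 0; rewrite !scale1r addr0 -subr_eq0 opprD addNKr oppr_eq0 => /eqP.
have jE x : j x = (q_re w x)%:M + q_im w x *: j w.
  by rewrite {1}(q_reE wB x) jl -[_ *: w]addr0 jl j0 addr0 j1 scalemx1.
have mE x : map_mx (ratr : rat -> F) (j x) =
    (ratr (q_re w x))%:M + ratr (q_im w x) *: map_mx ratr (j w).
  by rewrite jE map_mxD map_scalar_mx map_mxZ.
have uE x : u *m map_mx ratr (j x) - s x *: u
    = ratr (q_im w x) *: (u *m map_mx ratr (j w) - s w *: u).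
  rewrite mE (sE x) mulmxDr mul_mx_scalar -scalemxAr scalerBr scalerA scalerDl.
  by rewrite opprD addrACA subrr add0r.
apply/sub_bigcapmxP/eqP => [h|h i _]; last first.
  by apply/eigenspaceP/eqP; rewrite -subr_eq0 uE h subrr scaler0.
have [/existsP[i hi]|/existsPn n0] :=
    boolP [exists i : 'I_(\dim {:K}), q_im w (vbasis {:K})`_i != 0].
  have /eigenspaceP/eqP := h i isT; rewrite -subr_eq0 uE scaler_eq0 fmorph_eq0 (negPf hi).
  by rewrite subr_eq0 => /eqP.
have : q_im w w = 0.
  rewrite {2}(coord_vbasis (memvf w)) (big_morph _ (q_imD w) (linear0 _)) big1 // => i _.
  by rewrite q_imZ (eqP (negbNE (n0 i))) mulr0.
by rewrite q_imw // => /eqP; rewrite oner_eq0.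
Qed.

Lemma mxtrace_delta (F : comNzRingType) n (X : 'M[F]_n) i k :
  \tr (delta_mx k i *m X) = X i k.
Proof.
rewrite /mxtrace (bigD1 k) //= big1 => [|l lk]; last first.
  by rewrite mxE big1 // => m _; rewrite mxE (negPf lk) mul0r.
rewrite mxE (bigD1 i) //= big1 => [|m mi]; last first.
  by rewrite mxE (negPf mi) andbF mul0r.
by rewrite mxE !eqxx mul1r !addr0.
Qed.

Lemma mxtrace_kmx (F : comNzRingType) d (L : 'M[F]_(4 + 4)) X :
  \tr (L *m kmx d X) = \tr ((dlsubmx L - d%:R *: ursubmx L) *m X).
Proof.
rewrite -[L in LHS]submxK mulmx_block !mulmx0 add0r addr0 mxtrace_block.
rewrite addr0 addrC mulmxBl linearB /= -scalemxAl -scalemxAr scaleNr.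
by rewrite linearN.
Qed.

Section Moments.
Variables (R : realType) (d : nat) (b : R).
Hypothesis d0 : (0 < d)%N.
Hypothesis b_indep : forall p : {poly rat}, (size p <= 13)%N ->
  (map_poly ratr p).[b] = 0 -> p = 0.
Local Notation S := (refl_mx d b).

(** As L runs through all rational functionals, this says by duality that w and the w (E_0j + h_j
    E_j0) lie in every rational subspace whose real points contain w S. *)
Lemma kmx_moments (L : 'M[rat]_(4 + 4)) :
    \tr (map_mx ratr L *m kmx d S) = 0 ->
  \tr (L *m kmx d 1%:M) = 0 /\
  forall j, j != 0 -> \tr (L *m kmx d (boost 1 (form_coef rat d j) j)) = 0.
Proof.
pose L' := dlsubmx L - d%:R *: ursubmx L.
rewrite mxtrace_kmx -map_dlsubmx -map_ursubmx.
rewrite (_ : map_mx _ _ - _ = map_mx (ratr : rat -> R) L'); last first.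
  by rewrite map_mxB map_mxZ rmorph_nat.
move=> h.
have [|t0 tj] := @moment_independent R d b d0 b_indep L'^T.
  rewrite -[RHS]h /mxtrace exchange_big /=; apply: eq_bigr => i _.
  by rewrite mxE; apply: eq_bigr => k _; rewrite !mxE.
split=> [|j j0]; first by rewrite mxtrace_kmx mulmx1 -mxtrace_tr.
rewrite mxtrace_kmx -/L' /boost scale1r mulmxDr -scalemxAr mxtraceD mxtraceZ.
have trd i k : \tr (L' *m delta_mx i k) = L' k i.
  by rewrite mxtrace_mulC mxtrace_delta.
by rewrite !trd; have := tj j j0; rewrite !mxE.
Qed.

(** The product of w B and w is -d B, so M commutes with the boosts B themselves, which generate all
    elementary matrices. *)
Lemma kmx_boosts_commutant (M : 'M[rat]_(4 + 4)) :
    M *m kmx d 1%:M = kmx d 1%:M *m M ->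
    (forall j, j != 0 ->
      M *m kmx d (boost 1 (form_coef rat d j) j) = kmx d (boost 1 (form_coef rat d j) j) *m M) ->
  exists p q, M = p%:M + q *: kmx d 1%:M.
Proof.
move=> c1 cB; have dr0 : d%:R != 0 :> rat by rewrite pnatr_eq0 -lt0n.
have cj j : j != 0 ->
    M *m dmx (boost 1 (form_coef rat d j) j) = dmx (boost 1 (form_coef rat d j) j) *m M.
  move=> j0; set B := boost _ _ _.
  have : M *m (kmx d B *m kmx d 1%:M) = (kmx d B *m kmx d 1%:M) *m M.
    by rewrite mulmxA cB // -!mulmxA c1.
  rewrite kmxM mulmx1 -scalemxAr -scalemxAl => /(congr1 (fun X => (- d%:R)^-1 *: X)).
  by rewrite !scalerA mulVf ?oppr_eq0 // !scale1r.
apply: commutant_scalar => //.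
apply: (@boosts_generate _ (fun X => M *m dmx X = dmx X *m M) (fun _ => 1) (form_coef rat d)) => //.
- by move=> X Y cX cY; rewrite -dmxM mulmxA cX -!mulmxA cY.
- by move=> c X cX; rewrite dmxZ -scalemxAr cX scalemxAl.
- by move=> j j0; rewrite /form_coef (negPf j0); case: ifP; rewrite oppr_eq0 ?invr_eq0 ?oner_eq0.
Qed.

(** Each entry of the commutator of M with X is a rational functional of X; vanishing at w S, it
    vanishes at the generators. *)
Lemma kmx_commutant (M : 'M[rat]_(4 + 4)) :
    map_mx ratr M *m kmx d S = kmx d S *m map_mx ratr M ->
  exists p q, M = p%:M + q *: kmx d 1%:M.
Proof.
move=> cM.
have mom i k (F : fieldType) (Y X : 'M[F]_(4 + 4)) :
    \tr ((delta_mx k i *m Y - Y *m delta_mx k i) *m X) = (Y *m X - X *m Y) i k.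
  rewrite mulmxBl linearB /= -(mulmxA Y) [\tr (Y *m _)]mxtrace_mulC -!mulmxA.
  by rewrite !mxtrace_delta !mxE.
have key i k := @kmx_moments (delta_mx k i *m M - M *m delta_mx k i).
have {}key i k : (M *m kmx d 1%:M - kmx d 1%:M *m M) i k = 0 /\
   forall j, j != 0 ->
     (M *m kmx d (boost 1 (form_coef rat d j) j)
      - kmx d (boost 1 (form_coef rat d j) j) *m M) i k = 0.
  have [|h1 h2] := key i k; last by split=> [|j j0]; rewrite -mom ?h1 ?h2.
  by rewrite map_mxB !map_mxM map_delta_mx mom cM subrr mxE.
apply: kmx_boosts_commutant => [|j j0]; apply/matrixP => i k; apply/eqP; rewrite -subr_eq0.
  by rewrite -(key i k).1 !mxE.
by rewrite -((key i k).2 j j0) !mxE.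
Qed.

End Moments.

(** Lattice vectors are columns, written here as rows, so the generators act through their
    transposes. *)
Lemma kmx_boosts_transitive (d : nat) (P : 'rV[rat]_(4 + 4) -> Prop) :
    (0 < d)%N ->
    (forall c u v, P u -> P v -> P (c *: u + v)) ->
    (forall u, P u -> P (u *m (kmx d 1%:M)^T)) ->
    (forall j u, j != 0 -> P u -> P (u *m (kmx d (boost 1 (form_coef rat d j) j))^T)) ->
  forall u, P u -> u != 0 -> forall v, P v.
Proof.
move=> d0 PL P1 Pj u uP u0.
pose A (X : 'M[rat]_(4 + 4)) := forall u, P u -> P (u *m X^T).
have P0 : P 0 by have := PL (-1) _ _ uP uP; rewrite scaleN1r addNr.
have PZ c v : P v -> P (c *: v).
  by move=> vW; have := PL c _ _ vW P0; rewrite addr0.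
have AM X Y : A X -> A Y -> A (X *m Y).
  by move=> aX aY v vW; rewrite trmx_mul mulmxA; apply/aX/aY.
have AZ c X : A X -> A (c *: X).
  by move=> aX v vW; rewrite linearZ /= -scalemxAr; apply/PZ/aX.
have dr0 : - d%:R != 0 :> rat by rewrite oppr_eq0 pnatr_eq0 -lt0n.
have AD : forall i j, A (dmx (delta_mx i j)).
  apply: (@boosts_generate _ (fun X => A (dmx X)) (fun _ => 1) (form_coef rat d)) => //.
  - by move=> X Y aX aY; rewrite -dmxM; apply: (AM _ _ aX aY).
  - by move=> c X aX; rewrite dmxZ; apply: (AZ c _ aX).
  - move=> j j0; rewrite /form_coef (negPf j0).
    by case: ifP; rewrite oppr_eq0 ?invr_eq0 ?oner_eq0 // pnatr_eq0 -lt0n.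
  - move=> j j0; have := AZ (- d%:R)^-1 _ (AM _ _ (fun u => Pj j u j0) P1).
    by rewrite kmxM mulmx1 scalerA mulVf // scale1r.
(* Transposing [kmx] moves -d to the upper right block. *)
apply: (@transitive_rows _ (- d%:R) 1 P _ _ _ _ u) => //.
- move=> x y /eqP; rewrite mul1r mulNr eq_sym -subr_eq0 opprK.
  have q2 : 0 <= d%:R * x ^+ 2 by apply: mulr_ge0; rewrite ?ler0n ?sqr_ge0.
  rewrite (paddr_eq0 (sqr_ge0 y) q2).
  rewrite sqrf_eq0 mulf_eq0 sqrf_eq0 -[d%:R == 0]oppr_eq0 (negPf dr0).
  by case/andP=> /eqP -> /eqP ->.
- move=> v /P1; rewrite /kmx tr_block_mx !trmx0 linearZ /= tr_scalar_mx.
  by rewrite scale_scalar_mx mulr1.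
- by move=> i j v /(AD j i); rewrite /dmx tr_block_mx !trmx0 trmx_delta.
Qed.

Section AntiWeil.
Local Open Scope complex_scope.
Variables (R : realType) (d : nat) (b : R).
Hypothesis d0 : (0 < d)%N.
Hypothesis b_gt0 : 0 < b.
Hypothesis b_lt : b < 1 / 2.
Hypothesis b_indep : forall p : {poly rat}, (size p <= 13)%N ->
  (map_poly ratr p).[b] = 0 -> p = 0.
Local Notation C := R[i].
Local Notation S := (refl_mx d b).
Local Notation Pi := (Pimx d b : 'M[C]_(4, 4 + 4)).
Local Notation J := (Jmx d b).
Local Notation D := (DR R).
Local Notation kmxC := (kmx d (1%:M : 'M[C]_4)).

Lemma rat_mxE m n (M : 'M[rat]_(m, n)) : rat_mx R M = real_mx (map_mx ratr M).
Proof.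
apply/matrixP => i j; rewrite !mxE.
exact/esym/(fmorph_eq_rat (real_complex R \o ratr)).
Qed.

Lemma J_commute_kmxS (M : 'M[R]_(4 + 4)) :
  J *m M = M *m J -> M *m kmx d S = kmx d S *m M.
Proof.
rewrite /Jmx -scalemxAl -scalemxAr => /(congr1 (fun X => (sqrt_disc R d * line_norm d b) *: X)).
by rewrite !scalerA mulfV ?scale1r // gt_eqF // deltaN_gt0.
Qed.

(** A matrix induced by a complex linear map commutes with multiplication by i. *)
Lemma Pi_commute_J (M : 'M[R]_(4 + 4)) (X : 'M[C]_4) :
  X *m Pi = Pi *m real_mx M -> J *m M = M *m J.
Proof.
move=> e; apply/eqP; rewrite -subr_eq0; apply/eqP/(Pimx_free_mx d0 b_gt0 b_lt).
rewrite /real_mx map_mxB !map_mxM mulmxBr !mulmxA -!/(real_mx _) -e (PiJ d0 b_gt0 b_lt).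
by rewrite -scalemxAl -e -mulmxA (PiJ d0 b_gt0 b_lt) -scalemxAr subrr.
Qed.

Lemma Pi_commutant (M : 'M[rat]_(4 + 4)) (X : 'M[C]_4) :
  X *m Pi = Pi *m rat_mx R M -> exists p q, M = p%:M + q *: kmx d 1%:M.
Proof.
rewrite rat_mxE => /Pi_commute_J/J_commute_kmxS cM.
exact: (kmx_commutant d0 b_indep).
Qed.

Definition isqrt_disc : C := 'i * (sqrt_disc R d)%:C.

Lemma isqrt_disc_sqr : isqrt_disc * isqrt_disc = - ratr d%:R.
Proof.
rewrite /isqrt_disc mulrACA -expr2 sqr_i mulN1r -rmorphM sqrt_disc_sqr ratr_nat.
by rewrite rmorph_nat.
Qed.

(** w has eigenvalue i sqrt(d) on the first row and -i sqrt(d) on the other three, which is the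
    source of the dimensions 1 and 3. *)
Lemma Pi_kmx : Pi *m kmxC = (isqrt_disc *: real_mx D) *m Pi.
Proof.
rewrite /Pimx /kmx mul_row_block !mulmx0 add0r addr0 -/isqrt_disc mulmx1.
rewrite mul_mx_row -scalemxAl -[real_mx D *m _ in RHS]scalemxAr scalerA isqrt_disc_sqr ratr_nat.
rewrite /real_mx -map_mxM mulmxA DR2 mul1mx; congr row_mx.
  by rewrite -scalemxAr mulmx1.
by rewrite -scalemxAl -map_mxM.
Qed.

Lemma UR_unit : UR d b \in unitmx.
Proof.
rewrite -unitmx_tr -row_free_unit -kermx_eq0; apply/eqP/row_matrixP => i.
rewrite row0; apply: trmx_inj; rewrite trmx0.
apply: (UR_free d0 b_gt0 b_lt); apply: trmx_inj; rewrite trmx_mul trmxK trmx0.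
exact/sub_kermxP/row_sub.
Qed.

Lemma Pi_rinv : exists Y : 'M[C]_(4 + 4, 4), Pi *m Y = 1%:M.
Proof.
exists (col_mx 0 (real_mx (invmx (UR d b)))).
by rewrite mul_row_col mulmx0 add0r /real_mx -map_mxM mulmxV ?UR_unit // map_mx1.
Qed.

Lemma Pi_row_free : row_free Pi.
Proof. exact/row_freeP/Pi_rinv. Qed.

Section Simple.
Variable W : {vspace 'cV[C]_4}.
Hypothesis Wsub : abelian_subvariety (prop_av d0 b_gt0 b_lt) W.

Let inW (u : 'rV[rat]_(4 + 4)) := Pi *m rat_mx R u^T \in W.

Lemma inW_lin c u v : inW u -> inW v -> inW (c *: u + v).
Proof.
rewrite /inW linearP /rat_mx map_mxD map_mxZ mulmxDr -scalemxAr => uW vW.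
exact: memvD (memvZ _ uW) vW.
Qed.

(* If [n] is a rational vector of [W] then [J n] is a real combination of
   rational vectors of [W], so a rational functional that kills all of them
   kills [J n], and hence kills [kmx d X *m n] whenever [kmx_moments] applies. *)
Lemma inW_moment (u : 'rV[rat]_(4 + 4)) (X : 'M[rat]_4) :
    (forall L : 'M[rat]_(4 + 4), \tr (map_mx ratr L *m kmx d S) = 0 ->
       \tr (L *m kmx d X) = 0) ->
  inW u -> inW (u *m (kmx d X)^T).
Proof.
move=> mom uW.
have [m [N [c [NW e]]]] := Wsub (memvZ 'i uW).
pose Nt : 'M[rat]_(m, 4 + 4) := (map_mx intr N)^T.
have eJ : J *m map_mx ratr u^T = map_mx intr N *m c.
  apply/esym/(Jmx_uniq d0 b_gt0 b_lt); rewrite -rat_mxE -[RHS]/('i *: _) e.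
  rewrite /real_mx map_mxM mulmxA; congr (_ *m _ *m _).
  by apply/matrixP => i j; rewrite !mxE rmorph_int.
have : (u *m (kmx d X)^T <= Nt)%MS.
  (* The columns of the cokernel matrix are rational functionals killing all the given lattice
     vectors of W. *)
  rewrite submxE; apply/eqP/rowP => j; rewrite [RHS]mxE.
  move: (cokermx Nt) (mulmx_coker Nt) => Qc NtQ; pose l := col j Qc.
  have trl (F : fieldType) (p : 'cV[F]_(4 + 4)) (q : 'rV[F]_(4 + 4)) (M : 'M[F]_(4 + 4)) :
      \tr (q^T *m p^T *m M) = (q *m M^T *m p) 0 0.
    rewrite -mulmxA mxtrace_mulC -trace_mx11 -[RHS]mxtrace_tr.
    by rewrite !trmx_mul trmxK -!mulmxA.
  transitivity ((u *m (kmx d X)^T *m l) 0 0).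
    by rewrite /l [in RHS]colE mulmxA -[in RHS]colE [in RHS]mxE.
  rewrite -trl; apply: mom; rewrite map_mxM -!map_trmx trl.
  have kJ : kmx d S = (sqrt_disc R d * line_norm d b) *: J.
    by rewrite /Jmx scalerA mulfV ?scale1r // gt_eqF // deltaN_gt0.
  rewrite kJ linearZ /= -scalemxAr -scalemxAl mxE.
  have -> : map_mx ratr u *m J^T = c^T *m map_mx ratr Nt.
    rewrite -[map_mx ratr u]trmxK -trmx_mul map_trmx eJ trmx_mul; congr (_ *m _).
    by apply/matrixP => i k; rewrite !mxE rmorph_int.
  rewrite -mulmxA -map_mxM /l colE (mulmxA Nt) NtQ mul0mx map_mx0 mulmx0 mxE.
  by rewrite mulr0.
case/submxP => q eq; rewrite /inW eq trmx_mul trmxK /rat_mx map_mxM mulmxA.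
rewrite [map_mx ratr q^T]matrix_sum_delta; rewrite mulmx_sumr.
apply: memv_suml => k _; rewrite big_ord1 -scalemxAr; apply: memvZ.
rewrite -mulmxA -colE; have := NW k; congr (_ *m _ \in W).
by apply/matrixP => i j; rewrite !mxE /= ratr_int.
Qed.

Lemma inW_all u : inW u -> u != 0 -> W = fullv.
Proof.
move=> uW u0.
have moments := kmx_moments d0 b_indep.
have all : forall v, inW v.
  apply: (kmx_boosts_transitive d0 inW_lin _ _ uW u0).
    by move=> v; apply: inW_moment => L /moments[].
  by move=> j v j0; apply: inW_moment => L /moments[_ /(_ _ j0)].
apply/vspaceP => w; rewrite memvf.
(* Pi is onto, so every complex vector is a complex combination of lattice vectors, and these all
   lie in W. *)
have [Y PY] := Pi_rinv.
rewrite -[w]mul1mx -PY -mulmxA [Y *m w]matrix_sum_delta mulmx_sumr.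
apply: memv_suml => k _; rewrite big_ord1 -scalemxAr; apply: memvZ.
have := all (delta_mx 0 k); rewrite /inW trmx_delta; congr (_ *m _ \in W).
by apply/matrixP => i j; rewrite !mxE /= ratr_nat.
Qed.

End Simple.

Lemma prop_av_simple : simple_av (prop_av d0 b_gt0 b_lt).
Proof.
split=> // W Wsub; have [->|Wn0] := eqVneq W 0%VS; [by left|right].
have wW := memv_pick W; have w0 : vpick W != 0 by rewrite vpick0.
have [m [N [c [NW e]]]] := Wsub _ wW.
have [k Nk] : exists k, col k N != 0.
  apply/existsP; apply: contraNT w0 => /existsPn n0; apply/eqP.
  rewrite e (_ : N = 0); first by rewrite map_mx0 mulmx0 mul0mx.
  apply/matrixP => i k; have := n0 k; rewrite negbK => /eqP/colP/(_ i).
  by rewrite !mxE.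
apply: (inW_all Wsub (u := (map_mx intr (col k N))^T)).
  have := NW k; rewrite trmxK; congr (_ *m _ \in W).
  by apply/matrixP => i j; rewrite !mxE /= ratr_int.
apply: contraNneq Nk => z; apply/eqP/colP => i; have /rowP/(_ i) := z.
by rewrite !mxE => /eqP; rewrite intr_eq0 => /eqP.
Qed.

End AntiWeil.

Section KMatrices.
Variables (K : fieldExtType rat) (d : nat) (w : K).
Hypotheses (wB : basis_of {:K} [:: 1; w]) (wsq : w * w = - (d%:R : rat)%:A).

Definition jmx (x : K) : 'M[rat]_(4 + 4) := (q_re w x)%:M + q_im w x *: kmx d 1%:M.

Lemma jmx_linear : linear jmx.
Proof.
move=> c x y; rewrite /jmx q_reD q_imD q_reZ q_imZ raddfD /= scalerDl scalerDr.
by rewrite -scale_scalar_mx scalerA addrACA.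
Qed.

Lemma jmx1 : jmx 1 = 1%:M.
Proof. by rewrite /jmx q_re1 // q_im1 // scale0r addr0. Qed.

Lemma jmxw : jmx w = kmx d 1%:M.
Proof. by rewrite /jmx q_rew // q_imw // scale1r raddf0 add0r. Qed.

Lemma jmxE p q : jmx (p *: 1 + q *: w) = p%:M + q *: kmx d 1%:M.
Proof. by rewrite /jmx; have [-> ->] := q_coords wB p q. Qed.

Lemma jmxM x y : jmx (x * y) = jmx x *m jmx y.
Proof.
rewrite /jmx (q_reM wB wsq) (q_imM wB wsq).
have := @kmxM rat d 1%:M 1%:M; rewrite mulmx1 dmx1; move: (kmx d 1%:M) => k kk.
rewrite mulmxDl !mulmxDr -!scalemxAr -!scalemxAl kk !mul_scalar_mx !mul_mx_scalar.
apply/matrixP => i j; rewrite !mxE.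
by case: (i == j); rewrite ?mulr1n ?mulr0n; ring.
Qed.
End KMatrices.

Section AntiWeil.
Local Open Scope complex_scope.
Variables (R : realType) (d : nat) (b : R).
Hypothesis d0 : (0 < d)%N.
Hypothesis b_gt0 : 0 < b.
Hypothesis b_lt : b < 1 / 2.
Hypothesis b_indep : forall p : {poly rat}, (size p <= 13)%N ->
  (map_poly ratr p).[b] = 0 -> p = 0.
Local Notation C := R[i].
Local Notation Pi := (Pimx d b : 'M[C]_(4, 4 + 4)).
Local Notation A := (prop_av d0 b_gt0 b_lt).
Local Notation lam := (isqrt_disc R d).

Lemma rat_kmx (p q : rat) : rat_mx R (p%:M + q *: kmx d 1%:M) =
  (ratr p)%:M + ratr q *: kmx d 1%:M.
Proof. by rewrite /rat_mx map_mxD map_scalar_mx map_mxZ map_kmx map_mx1. Qed.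

Lemma av_end_rat_commutant (M : 'M[rat]_(4 + 4)) :
  av_end_rat A M <-> exists p q, M = p%:M + q *: kmx d 1%:M.
Proof.
have eN (c : int) (N : 'M[int]_(4 + 4)) : c%:~R *: M = map_mx intr N ->
    map_mx intr N = (c%:~R : C) *: rat_mx R M.
  move=> e; have := congr1 (@rat_mx R _ _) e; rewrite /rat_mx map_mxZ /= ratr_int => ->.
  by apply/matrixP => i j; rewrite !mxE /= ratr_int.
split.
  move=> [c [N [c0 [f fPi] e]]]; apply: (Pi_commutant d0 b_gt0 b_lt b_indep (X := c%:~R^-1 *: f)).
  rewrite -scalemxAl -[f *m Pi]/(f *m period A) fPi (eN c N e) -scalemxAr scalerA.
  by rewrite mulVf ?scale1r // intr_eq0.
(* The common denominator [c] makes the matrix integral; the complex linear map inducing it is read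
   off from [Pi_kmx]. *)
move=> [p [q eM]]; pose c := denq p * denq q.
pose N : 'M[int]_(4 + 4) := (numq p * denq q)%:M + (numq q * denq p) *: kmx d 1%:M.
have e : c%:~R *: M = map_mx intr N.
  rewrite eM map_mxD map_scalar_mx map_mxZ map_kmx map_mx1 scalerDr scale_scalar_mx scalerA /=.
  by rewrite /c !intrM !numqE; congr (_%:M + _ *: _); ring.
exists c, N; split=> //; first by rewrite mulf_neq0 ?denq_neq0.
exists (c%:~R *: ((ratr p)%:M + ratr q *: (lam *: real_mx (DR R)))).
rewrite (eN c N e) eM rat_kmx -scalemxAl -scalemxAr; congr (_ *: _).
rewrite mulmxDl mulmxDr mul_scalar_mx mul_mx_scalar -scalemxAl -scalemxAr.
by congr (_ + _ *: _); rewrite -Pi_kmx.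
Qed.

Section Ranks.
Variables (K : fieldExtType rat) (w : K).
Hypotheses (wB : basis_of {:K} [:: 1; w]) (wsq : w * w = - (d%:R : rat)%:A).

(** Pulled back along the injective Pi, the eigenspace of K becomes the e-eigenspace of D, which is
    the row space of Z. *)
Lemma Pi_char_space (e : C) (Z : 'M[C]_4) (s : {rmorphism K -> C}) :
    s w = e * lam ->
    (forall y : 'rV[C]_4, (y *m real_mx (DR R) == e *: y) = (y <= Z)%MS) ->
  \rank (Pi :&: char_space (jmx d w) s)%MS = \rank Z.
Proof.
move=> sw eZ; rewrite -(mxrankMfree Z (Pi_row_free d0 b_gt0 b_lt)).
apply/eqmx_rank/andP.
have l0 : lam != 0.
  apply/eqP => l0; have /eqP := isqrt_disc_sqr R d.
  by rewrite l0 mul0r eq_sym oppr_eq0 ratr_nat pnatr_eq0 -leqn0 leqNgt d0.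
have cs (y : 'rV[C]_4) : (y *m Pi <= char_space (jmx d w) s)%MS = (y <= Z)%MS.
  rewrite (char_spaceP s _ wB wsq (jmx_linear d w) (jmx1 d wB)) (jmxw d wB).
  rewrite map_kmx map_mx1 -mulmxA Pi_kmx mulmxA -scalemxAr sw -eZ.
  rewrite -scalemxAl (mulrC e) -(scalerA lam e) -subr_eq0 -(scalerBr lam) scaler_eq0 (negPf l0) /=.
  rewrite scalemxAl -mulmxBl -[RHS]subr_eq0.
  apply/eqP/eqP => [|->]; last by rewrite mul0mx.
  have /row_freeP[Y PY] := Pi_row_free d0 b_gt0 b_lt.
  by move/(congr1 (mulmx^~ Y)); rewrite -mulmxA PY mulmx1 mul0mx.
split; apply/rV_subP => u.
  rewrite sub_capmx => /andP[/submxP[y ->]]; rewrite cs => yZ; exact: submxMr.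
case/submxP => y ->; rewrite mulmxA sub_capmx submxMl cs; exact: submxMl.
Qed.

Lemma idempotent_sub m (P : 'M[C]_4) (y : 'M[C]_(m, 4)) :
  P *m P = P -> (y <= P)%MS = (y *m P == y).
Proof.
move=> PP; apply/submxP/eqP => [[z ->]|<-]; last by exists y.
by rewrite -mulmxA PP.
Qed.

Lemma DR_pid : real_mx (DR R) = 2 *: pid_mx 1 - 1%:M :> 'M[C]_4.
Proof.
rewrite /real_mx map_diag_mx; apply/matrixP; apply: ord4P; apply: ord4P;
  by rewrite !mxE /= ?mulr1n ?mulr0n; ring.
Qed.

Lemma DR_eigen1 (y : 'rV[C]_4) :
  (y *m real_mx (DR R) == 1 *: y) = (y <= (pid_mx 1 : 'M[C]_4))%MS.
Proof.
rewrite idempotent_sub ?pid_mx_id // DR_pid mulmxBr mulmx1 -scalemxAr scale1r.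
have n2 : (2 : C) != 0 by rewrite pnatr_eq0.
rewrite subr_eq (_ : y + y = 2 *: y); last by rewrite scaler_nat mulr2n.
by rewrite (inj_eq (scalerI n2)).
Qed.

Lemma DR_eigenN1 (y : 'rV[C]_4) :
  (y *m real_mx (DR R) == -1 *: y) = (y <= (copid_mx 1 : 'M[C]_4))%MS.
Proof.
rewrite idempotent_sub ?copid_mx_id // DR_pid !mulmxBr mulmx1 -scalemxAr scaleN1r.
rewrite -subr_eq0 opprK subrK scaler_eq0 pnatr_eq0 /=.
by rewrite -[RHS]subr_eq0 addrAC subrr add0r oppr_eq0.
Qed.

End Ranks.

Lemma prop_av_anti_weil (K : fieldExtType rat) (w : K) :
  basis_of {:K} [:: 1; w] -> w * w = - (d%:R : rat)%:A ->
  imaginary_quadratic K -> anti_weil A.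
Proof.
move=> wB wsq imK.
pose lin := GRing.isSemilinear.Build _ _ _ _ (jmx d w) (GRing.semilinear_linear (jmx_linear d w)).
pose j : {linear K -> 'M[rat]_(4.*2)} := HB.pack (jmx d w : K -> 'M[rat]_(4.*2)) lin.
exists K, j; split=> //.
- exact: jmx1.
- exact: jmxM.
- move=> M; rewrite av_end_rat_commutant; split=> [[p [q ->]]|[x <-]].
    by exists (p *: 1 + q *: w); apply: jmxE.
  by exists (q_re w x), (q_im w x).
have [s [sw _]] := q_emb_ex wB wsq (isqrt_disc_sqr R d).
have lN : - lam * - lam = - ratr d%:R by rewrite mulrNN isqrt_disc_sqr.
have [t [tw _]] := q_emb_ex wB wsq lN.
exists s, t; split.
  rewrite (@Pi_char_space K w wB wsq 1 (pid_mx 1)) ?rank_pid_mx ?mul1r //.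
  exact: DR_eigen1.
rewrite (@Pi_char_space K w wB wsq (-1) (copid_mx 1)) ?rank_copid_mx ?mulN1r //.
exact: DR_eigenN1.
Qed.

End AntiWeil.

(** * Lie algebras of algebraic groups *)

Section Evaluation.
Variables (n : nat) (F : numFieldType).
Implicit Types (p q : {mpoly rat[n * n]}) (M : 'M[F]_n).

Lemma mx_evalD p q M : mx_eval (p + q) M = mx_eval p M + mx_eval q M.
Proof. exact: mmapD. Qed.
Lemma mx_evalB p q M : mx_eval (p - q) M = mx_eval p M - mx_eval q M.
Proof. exact: mmapB. Qed.
Lemma mx_evalM p q M : mx_eval (p * q) M = mx_eval p M * mx_eval q M.
Proof. exact: rmorphM. Qed.
Lemma mx_eval_sum (I : Type) (r : seq I) (f : I -> {mpoly rat[n * n]}) M :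
  mx_eval (\sum_(i <- r) f i) M = \sum_(i <- r) mx_eval (f i) M.
Proof. exact: raddf_sum. Qed.
Lemma mx_evalC c M : mx_eval c%:MP M = ratr c.
Proof. exact: mmapC. Qed.
Lemma mx_evalX i M : mx_eval 'X_i M = mxvec M 0 i.
Proof. by rewrite /mx_eval mmapX mmap1U. Qed.

End Evaluation.

Lemma mpoly_ring_ind (m : nat) (P : {mpoly rat[m]} -> Prop) :
  (forall c, P c%:MP) -> (forall i, P 'X_i) ->
  (forall p q, P p -> P q -> P (p + q)) -> (forall p q, P p -> P q -> P (p * q)) ->
  forall p, P p.
Proof.
move=> PC PX PD PM; elim/mpolyind => [|c k p _ _ Pp]; first by rewrite -mpolyC0.
apply: (PD) => //; rewrite -mul_mpolyC; apply: (PM) => //.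
rewrite mpolyXE_id; apply: (big_ind P) => [||i _] //; first by rewrite -mpolyC1.
by elim: (k i) => [|e IH]; rewrite ?expr0 -?mpolyC1 // exprS; apply: (PM).
Qed.

Lemma mx_eval_map n (F G : numFieldType) (f : {rmorphism F -> G})
    (p : {mpoly rat[n * n]}) (M : 'M[F]_n) :
  mx_eval p (map_mx f M) = f (mx_eval p M).
Proof.
elim/mpoly_ring_ind: p => [c|i|p q IHp IHq|p q IHp IHq].
- by rewrite !mx_evalC; apply/esym/(fmorph_eq_rat (f \o ratr)).
- by rewrite !mx_evalX -map_mxvec mxE.
- by rewrite !mx_evalD rmorphD IHp IHq.
- by rewrite !mx_evalM rmorphM IHp IHq.
Qed.

(* The differential at the identity of the polynomial function [p] is
   [X |-> \tr (mx_grad p *m X)]. *)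
Definition mx_grad n (p : {mpoly rat[n * n]}) : 'M[rat]_n :=
  \matrix_(j, i) mx_eval (mderiv (mxvec_index i j) p) (1%:M : 'M[rat]_n).

Section Gradient.
Variable n : nat.
Implicit Types (p q : {mpoly rat[n * n]}).

Lemma sum_mxvec_index (V : nmodType) (f : 'I_(n * n) -> V) :
  \sum_k f k = \sum_i \sum_j f (mxvec_index i j).
Proof.
rewrite pair_bigA /= (reindex (uncurry (@mxvec_index n n))) /=; last exact: curry_mxvec_bij.
by apply: eq_bigr => -[].
Qed.

Lemma mx_gradE p (X : 'M[rat]_n) :
  \sum_k mxvec X 0 k * mx_eval (mderiv k p) (1%:M : 'M[rat]_n) = \tr (mx_grad p *m X).
Proof.
rewrite sum_mxvec_index exchange_big /=; apply: eq_bigr => j _.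
by rewrite mxE; apply: eq_bigr => i _; rewrite mxvecE mxE mulrC.
Qed.

Lemma mx_gradC c : mx_grad c%:MP = 0 :> 'M_n.
Proof. by apply/matrixP => i j; rewrite !mxE mderivC -mpolyC0 mx_evalC rmorph0. Qed.
Lemma mx_gradD p q : mx_grad (p + q) = mx_grad p + mx_grad q.
Proof. by apply/matrixP => i j; rewrite !mxE mderivD mx_evalD. Qed.
Lemma mx_gradB p q : mx_grad (p - q) = mx_grad p - mx_grad q.
Proof. by apply/matrixP => i j; rewrite !mxE mderivB mx_evalB. Qed.
Lemma mx_gradM p q : mx_grad (p * q) =
  mx_eval q (1%:M : 'M[rat]_n) *: mx_grad p + mx_eval p (1%:M : 'M[rat]_n) *: mx_grad q.
Proof.
apply/matrixP => i j; rewrite !mxE mderivM mx_evalD !mx_evalM mulrC.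
by congr (_ + _).
Qed.
Lemma mx_gradX i j : mx_grad 'X_(mxvec_index i j) = delta_mx j i :> 'M_n.
Proof.
apply/matrixP => k l; rewrite !mxE mderivX mnm1E.
have -> : (mxvec_index i j == mxvec_index l k) = (k == j) && (l == i).
  have [g gK _] := curry_mxvec_bij n n.
  have inj : injective (uncurry (@mxvec_index n n)) := can_inj (fun x => gK x isT).
  by rewrite (inj_eq inj (i, j) (l, k)) xpair_eqE andbC ![_ == k]eq_sym ![_ == l]eq_sym.
case: andP => [[/eqP -> /eqP ->]|_]; last first.
  by rewrite scale0r -mpolyC0 mx_evalC rmorph0.
rewrite scale1r (_ : (U_(_) - U_(_))%MM = 0%MM) ?mpolyX0 -?mpolyC1 ?mx_evalC ?rmorph1 //.
by apply/mnmP => t; rewrite mnmBE subnn mnm0E.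
Qed.

Lemma mx_grad_sum (I : Type) (r : seq I) (f : I -> {mpoly rat[n * n]}) :
  mx_grad (\sum_(i <- r) f i) = \sum_(i <- r) mx_grad (f i).
Proof.
apply: (big_morph _ mx_gradD); by rewrite -mpolyC0 mx_gradC.
Qed.

(** The generic matrix. Group equations are written as identities between matrices of polynomials,
    to be evaluated and differentiated by matrix calculus. *)
Definition gen_mx : 'M[{mpoly rat[n * n]}]_n := \matrix_(i, j) 'X_(mxvec_index i j).
Definition mx_evals (F : numFieldType) (P : 'M[{mpoly rat[n * n]}]_n) (M : 'M[F]_n) : 'M[F]_n :=
  map_mx (fun p => mx_eval p M) P.
Definition mx_diff (P : 'M[{mpoly rat[n * n]}]_n) (Y : 'M[rat]_n) : 'M[rat]_n :=
  map_mx (fun p => \tr (mx_grad p *m Y)) P.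
Definition cst_mx (M : 'M[rat]_n) : 'M[{mpoly rat[n * n]}]_n := map_mx (@mpolyC _ _) M.

Lemma mx_evals_gen (F : numFieldType) (M : 'M[F]_n) : mx_evals gen_mx M = M.
Proof. by apply/matrixP => i j; rewrite !mxE mx_evalX mxvecE. Qed.
Lemma mx_evals_cst (F : numFieldType) N (M : 'M[F]_n) : mx_evals (cst_mx N) M = map_mx ratr N.
Proof. by apply/matrixP => i j; rewrite !mxE mx_evalC. Qed.
Lemma mx_evalsM (F : numFieldType) P Q (M : 'M[F]_n) :
  mx_evals (P *m Q) M = mx_evals P M *m mx_evals Q M.
Proof.
apply/matrixP => i j; rewrite !mxE mx_eval_sum; apply: eq_bigr => k _.
by rewrite mx_evalM !mxE.
Qed.
Lemma mx_evalsB (F : numFieldType) P Q (M : 'M[F]_n) :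
  mx_evals (P - Q) M = mx_evals P M - mx_evals Q M.
Proof. by apply/matrixP => i j; rewrite !mxE mx_evalB. Qed.
Lemma mx_evals_tr (F : numFieldType) P (M : 'M[F]_n) :
  mx_evals P^T M = (mx_evals P M)^T.
Proof. by apply/matrixP => i j; rewrite !mxE. Qed.

Lemma mx_diff_gen Y : mx_diff gen_mx Y = Y.
Proof.
by apply/matrixP => i j; rewrite !mxE mx_gradX mxtrace_delta.
Qed.
Lemma mx_diff_cst N Y : mx_diff (cst_mx N) Y = 0.
Proof. by apply/matrixP => i j; rewrite !mxE mx_gradC mul0mx mxtrace0. Qed.
Lemma mx_diffB P Q Y : mx_diff (P - Q) Y = mx_diff P Y - mx_diff Q Y.
Proof. by apply/matrixP => i j; rewrite !mxE mx_gradB mulmxBl linearB. Qed.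
Lemma mx_diff_tr P Y : mx_diff P^T Y = (mx_diff P Y)^T.
Proof. by apply/matrixP => i j; rewrite !mxE. Qed.
Lemma mx_diffM P Q Y :
  mx_diff (P *m Q) Y = mx_diff P Y *m mx_evals Q 1%:M + mx_evals P 1%:M *m mx_diff Q Y.
Proof.
apply/matrixP => i j; rewrite !mxE mx_grad_sum mulmx_suml linear_sum -big_split /=.
apply: eq_bigr => k _; rewrite mx_gradM mulmxDl linearD /= -!scalemxAl !linearZ /= !mxE.
by rewrite mulrC.
Qed.

End Gradient.

Section Curves.
Variables (R : realType) (n : nat) (J : 'M[R]_n).

(** The point cos u + J sin u with t = tan(u / 2): a rational parametrization, of velocity 2 J at t
    = 0. *)
Definition circle_pt (t : R) : 'M[R]_n :=
  ((1 - t ^+ 2) / (1 + t ^+ 2))%:M + (2 * t / (1 + t ^+ 2)) *: J.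

Lemma poly_zero (g : {poly R}) : (forall t, g.[t] = 0) -> g = 0.
Proof.
move=> g0; apply/eqP; apply: contraT => gn0.
pose rs : seq R := [seq i%:R | i <- iota 0 (size g)].
have rs_root : all (root g) rs by apply/allP => x _; apply/rootP.
have rs_uniq : uniq rs.
  rewrite map_inj_uniq ?iota_uniq // => i j /eqP.
  by rewrite eqr_nat => /eqP.
by have := max_poly_roots gn0 rs_root rs_uniq; rewrite size_map size_iota ltnn.
Qed.

(** The denominator of [circle_pt] is 1 to first order at 0, so clearing it changes neither the
    value nor the derivative there. *)
Let q : {poly R} := 1 + 'X^2.
Let q0 : q.[0] = 1. Proof. by rewrite /q !hornerE expr0n addr0. Qed.
Let dq0 : (q^`()).[0] = 0.
Proof. by rewrite /q derivD derivXn -polyC1 derivC add0r hornerMn hornerX mul0rn. Qed.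
Let qX k : (q ^+ k).[0] = 1. Proof. by rewrite horner_exp q0 expr1n. Qed.
Let dqX k : ((q ^+ k)^`()).[0] = 0.
Proof. by rewrite deriv_exp hornerMn hornerM dq0 mul0r mul0rn. Qed.

Let has_expansion (p : {mpoly rat[n * n]}) := exists (k : nat) (g : {poly R}),
  [/\ forall t, (1 + t ^+ 2) ^+ k * mx_eval p (circle_pt t) = g.[t],
      g.[0] = mx_eval p (1%:M : 'M[R]_n) &
      (g^`()).[0] = 2 * \tr (map_mx ratr (mx_grad p) *m J)].

Let circle0 t : 1 + t ^+ 2 != 0 :> R.
Proof. by rewrite gt_eqF // ltr_pwDl ?sqr_ge0. Qed.

Let qt t k : (q ^+ k).[t] = (1 + t ^+ 2) ^+ k.
Proof. by rewrite horner_exp /q !hornerE. Qed.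

(* First order expansion at t = 0 of a polynomial function along the unit circle
   of R[J], after clearing denominators. *)
Lemma circle_expansion p : has_expansion p.
Proof.
elim/mpoly_ring_ind: p => [c|k|p1 p2 [k1 [g1 [e1 v1 d1]]] [k2 [g2 [e2 v2 d2]]]
  |p1 p2 [k1 [g1 [e1 v1 d1]]] [k2 [g2 [e2 v2 d2]]]].
- exists 0%N, (ratr c)%:P; split=> [t||].
  + by rewrite mx_evalC !hornerE.
  + by rewrite mx_evalC !hornerE.
  + by rewrite mx_gradC map_mx0 mul0mx mxtrace0 mulr0 derivC horner0.
- case/mxvec_indexP: k => i j.
  exists 1%N, ((i == j)%:R *: (1 - 'X^2) + (2 * J i j) *: 'X); split=> [t||].
  + rewrite mx_evalX mxvecE !mxE !hornerE.
    have := circle0 t.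
    by case: (i == j); rewrite ?mulr1n ?mulr0n => c0; field.
  + by rewrite mx_evalX mxvecE !mxE !hornerE /=; case: (i == j) => /=; ring.
  + rewrite mx_gradX map_delta_mx !derivE !hornerE /=.
    rewrite mxtrace_delta.
    by ring.
- exists (k1 + k2)%N, (g1 * q ^+ k2 + g2 * q ^+ k1); split=> [t||].
  + by rewrite mx_evalD hornerD !hornerM -e1 -e2 !qt exprD; ring.
  + by rewrite mx_evalD hornerD !hornerM !qX !mulr1 v1 v2.
  + rewrite derivD !derivM !hornerD !hornerM !qX !dqX d1 d2.
    by rewrite mx_gradD map_mxD mulmxDl mxtraceD; ring.
- exists (k1 + k2)%N, (g1 * g2); split=> [t||].
  + by rewrite mx_evalM hornerM -e1 -e2 exprD; ring.
  + by rewrite mx_evalM hornerM v1 v2.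
  + rewrite derivM hornerD !hornerM v1 v2 d1 d2 mx_gradM map_mxD !map_mxZ mulmxDl mxtraceD.
    rewrite -!scalemxAl !mxtraceZ.
    have e p : ratr (mx_eval p (1%:M : 'M[rat]_n)) = mx_eval p (1%:M : 'M[R]_n).
      by rewrite -mx_eval_map map_mx1.
    by rewrite /= !e; ring.
Qed.

Lemma circle_tangent p : (forall t, mx_eval p (circle_pt t) = 0) ->
  \tr (map_mx ratr (mx_grad p) *m J) = 0.
Proof.
move=> p0; have [k [g [ge _ dg]]] := circle_expansion p.
have g0 : g = 0 by apply: poly_zero => t; rewrite -ge p0 mulr0.
move: dg; rewrite g0 deriv0 horner0 => /esym/eqP.
by rewrite mulf_eq0 pnatr_eq0 => /eqP.
Qed.

End Curves.

Section LieAlgebras.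
Variables (R : realType) (n : nat) (X : 'M[R]_n -> Prop).

Lemma lie_algE (S : mx_equations n) (Y : 'M[rat]_n) :
  lie_alg R S Y <-> forall p, (forall M : 'M[R[i]]_n, points S M -> mx_eval p M = 0) ->
    \tr (mx_grad p *m Y) = 0.
Proof. by split=> h p /h; rewrite mx_gradE. Qed.

(** Upper bound: the equations of any Q-group containing X are among those of the smallest one, so
    their differentials vanish on its Lie algebra. *)
Lemma smallest_lie_alg_in (S : mx_equations n) (Y : 'M[rat]_n) :
    q_subgroup R S -> (forall M, X M -> points S M) ->
    lie_alg R (smallest_q_subgroup X) Y ->
  forall p, S p -> \tr (mx_grad p *m Y) = 0.
Proof.
move=> gS XS /lie_algE lY p Sp; apply: lY => M [_]; apply.
by exists S.
Qed.

(* J is a real point of the Lie algebra, which is defined over Q; so the Lie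
   algebra contains every rational matrix in the smallest rational subspace whose
   real points contain J. *)
Lemma smallest_lie_alg_circle (J : 'M[R]_n) (Y : 'M[rat]_n) :
    (forall t, X (circle_pt J t)) -> (forall t, circle_pt J t \in unitmx) ->
    (forall L : 'M[rat]_n, \tr (map_mx ratr L *m J) = 0 -> \tr (L *m Y) = 0) ->
  lie_alg R (smallest_q_subgroup X) Y.
Proof.
move=> XJ uJ h; apply/lie_algE => p p0; apply/h/circle_tangent => t.
apply: (fmorph_inj (real_complex R)); rewrite rmorph0 -mx_eval_map.
apply: p0; split; first by rewrite map_unitmx.
move=> r [S [_ XS Sr]]; rewrite mx_eval_map.
by have [_ /(_ r Sr) ->] := XS _ (XJ t); rewrite rmorph0.
Qed.

Lemma smallest_lie_alg_mono (X' : 'M[R]_n -> Prop) (Y : 'M[rat]_n) :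
    (forall M, X M -> X' M) ->
  lie_alg R (smallest_q_subgroup X) Y -> lie_alg R (smallest_q_subgroup X') Y.
Proof.
move=> XX' h p p0; apply: h => M [uM hM]; apply: p0; split=> // r [S [gS XS Sr]].
by apply: hM; exists S; split=> // N /XX'/XS.
Qed.

End LieAlgebras.

Section Equations.
Variables (R : realType) (n : nat).
Local Notation C := R[i].

Definition entries (P : 'M[{mpoly rat[n * n]}]_n) : mx_equations n :=
  fun p => exists i j, p = P i j.

Lemma points_entries (F : numFieldType) P (M : 'M[F]_n) :
  points (entries P) M <-> M \in unitmx /\ mx_evals P M = 0.
Proof.
split=> -[uM h]; split=> //.
  by apply/matrixP => i j; rewrite mxE h ?mxE //; exists i, j.
by move=> p [i [j ->]]; have /matrixP/(_ i j) := h; rewrite !mxE.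
Qed.

(** The first equations cut out the centralizer of N, those of [form_eqs] the isometry group of the
    form N on rows. *)
Definition commute_eqs (N : 'M[rat]_n) := gen_mx n *m cst_mx N - cst_mx N *m gen_mx n.
Definition form_eqs (N : 'M[rat]_n) := gen_mx n *m cst_mx N *m (gen_mx n)^T - cst_mx N.

Lemma commute_eqsE (F : numFieldType) N (M : 'M[F]_n) :
  mx_evals (commute_eqs N) M = M *m map_mx ratr N - map_mx ratr N *m M.
Proof. by rewrite mx_evalsB !mx_evalsM mx_evals_gen mx_evals_cst. Qed.
Lemma form_eqsE (F : numFieldType) N (M : 'M[F]_n) :
  mx_evals (form_eqs N) M = M *m map_mx ratr N *m M^T - map_mx ratr N.
Proof. by rewrite mx_evalsB !mx_evalsM mx_evals_tr mx_evals_gen mx_evals_cst. Qed.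

Lemma map_ratr_rat m k (N : 'M[rat]_(m, k)) : map_mx ratr N = N.
Proof.
apply/matrixP => i j; rewrite mxE.
exact/esym/(fmorph_eq_rat (idfun : {rmorphism rat -> rat})).
Qed.

Lemma commute_diff N Y : mx_diff (commute_eqs N) Y = Y *m N - N *m Y.
Proof.
rewrite mx_diffB !mx_diffM !mx_diff_gen !mx_diff_cst !mx_evals_cst map_ratr_rat.
by rewrite mulmx0 mul0mx addr0 add0r.
Qed.
Lemma form_diff N Y : mx_diff (form_eqs N) Y = Y *m N + N *m Y^T.
Proof.
rewrite mx_diffB !mx_diffM mx_diff_tr !mx_diff_gen !mx_diff_cst mx_evalsM mx_evals_tr.
rewrite !mx_evals_cst !mx_evals_gen map_ratr_rat.
by rewrite mulmx0 addr0 subr0 trmx1 mulmx1 mul1mx.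
Qed.

Lemma commute_group N : q_subgroup R (entries (commute_eqs N)).
Proof.
split=> [|M M' /points_entries[uM hM] /points_entries[uM' hM']|M /points_entries[uM hM]];
  apply/points_entries; rewrite ?unitmx1 ?unitmx_mul ?unitmx_inv ?uM ?uM'; split=> //;
  rewrite !commute_eqsE ?mul1mx ?mulmx1 ?subrr //.
- move/eqP: hM; rewrite commute_eqsE subr_eq0 => /eqP hM.
  move/eqP: hM'; rewrite commute_eqsE subr_eq0 => /eqP hM'.
  by rewrite -mulmxA hM' mulmxA hM -mulmxA subrr.
- move/eqP: hM; rewrite commute_eqsE subr_eq0 => /eqP hM.
  apply/eqP; rewrite subr_eq0; apply/eqP.
  by rewrite -[LHS](mulmxK uM) -[_ *m M]mulmxA -hM mulKmx.
Qed.

Lemma form_group N : q_subgroup R (entries (form_eqs N)).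
Proof.
split=> [|M M' /points_entries[uM hM] /points_entries[uM' hM']|M /points_entries[uM hM]];
  apply/points_entries; rewrite ?unitmx1 ?unitmx_mul ?unitmx_inv ?uM ?uM'; split=> //;
  rewrite !form_eqsE ?trmx1 ?mul1mx ?mulmx1 ?subrr //.
- move/eqP: hM; rewrite form_eqsE subr_eq0 => /eqP hM.
  move/eqP: hM'; rewrite form_eqsE subr_eq0 => /eqP hM'.
  set F := map_mx ratr N in hM hM' *; rewrite trmx_mul.
  have -> : M *m M' *m F *m (M'^T *m M^T) = M *m (M' *m F *m M'^T) *m M^T.
    by rewrite !mulmxA.
  by rewrite hM' hM subrr.
- move/eqP: hM; rewrite form_eqsE subr_eq0 => /eqP hM.
  apply/eqP; rewrite subr_eq0 -{1}hM !mulmxA mulVmx // mul1mx -mulmxA -trmx_mul.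
  by rewrite mulVmx // trmx1 mulmx1.
Qed.

Lemma entries_diff P Y : (forall p, entries P p -> \tr (mx_grad p *m Y) = 0) ->
  mx_diff P Y = 0.
Proof. by move=> h; apply/matrixP => i j; rewrite !mxE; apply: h; exists i, j. Qed.

End Equations.

(** * Hodge structure on V *)

(* A basis of V over Q(f), where f^2 = -d. *)
Lemma free_semilinear_square (V : vectType rat) (f : 'End(V)) (d : nat) (m : nat) :
    (forall v, f (f v) = - d%:R *: v) -> (0 < d)%N -> (2 * m <= \dim {:V})%N ->
  exists s : seq V, size s = m /\ free (s ++ map f s).
Proof.
move=> ff d0; elim: m => [_|m IH hm].
  by exists [::]; split=> //; apply: nil_free.
have [|s [ss fs]] := IH; first by rewrite (leq_trans _ hm) // leq_mul2l leqnSn.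
set e := s ++ map f s in fs; pose U := <<e>>%VS.
have fU u : u \in U -> f u \in U.
  move=> uU; have : f u \in (f @: U)%VS by apply: memv_img.
  apply: subvP; rewrite limg_span; apply/span_subvP => x.
  rewrite map_cat mem_cat => /orP[] /mapP[y ye ->].
    by rewrite memv_span // mem_cat map_f // orbT.
  have /mapP[z zs ->] := ye; rewrite ff memvZ // memv_span //.
  by rewrite mem_cat zs.
have [v vU] : exists v, v \notin U.
  have /subvPn[v _ vU] : ~~ ({:V} <= U)%VS; last by exists v.
  apply: contraL hm => /dimvS le; rewrite -ltnNge (leq_ltn_trans le) //.
  by rewrite (leq_ltn_trans (dim_span _)) // size_cat size_map ss addnn mul2n doubleS.
have scal c : c != 0 -> c *: v \notin U.
  by move=> c0; apply: contra vU => h; rewrite -[v](scalerK c0) memvZ.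
exists (v :: s); split; first by rewrite /= ss.
rewrite (perm_free (Y := v :: f v :: e)); last first.
  by rewrite /= perm_cons; apply: (permEl (perm_catCA s [:: f v] (map f s))).
rewrite free_cons free_cons fs andbT; apply/andP; split; last first.
  have dn0 : - d%:R != 0 :> rat by rewrite oppr_eq0 pnatr_eq0 -lt0n.
  by apply: contra (scal _ dn0) => /fU; rewrite ff.
rewrite span_cons; apply/negP => /memv_addP[_ /vlineP[c ->] [u uU vE]].
(* Applying f to v = c f(v) + u and substituting back eliminates f(v); the factor 1 + c^2 d is
   positive. *)
have : (1 + c ^+ 2 * d%:R) *: v \in U.
  have -> : (1 + c ^+ 2 * d%:R) *: v = c *: f u + u.
    have fv : f v = - (c * d%:R) *: v + f u.
      by rewrite {1}vE linearD linearZ /= ff scalerA mulrN.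
    rewrite scalerDl scale1r {1}vE {1}fv scalerDr scalerA addrC -!addrA.
    have k : c ^+ 2 * d%:R + c * - (c * d%:R) = 0 by ring.
    by rewrite [LHS]addrA -[X in X + _]scalerDl k scale0r add0r.
  by rewrite memvD // memvZ // fU.
by apply/negP/scal; rewrite gt_eqF // ltr_pwDl // (mulr_ge0 (sqr_ge0 c)) // ler0n.
Qed.

(** The standard basis is sent to s followed by f(s), with s a basis over Q(f). *)
Lemma ex_theta (V : vectType rat) (f : 'End(V)) (d : nat) :
    (forall v, f (f v) = - d%:R *: v) -> (0 < d)%N -> \dim {:V} = 8%N ->
  exists theta : {linear 'rV[rat]_(4 + 4) -> V},
    bijective theta /\ forall u, theta (u *m kmx d 1%:M) = f (theta u).
Proof.
move=> ff d0 dV.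
have [|s [ss fs]] := @free_semilinear_square V f d 4 ff d0; first by rewrite dV.
set e := s ++ map f s in fs.
have se : size e == (4 + 4)%N by rewrite size_cat size_map ss.
pose te := Tuple se.
have be : basis_of fullv te by rewrite basisEfree fs subvf dV (eqP se).
pose th (u : 'rV[rat]_(4 + 4)) : V := \sum_k u 0 k *: te`_k.
have th_lin : linear th.
  move=> c u v; rewrite /th scaler_sumr -big_split; apply: eq_bigr => k _.
  by rewrite !mxE scalerDl scalerA.
pose lin := GRing.isSemilinear.Build _ _ _ _ th (GRing.semilinear_linear th_lin).
pose theta : {linear 'rV[rat]_(4 + 4) -> V} := HB.pack th lin.
exists theta; split.
  exists (fun v => \row_k coord te k v) => [u|v].
    by apply/rowP => k; rewrite mxE coord_sum_free.
  rewrite [RHS](coord_basis be (memvf v)).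
  by apply: eq_bigr => k _; rewrite mxE.
move=> u; rewrite -[u]hsubmxK /kmx mul_row_block !mulmx0 add0r addr0 mulmx1.
set u1 := lsubmx u; set u2 := rsubmx u.
have thE x y : theta (row_mx x y) = \sum_(r < 4) x 0 r *: s`_r + \sum_(r < 4) y 0 r *: f s`_r.
  rewrite /= /th big_split_ord /=; congr (_ + _); apply: eq_bigr => r _.
    by rewrite row_mxEl /e nth_cat ss ltn_ord.
  rewrite row_mxEr /e nth_cat ss ltnNge leq_addr /= addKn (nth_map 0) // ss.
  exact: ltn_ord.
rewrite !thE linearD !linear_sum /= addrC; congr (_ + _); apply: eq_bigr => r _.
  by rewrite linearZ.
by rewrite -scalemxAr mulmx1 linearZ /= ff scalerA !mxE mulrC.
Qed.

Section Coordinates.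
Variables (V : vectType rat) (theta : {linear 'rV[rat]_(4 + 4) -> V}).
Hypothesis theta_bij : bijective theta.
Local Notation n := (\dim {:V}).
Local Notation vb := (vbasis {:V}).
Local Notation vbP := (vbasisP {:V}).

Definition theta_mx : 'M[rat]_(4 + 4, n) := lin1_mx (rVof vb \o theta).
Local Notation Th := theta_mx.

Lemma mul_Th u : u *m Th = rVof vb (theta u).
Proof. by rewrite mul_rV_lin1. Qed.

Lemma Th_inverse : exists Ti : 'M[rat]_(n, 4 + 4), Th *m Ti = 1%:M /\ Ti *m Th = 1%:M.
Proof.
have [g gK Kg] := theta_bij; pose Ti : 'M[rat]_(n, 4 + 4) := \matrix_i g vb`_i.
have TiT : Ti *m Th = 1%:M.
  apply/row_matrixP => i; rewrite row_mul rowK mul_Th Kg row1.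
  by rewrite rVofE // vbP.
exists Ti; split=> //; apply/row_matrixP => i; rewrite row1 rowE.
apply: (bij_inj theta_bij); apply: (can_inj (rVofK vbP)).
by rewrite -!mul_Th -!mulmxA TiT mulmx1.
Qed.

(** The Hodge theoretic notions use the basis [vbasis] of V, the construction lives in Q^8; [Th] and
    its inverse [Ti] pass between the two. *)
Definition coord_mx (Ti : 'M[rat]_(n, 4 + 4)) (f : 'End(V)) : 'M[rat]_(4 + 4) :=
  Th *m mxof vb vb f *m Ti.

Section Inverse.
Implicit Types (f g : 'End(V)) (u : 'rV[rat]_(4 + 4)).
Variable Ti : 'M[rat]_(n, 4 + 4).
Hypotheses (ThTi : Th *m Ti = 1%:M) (TiTh : Ti *m Th = 1%:M).

Lemma std_theta f u : f (theta u) = theta (u *m coord_mx Ti f).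
Proof.
apply: (can_inj (rVofK vbP)); rewrite (rVof_app vb vbP) -!mul_Th /coord_mx !mulmxA.
by rewrite -(mulmxA _ Ti) TiTh mulmx1.
Qed.

Lemma std_uniq f M : (forall u, f (theta u) = theta (u *m M)) -> coord_mx Ti f = M.
Proof.
move=> fM; apply/row_matrixP => i; rewrite !rowE.
by apply: (bij_inj theta_bij); rewrite -fM std_theta.
Qed.

Lemma mxof_std f : mxof vb vb f = Ti *m coord_mx Ti f *m Th.
Proof. by rewrite /coord_mx !mulmxA TiTh mul1mx -mulmxA TiTh mulmx1. Qed.

Lemma std_inj : injective (coord_mx Ti).
Proof.
move=> f g e; apply: (can_inj (mxofK vbP vbP)).
by rewrite !mxof_std e.
Qed.

(** Vectors are rows, so composition reverses the order; the commutators below inherit this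
    reversal. *)
Lemma std_comp f g : coord_mx Ti (f \o g)%VF = coord_mx Ti g *m coord_mx Ti f.
Proof.
apply: std_uniq => u; rewrite comp_lfunE std_theta std_theta mulmxA //.
Qed.

Lemma std_linear : linear (coord_mx Ti).
Proof.
by move=> c f g; rewrite /coord_mx linearP mulmxDr mulmxDl -scalemxAr -scalemxAl.
Qed.

Lemma std0 : coord_mx Ti 0 = 0.
Proof. by apply: std_uniq => u; rewrite zero_lfunE mulmx0 linear0. Qed.

Lemma lie_comm_std f g :
  coord_mx Ti (lie_comm f g) = coord_mx Ti g *m coord_mx Ti f - coord_mx Ti f *m coord_mx Ti g.
Proof. by rewrite /lie_comm -scaleN1r addrC std_linear scaleN1r !std_comp addrC. Qed.

Lemma lie_comm_eq0 f g :
  lie_comm f g = 0 <-> coord_mx Ti f *m coord_mx Ti g = coord_mx Ti g *m coord_mx Ti f.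
Proof.
split=> [e|e]; last by apply: std_inj; rewrite lie_comm_std e subrr std0.
have /eqP := congr1 (coord_mx Ti) e; rewrite lie_comm_std std0 subr_eq0 => /eqP.
by move=> ->.
Qed.

End Inverse.
End Coordinates.

Section Structure.
Local Open Scope complex_scope.
Variables (R : realType) (d : nat) (b : R).
Hypothesis d0 : (0 < d)%N.
Hypothesis b_gt0 : 0 < b.
Hypothesis b_lt : b < 1 / 2.
Hypothesis b_indep : forall p : {poly rat}, (size p <= 13)%N ->
  (map_poly ratr p).[b] = 0 -> p = 0.
Variables (K : fieldExtType rat) (w : K).
Hypotheses (wB : basis_of {:K} [:: 1; w]) (wsq : w * w = - (d%:R : rat)%:A).
Variables (V : vectType rat) (iota : {linear K -> 'End(V)}).
Hypothesis iota_1 : iota 1 = \1%VF.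
Variable theta : {linear 'rV[rat]_(4 + 4) -> V}.
Hypothesis theta_bij : bijective theta.
Hypothesis theta_w : forall u, theta (u *m kmx d 1%:M) = iota w (theta u).
Local Notation n := (\dim {:V}).
Local Notation vb := (vbasis {:V}).
Local Notation C := R[i].
Local Notation Pi := (Pimx d b : 'M[C]_(4, 4 + 4)).
Local Notation J := (Jmx d b).
Local Notation A := (prop_av d0 b_gt0 b_lt).
Local Notation H10 := (H10 A (theta : {linear 'rV[rat]_(4.*2) -> V})).
Local Notation H01 := (H01 A (theta : {linear 'rV[rat]_(4.*2) -> V})).
Local Notation Th := (theta_mx theta).
Variable Ti : 'M[rat]_(n, 4 + 4).
Hypotheses (ThTi : Th *m Ti = 1%:M) (TiTh : Ti *m Th = 1%:M).
Local Notation std := (coord_mx theta Ti).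

Implicit Types f : 'End(V).

Lemma std_iota x : std (iota x) = jmx d w x.
Proof.
apply: (std_uniq theta_bij TiTh) => u; rewrite {1}(q_reE wB x) linearP linearZ /=.
rewrite iota_1 !lfunE /= !lfunE /= /jmx mulmxDr linearD /= mul_mx_scalar linearZ /=.
by rewrite -scalemxAr linearZ /= theta_w id_lfunE.
Qed.

Lemma std_iotaw : std (iota w) = kmx d 1%:M.
Proof. by rewrite std_iota jmxw. Qed.

Lemma iota_of_std f p q : std f = p%:M + q *: kmx d 1%:M -> exists x, iota x = f.
Proof.
move=> e; exists (p *: 1 + q *: w); apply: (std_inj TiTh).
by rewrite std_iota jmxE.
Qed.

Let H10E : H10 = Pi *m rat_mx R Th. Proof. by []. Qed.

Let rat_mxM m k l (M : 'M[rat]_(m, k)) (N : 'M[rat]_(k, l)) :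
  rat_mx R (M *m N) = rat_mx R M *m rat_mx R N.
Proof. exact: map_mxM. Qed.

Lemma H10_end f : H10 *m ext_end C f = Pi *m rat_mx R (std f) *m rat_mx R Th.
Proof.
rewrite H10E /ext_end -/(rat_mx R _) (mxof_std TiTh f) !rat_mxM !mulmxA.
by rewrite -(mulmxA Pi) -rat_mxM ThTi /rat_mx map_mx1 mulmx1.
Qed.

(** Stability of H^{1,0} already puts f in the commutant of J. Conversely iota x is rational, so
    stability of H^{0,1} follows by conjugation. *)
Lemma hodge_end_iota f :
  hodge_end A (theta : {linear 'rV[rat]_(4.*2) -> V}) f <-> exists x, iota x = f.
Proof.
split.
  move=> [/submxP[X] + _]; rewrite H10_end H10E => e.
  have : X *m Pi = Pi *m rat_mx R (std f).
    have := congr1 (fun M => M *m rat_mx R Ti) e.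
    by rewrite mulmxA -!(mulmxA _ (rat_mx R Th)) -rat_mxM ThTi /rat_mx map_mx1 !mulmx1 => ->.
  by case/(Pi_commutant d0 b_gt0 b_lt b_indep) => p [q]; apply: iota_of_std.
move=> [x <-].
have [X eX] : exists X : 'M[C]_4, H10 *m ext_end C (iota x) = X *m H10.
  exists ((ratr (q_re w x))%:M + ratr (q_im w x) *: (isqrt_disc R d *: real_mx (DR R))).
  rewrite H10_end std_iota rat_kmx H10E mulmxA; congr (_ *m _).
  rewrite mulmxDl mulmxDr mul_scalar_mx mul_mx_scalar -scalemxAl -scalemxAr.
  by congr (_ + _ *: _); rewrite -Pi_kmx.
split; first by rewrite eX submxMl.
have -> : ext_end C (iota x) = conj_mx (ext_end C (iota x)).
  by apply/matrixP => i j; rewrite !mxE fmorph_rat.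
by rewrite /Defs.H01 /conj_mx -map_mxM eX map_mxM submxMl.
Qed.

Let J' : 'M[R]_n := map_mx ratr Ti *m J *m map_mx ratr Th.

Lemma J'2 : J' *m J' = - 1%:M.
Proof.
rewrite /J' !mulmxA -(mulmxA _ (map_mx ratr Th)) -map_mxM ThTi map_mx1 mulmx1.
rewrite -(mulmxA _ J J) (Jmx2 d0 b_gt0 b_lt) mulmxN mulmx1 mulNmx -map_mxM.
by rewrite TiTh map_mx1.
Qed.

Lemma H10_J' : H10 *m real_mx J' = 'i *: H10.
Proof.
rewrite H10E /J' /real_mx !map_mxM -!/(real_mx _) -!rat_mxE !mulmxA.
rewrite -(mulmxA Pi) -rat_mxM ThTi /rat_mx map_mx1 mulmx1.
by rewrite (PiJ d0 b_gt0 b_lt) scalemxAl.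
Qed.

Lemma H10_free m (X : 'M[R]_(n, m)) : H10 *m real_mx X = 0 -> X = 0.
Proof.
rewrite H10E rat_mxE -mulmxA /real_mx -map_mxM => /(Pimx_free_mx d0 b_gt0 b_lt) e.
have := congr1 (fun M => map_mx ratr Ti *m M) e.
by rewrite mulmxA -map_mxM TiTh map_mx1 mul1mx mulmx0.
Qed.

Definition torus_pt (x y : R) : 'M[R]_n := x%:M + y *: J'.

Lemma H10_torus x y : H10 *m real_mx (torus_pt x y) = (x +i* y) *: H10.
Proof.
rewrite /real_mx map_mxD map_scalar_mx map_mxZ mulmxDr mul_mx_scalar -scalemxAr.
rewrite -/(real_mx _) H10_J' scalerA -scalerDl; congr (_ *: _).
by rewrite [RHS]complexE mulrC.
Qed.

Lemma torus_deligne x y : deligne_action A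
  (theta : {linear 'rV[rat]_(4.*2) -> V}) (x +i* y) (torus_pt x y).
Proof.
split; first exact: H10_torus.
have -> : real_mx (torus_pt x y) = conj_mx (real_mx (torus_pt x y)).
  by apply/matrixP => i j; rewrite !mxE conj_Creal // complex_real.
by rewrite /Defs.H01 /conj_mx -map_mxM H10_torus map_mxZ.
Qed.

(** No nonzero real matrix is killed by H^{1,0}, so the action there determines M. *)
Lemma deligne_torus z M : deligne_action A (theta : {linear 'rV[rat]_(4.*2) -> V}) z M ->
  M = torus_pt (complex.Re z) (complex.Im z).
Proof.
move=> [e _]; apply/eqP; rewrite -subr_eq0; apply/eqP/H10_free.
rewrite /real_mx map_mxB mulmxBr -!/(real_mx _) e H10_torus.
by case: z {e} => x y; rewrite subrr.
Qed.

Lemma torus_ptM x y x' y' :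
  torus_pt x y *m torus_pt x' y' = torus_pt (x * x' - y * y') (x * y' + y * x').
Proof.
rewrite /torus_pt mulmxDl !mulmxDr -!scalemxAl -!scalemxAr J'2 !mul_scalar_mx !mul_mx_scalar.
move: (J') => J0; apply/matrixP => i j; rewrite !mxE.
by case: (i == j); rewrite ?mulr1n ?mulr0n; ring.
Qed.

Lemma torus_unit x y : x ^+ 2 + y ^+ 2 != 0 -> torus_pt x y \in unitmx.
Proof.
move=> z0; have /mulmx1_unit[] // :
  torus_pt x y *m ((x ^+ 2 + y ^+ 2)^-1 *: torus_pt x (- y)) = 1%:M.
rewrite -scalemxAr torus_ptM /torus_pt (_ : x * - y + y * x = 0) ?scale0r; last by ring.
rewrite addr0 scale_scalar_mx (_ : _ * _ = 1) //.
by rewrite (_ : x * x - y * - y = x ^+ 2 + y ^+ 2) ?mulVf //; ring.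
Qed.

Local Notation thetaA := (theta : {linear 'rV[rat]_(4.*2) -> V}).

Lemma mulc_norm1 (x y : R) : x ^+ 2 + y ^+ 2 = 1 -> (x +i* y) * (x -i* y) = 1.
Proof.
move=> e; apply/eqP; rewrite eq_complex /= -e; apply/andP; split; apply/eqP; ring.
Qed.

Lemma sqr_norm_neq0 (z : C) : z != 0 -> complex.Re z ^+ 2 + complex.Im z ^+ 2 != 0.
Proof.
apply: contra_neq => /eqP; rewrite paddr_eq0 ?sqr_ge0 // !sqrf_eq0.
by case: z => x y /= /andP[/eqP -> /eqP ->].
Qed.

Lemma std_mul (f g : 'End(V)) : std f *m std g = Th *m (mxof vb vb f *m mxof vb vb g) *m Ti.
Proof. by rewrite /coord_mx !mulmxA -(mulmxA _ Ti) TiTh mulmx1. Qed.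

Lemma J'_conj m (M : 'M[R]_(4 + 4, m)) : J' *m (map_mx ratr Ti *m M) = map_mx ratr Ti *m (J *m M).
Proof.
by rewrite /J' -!mulmxA (mulmxA (map_mx ratr Th)) -map_mxM ThTi map_mx1 mul1mx.
Qed.

Let map_conj (M : 'M[rat]_(4 + 4)) :
  map_mx ratr (Ti *m M *m Th) = map_mx ratr Ti *m map_mx ratr M *m map_mx ratr Th :> 'M[R]_n.
Proof. by rewrite !map_mxM. Qed.

(** The circle points of J' are actions of norm one elements, so [smallest_lie_alg_circle] applies;
    functionals move to standard coordinates by cyclicity of the trace. *)
Lemma hodge_gens f X : std f = kmx d X ->
    (forall L : 'M[rat]_(4 + 4), \tr (map_mx ratr L *m kmx d (refl_mx d b)) = 0 ->
       \tr (L *m kmx d X) = 0) ->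
  hdg_alg A thetaA f.
Proof.
move=> fX mom; rewrite /hdg_alg (mxof_std TiTh) fX.
have c0 t : 1 + t ^+ 2 != 0 :> R by rewrite gt_eqF // ltr_pwDl ?sqr_ge0.
have norm1 t : ((1 - t ^+ 2) / (1 + t ^+ 2)) ^+ 2 + (2 * t / (1 + t ^+ 2)) ^+ 2 = 1 :> R.
  by field.
apply: (@smallest_lie_alg_circle _ _ _ J') => [t|t|L].
- exists (((1 - t ^+ 2) / (1 + t ^+ 2)) +i* (2 * t / (1 + t ^+ 2))); split.
    have -> : ((1 - t ^+ 2) / (1 + t ^+ 2) +i* (2 * t / (1 + t ^+ 2)))^*%R
      = (1 - t ^+ 2) / (1 + t ^+ 2) -i* (2 * t / (1 + t ^+ 2)) by [].
    rewrite mulc_norm1 ?norm1 //.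
  exact: torus_deligne.
- by apply: torus_unit; rewrite norm1 oner_eq0.
have trE (F : fieldType) (A1 : 'M[F]_(n, 4 + 4)) (A2 : 'M[F]_(4 + 4, n)) (L0 : 'M[F]_n) M :
    \tr (L0 *m (A1 *m M *m A2)) = \tr (A2 *m L0 *m A1 *m M).
  by rewrite !mulmxA mxtrace_mulC !mulmxA.
rewrite /J' trE trE -!map_mxM => h; apply: mom.
have -> : kmx d (refl_mx d b) = (sqrt_disc R d * line_norm d b) *: J.
  by rewrite /Jmx scalerA mulfV ?scale1r // gt_eqF // deltaN_gt0.
by rewrite -scalemxAr mxtraceZ h mulr0.
Qed.

Lemma hdg_sub_mt f : hdg_alg A thetaA f -> mt_alg A thetaA f.
Proof.
apply: smallest_lie_alg_mono => M [z [z1 hM]]; exists z; split=> //.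
by apply: contra_eq_neq z1 => ->; rewrite mul0r eq_sym oner_eq0.
Qed.

(** J is a real multiple of w S, hence K-linear, so the Mumford-Tate group lies in the centralizer
    of w. *)
Lemma mt_commute f : mt_alg A thetaA f -> lie_comm (iota w) f = 0.
Proof.
move=> mf; pose N := mxof vb vb (iota w).
have key : mx_diff (commute_eqs N) (mxof vb vb f) = 0.
  apply: entries_diff.
  apply: (smallest_lie_alg_in (commute_group R N) _ mf) => M [z [z0 hM]].
  have eM := deligne_torus hM; apply/points_entries; split.
    by rewrite eM; apply/torus_unit/sqr_norm_neq0.
  rewrite commute_eqsE eM /torus_pt mulmxDl mulmxDr mul_scalar_mx mul_mx_scalar.
  rewrite -scalemxAl -scalemxAr; apply/eqP; rewrite subr_eq0; apply/eqP.
  congr (_ + _ *: _); rewrite /N (mxof_std TiTh) std_iotaw map_conj map_kmx map_mx1.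
  rewrite -(mulmxA (map_mx ratr Ti) _ (map_mx ratr Th)). rewrite J'_conj.
  rewrite /J' -!mulmxA; congr (_ *m _).
  rewrite (mulmxA (map_mx ratr Th) (map_mx ratr Ti)) -map_mxM ThTi map_mx1 mul1mx.
  by rewrite !mulmxA; congr (_ *m _); rewrite /Jmx -scalemxAl -scalemxAr !kmxM mulmx1 mul1mx.
apply/(lie_comm_eq0 theta_bij TiTh); rewrite !std_mul -/N; congr (_ *m _ *m _).
by move: key; rewrite commute_diff => /eqP; rewrite subr_eq0 => /eqP.
Qed.

(** The polarization carried to H^1, with H in place of the dual form G on the lattice. *)
Definition form_mx : 'M[rat]_(4 + 4) :=
  block_mx 0 (diag_mx (\row_r form_coef rat d r)) (- diag_mx (\row_r form_coef rat d r)) 0.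

Lemma form_Q : form_mx *m (map_mx intr (Qmx d) : 'M[rat]_(4 + 4))^T = 1%:M.
Proof.
rewrite /form_mx /Qmx map_block_mx !map_mx0 map_mxN tr_block_mx !trmx0 linearN /=.
rewrite mulmx_block !(mulmx0, mul0mx, addr0, add0r) mulmxN mulNmx.
rewrite /Gmx map_diag_mx tr_diag_mx mulmx_diag (scalar_mx_block 4 4) -diag_const_mx.
have e : \row_j ((\row_r form_coef rat d r) 0 j
    * (map_mx intr (\row_r dual_coef d r)) 0 j) = const_mx 1 :> 'rV[rat]_4.
  apply/rowP => i; rewrite !mxE /form_coef /dual_coef; case: ifP => _; first by rewrite mulr1.
  by case: ifP => _; rewrite ?mulrN1 ?opprK // rmorphN mulrNN mulVf // pnatr_eq0 -lt0n.
by rewrite e opprK.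
Qed.

(** This is J^T Q J = Q after inverting Q. *)
Lemma J_form : J *m map_mx ratr form_mx *m J^T = map_mx ratr form_mx.
Proof.
pose QR : 'M[R]_(4 + 4) := map_mx intr (Qmx d); pose F : 'M[R]_(4 + 4) := map_mx ratr form_mx.
have FQ : F *m QR^T = 1%:M.
  have := congr1 (map_mx (ratr : rat -> R)) form_Q; rewrite map_mxM map_mx1 => <-.
  congr (_ *m _); apply/matrixP => i j; rewrite !mxE /= ratr_int //.
have JQJT : J^T *m QR^T *m J = QR^T.
  by rewrite -[RHS](congr1 trmx (JQJ d0 b_gt0 b_lt)) !trmx_mul trmxK mulmxA.
have J1 : J *m (- J) = 1%:M by rewrite mulmxN (Jmx2 d0 b_gt0 b_lt) opprK.
have e : J^T = QR^T *m (- J) *m F.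
  by rewrite -{1}JQJT -(mulmxA _ J (- J)) J1 mulmx1 -mulmxA (mulmx1C FQ) mulmx1.
by rewrite -/F e !mulmxA -(mulmxA J F) FQ mulmx1 J1 mul1mx.
Qed.

(** J' preserves N and has square -1, so it is skew for N: the cross terms cancel and x^2 + y^2
    remains as factor. *)
Lemma torus_form x y : x ^+ 2 + y ^+ 2 = 1 ->
  let N := map_mx ratr (Ti *m form_mx *m Ti^T) in
  torus_pt x y *m N *m (torus_pt x y)^T = N.
Proof.
move=> xy N.
pose TR : 'M[R]_(n, 4 + 4) := map_mx ratr Ti.
pose F : 'M[R]_(4 + 4) := map_mx ratr form_mx.
have NE : N = TR *m (F *m TR^T).
  by rewrite /N !map_mxM map_trmx mulmxA.
have JT : TR^T *m J'^T = J^T *m TR^T.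
  by rewrite -!trmx_mul -[TR in J' *m TR]mulmx1 J'_conj mulmx1.
have JNJ : J' *m N *m J'^T = N.
  rewrite NE J'_conj -!(mulmxA TR) -!(mulmxA J) -!(mulmxA F) JT (mulmxA F) (mulmxA J).
  by rewrite (mulmxA J F) J_form.
have JN : J' *m N = - (N *m J'^T).
  have e : N *m J'^T = J' *m N *m (J'^T *m J'^T) by rewrite mulmxA JNJ.
  by rewrite e -trmx_mul J'2 linearN /= trmx1 mulmxN mulmx1 opprK.
rewrite /torus_pt linearD /= linearZ /= tr_scalar_mx mulmxDl mul_scalar_mx.
rewrite -scalemxAl mulmxDr mul_mx_scalar -scalemxAr mulmxDl -!scalemxAl JNJ JN.
move: (N *m J'^T) => Z; rewrite -[RHS]scale1r -xy.
by apply/matrixP => i j; rewrite !mxE; ring.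
Qed.

Lemma hdg_form f : hdg_alg A thetaA f ->
  std f *m form_mx + form_mx *m (std f)^T = 0.
Proof.
move=> mf; pose N := Ti *m form_mx *m Ti^T.
have : mx_diff (form_eqs N) (mxof vb vb f) = 0.
  apply: entries_diff.
  apply: (smallest_lie_alg_in (form_group R N) _ mf) => M [z [z1 hM]].
  have z0 : z != 0 by apply: contra_eq_neq z1 => ->; rewrite mul0r eq_sym oner_eq0.
  have eM := deligne_torus hM; apply/points_entries; split.
    by rewrite eM; apply/torus_unit/sqr_norm_neq0.
  rewrite form_eqsE eM torus_form ?subrr //.
  case: z z1 {hM z0 eM} => x y /eqP; rewrite eq_complex /= => /andP[/eqP <- _].
  by ring.
rewrite form_diff => /(congr1 (fun M => Th *m M *m Th^T)).
rewrite mulmx0 mul0mx mulmxDr mulmxDl => <-; rewrite /N /coord_mx.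
have TT : Ti^T *m Th^T = 1%:M by rewrite -trmx_mul ThTi trmx1.
congr (_ + _); first by rewrite -!mulmxA TT mulmx1.
by rewrite !trmx_mul !mulmxA ThTi mul1mx.
Qed.

(** A central f commutes with the generators found in the Hodge Lie algebra, whose commutant is K.
    The general g covers both Lie algebras. *)
Lemma centre_sub (g : 'End(V) -> Prop) f :
  (forall f, hdg_alg A thetaA f -> g f) -> centre g f -> exists x, iota x = f.
Proof.
move=> hg [_ cf].
have gens X : (forall L : 'M[rat]_(4 + 4), \tr (map_mx ratr L *m kmx d (refl_mx d b)) = 0 ->
       \tr (L *m kmx d X) = 0) -> std f *m kmx d X = kmx d X *m std f.
  move=> mom; pose h := hommx vb vb (Ti *m kmx d X *m Th).
  have sh : std h = kmx d X.
    rewrite /coord_mx hommxK ?vbasisP // !mulmxA ThTi mul1mx -mulmxA ThTi mulmx1 //.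
  have /cf/(lie_comm_eq0 theta_bij TiTh) := hg _ (hodge_gens sh mom).
  by rewrite sh.
have moments := kmx_moments d0 b_indep.
have [|j j0|p [q e]] := @kmx_boosts_commutant d d0 (std f).
- by apply: gens => L /moments[].
- by apply: gens => L /moments[_ /(_ _ j0)].
exact: iota_of_std e.
Qed.

Lemma iotaw_centre : centre (mt_alg A thetaA) (iota w).
Proof.
split; last exact: mt_commute.
apply/hdg_sub_mt/(hodge_gens std_iotaw) => L.
by case/(kmx_moments d0 b_indep).
Qed.

End Structure.

(** * The representation of the quaternion algebra *)

Lemma ord2P (P : 'I_2 -> Prop) : P 0 -> P 1 -> forall i, P i.
Proof.
move=> p0 p1 [[|[|i]] hi] //.
- by rewrite (_ : Ordinal hi = 0) //; apply/val_inj.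
- by rewrite (_ : Ordinal hi = 1) //; apply/val_inj.
Qed.

Lemma big_ord2 (V : nmodType) (F : 'I_2 -> V) : \sum_i F i = F 0 + F 1.
Proof.
rewrite !big_ord_recl big_ord0 addr0.
by congr (F _ + F _); apply/val_inj.
Qed.

Section Hermitian.
Variables (F : comUnitRingType) (d : nat).

(* [x = x1 i + x2 j + x3 k] with [i^2 = -1], [j^2 = 1] as a 2 x 2 matrix. *)
Definition sl2_mx (x1 x2 x3 : F) : 'M[F]_2 := \matrix_(i, j)
  nth 0 (nth [::] [:: [:: x2; x3 - x1]; [:: x3 + x1; - x2]] i) j.

(* The action [h |-> X h + h X^*] of [X = sl2_mx x1 x2 x3], with
   [x_r = p_r + q_r w], on the rows of coordinates [c] of the Hermitian matrices
   [[c0 + c1, c2 + c3 w / d], [c2 - c3 w / d, c0 - c1]]. *)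
Definition herm_mx (p1 q1 p2 q2 p3 q3 : F) : 'M[F]_4 := \matrix_(i, j)
  nth 0 (nth [::]
    [:: [:: 0; 2 * p2; 2 * p3; - (2 * d%:R * q1)];
        [:: 2 * p2; 0; 2 * p1; - (2 * d%:R * q3)];
        [:: 2 * p3; - (2 * p1); 0; 2 * d%:R * q2];
        [:: - (2 * q1); 2 * q3; - (2 * q2); 0]] i) j.

Lemma sl2_mx_bracket a1 a2 a3 b1 b2 b3 :
  sl2_mx a1 a2 a3 *m sl2_mx b1 b2 b3 - sl2_mx b1 b2 b3 *m sl2_mx a1 a2 a3 =
  sl2_mx (2 * (a3 * b2 - a2 * b3)) (2 * (a3 * b1 - a1 * b3)) (2 * (a1 * b2 - a2 * b1)).
Proof.
apply/matrixP; apply: ord2P; apply: ord2P; rewrite !mxE !big_ord2 !mxE /=; ring.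
Qed.

Lemma sl2_mx_tr a1 a2 a3 : \tr (sl2_mx a1 a2 a3) = 0.
Proof. by rewrite /mxtrace big_ord2 !mxE /= subrr. Qed.

Lemma herm_mx_bracket p1 q1 p2 q2 p3 q3 p1' q1' p2' q2' p3' q3' :
  let re p q p' q' := p * p' - d%:R * (q * q') in
  let im p q p' q' := p * q' + q * p' in
  let M := herm_mx p1 q1 p2 q2 p3 q3 in
  let M' := herm_mx p1' q1' p2' q2' p3' q3' in
  M' *m M - M *m M' = herm_mx
    (2 * (re p3 q3 p2' q2' - re p2 q2 p3' q3')) (2 * (im p3 q3 p2' q2' - im p2 q2 p3' q3'))
    (2 * (re p3 q3 p1' q1' - re p1 q1 p3' q3')) (2 * (im p3 q3 p1' q1' - im p1 q1 p3' q3'))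
    (2 * (re p1 q1 p2' q2' - re p2 q2 p1' q1')) (2 * (im p1 q1 p2' q2' - im p2 q2 p1' q1')).
Proof.
move=> /=; apply/matrixP; apply: ord4P; apply: ord4P;
  rewrite !mxE !big_ord4 !mxE /=; ring.
Qed.

(* Coordinates of [T], viewed as an element of the scalar extension of the space
   of Hermitian matrices in which [w] is sent to [l]. *)
Definition herm_coord (l : F) (T : 'M[F]_2) : 'rV[F]_4 := \row_j
  nth 0 [:: (T 0 0 + T 1 1) / 2; (T 0 0 - T 1 1) / 2; (T 0 1 + T 1 0) / 2;
            - l * (T 0 1 - T 1 0) / 2] j.

(** Conjugation of K exchanges l and -l, so after scalar extension h |-> X h + h X^* becomes T |-> X
    T + T Y^T with Y the image of X under the other embedding, which is the action on V(1) [x]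
    V(1). *)
Lemma herm_coord_equivariant (l : F) p1 q1 p2 q2 p3 q3 T :
    l * l = - d%:R -> (2 : F) \is a GRing.unit ->
  let X := sl2_mx (p1 + q1 * l) (p2 + q2 * l) (p3 + q3 * l) in
  let Y := sl2_mx (p1 + q1 * - l) (p2 + q2 * - l) (p3 + q3 * - l) in
  herm_coord l (X *m T + T *m Y^T) = herm_coord l T *m herm_mx p1 q1 p2 q2 p3 q3.
Proof.
move=> lsq u2 /=.
(* Eliminating d leaves polynomial identities in l and 1/2 for [ring]. *)
have hd : d%:R = - (l * l) by rewrite lsq opprK.
have h2 : 2^-1 * 2 = 1 :> F by rewrite mulVr.
have cancel2 (x y : F) : 2 * x = 2 * y -> x = y by apply: mulrI.
have t2 : 2 * 2^-1 = 1 :> F by rewrite mulrV.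
apply/rowP; apply: ord4P; apply: cancel2;
  rewrite !mxE !big_ord4 !mxE /= !big_ord2 !mxE /= ?hd; ring: t2.
Qed.

End Hermitian.

(** The derivative of det h along X h + h X^* is the trace of X + X^* times det h, and X has trace
    zero. *)
Lemma herm_form (d : nat) p1 q1 p2 q2 p3 q3 : (0 < d)%N ->
  let H : 'M[rat]_4 := diag_mx (\row_r form_coef rat d r) in
  let M := herm_mx d p1 q1 p2 q2 p3 q3 in M *m H + H *m M^T = 0.
Proof.
move=> d0 /=; have dr0 : d%:R != 0 :> rat by rewrite pnatr_eq0 -lt0n.
rewrite mul_mx_diag mul_diag_mx; apply/matrixP; apply: ord4P; apply: ord4P;
  by rewrite !mxE /form_coef /=; field.
Qed.

(** * Extension of scalars for Q-linear maps *)

Lemma linear_sum_prop (F : fieldType) (U W : lmodType F) (f : U -> W) (I : finType)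
    (c : I -> F) (v : I -> U) : linear f ->
  f (\sum_i c i *: v i) = \sum_i c i *: f (v i).
Proof.
move=> fl; have f0 : f 0 = 0.
  have /eqP := fl 1 0 0; rewrite !scale1r addr0 -subr_eq0 opprD addNKr oppr_eq0.
  by move/eqP.
have fD : {morph f : x y / x + y} by move=> x y; rewrite -[x]scale1r fl !scale1r.
rewrite (big_morph f fD f0); apply: eq_bigr => i _.
by rewrite -[c i *: v i]addr0 fl f0 addr0.
Qed.

Section ScalarExtension.
Variables (F : numFieldType) (L : vectType rat).
Local Notation n := (\dim {:L}).
Local Notation vb := (vbasis {:L}).

Definition qlinear (W : lmodType F) (f : L -> W) :=
  forall q x y, f (q *: x + y) = ratr q *: f x + f y.

Lemma ext_vec_qlinear : qlinear (ext_vec F (V := L)).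
Proof. by move=> q x y; rewrite /ext_vec linearP map_mxD map_mxZ. Qed.

Lemma ext_vec_basis (i : 'I_n) : ext_vec F vb`_i = delta_mx 0 i.
Proof. by rewrite /ext_vec rVofE ?vbasisP // map_delta_mx. Qed.

Lemma ext_lin_linear (W : lmodType F) (f : L -> W) : linear (ext_lin (F := F) f).
Proof.
move=> c u v; rewrite /ext_lin scaler_sumr -big_split; apply: eq_bigr => i _.
by rewrite !mxE scalerDl scalerA.
Qed.

Lemma qlinear_sum (W : lmodType F) (f : L -> W) x : qlinear f ->
  f x = \sum_i ratr (coord vb i x) *: f vb`_i.
Proof.
move=> fl; have f0 : f 0 = 0.
  have /eqP := fl 1 0 0; rewrite rmorph1 !scale1r addr0 -subr_eq0 opprD addNKr oppr_eq0.
  by move/eqP.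
have fD : {morph f : x y / x + y}.
  by move=> y z; rewrite -[y]scale1r fl rmorph1 !scale1r.
rewrite {1}(coord_vbasis (memvf x)) (big_morph f fD f0); apply: eq_bigr => i _.
by rewrite -[coord _ _ _ *: _ in LHS]addr0 fl f0 addr0.
Qed.

Lemma ext_lin_vec (W : lmodType F) (f : L -> W) x :
  qlinear f -> ext_lin f (ext_vec F x) = f x.
Proof.
move=> fl; rewrite (qlinear_sum x fl); apply: eq_bigr => i _.
by rewrite !mxE.
Qed.

Lemma ext_linear_eq (W : lmodType F) (f g : 'rV[F]_n -> W) : linear f -> linear g ->
  (forall x, f (ext_vec F x) = g (ext_vec F x)) -> forall u, f u = g u.
Proof.
move=> fl gl fg u; rewrite [u]row_sum_delta !linear_sum_prop //.
by apply: eq_bigr => i _; rewrite -ext_vec_basis fg.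
Qed.

Lemma ext_bracket_vec (br : L -> L -> L) x y :
    (forall z, linear (br z)) -> (forall z, linear (br^~ z)) ->
  ext_bracket br (ext_vec F x) (ext_vec F y) = ext_vec F (br x y).
Proof.
move=> b1 b2.
have q1 z : qlinear (fun t => ext_vec F (br z t)).
  by move=> q t u; rewrite b1 ext_vec_qlinear.
rewrite /ext_bracket ext_lin_vec ?ext_lin_vec // => q t u.
by rewrite !ext_lin_vec // b2 ext_vec_qlinear.
Qed.

Lemma ext_bracket_linear2 (br : L -> L -> L) u : linear (ext_bracket (F := F) br u).
Proof.
move=> c v v'; have e z : ext_bracket br u z =
    \sum_i u 0 i *: ext_lin (fun y => ext_vec F (br vb`_i y)) z by [].
rewrite !e scaler_sumr -big_split; apply: eq_bigr => i _.
by rewrite ext_lin_linear scalerDr !scalerA mulrC.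
Qed.

End ScalarExtension.

(** * Splitting of the pure quaternions of K(-1, 1) *)

Lemma pair3_eq (T : Type) (x y : (T * T * T)%type) :
  x.1.1 = y.1.1 -> x.1.2 = y.1.2 -> x.2 = y.2 -> x = y.
Proof. by case: x y => [[? ?] ?] [[? ?] ?] /= -> -> ->. Qed.

Section Quaternions.
Variables (K : fieldExtType rat) (d : nat) (w : K).
Hypotheses (wB : basis_of {:K} [:: 1; w]) (wsq : w * w = - (d%:R : rat)%:A).
Hypothesis d0 : (0 < d)%N.
Local Notation L := (pure_quat K).
Local Notation br := (pure_bracket ((-1)%:A : K) 1).
Local Notation re := (q_re w).
Local Notation im := (q_im w).

Lemma pure_bracketE (x y : L) : br x y =
  (2 * (x.2 * y.1.2 - x.1.2 * y.2), 2 * (x.2 * y.1.1 - x.1.1 * y.2),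
   2 * (x.1.1 * y.1.2 - x.1.2 * y.1.1)) :> L.
Proof.
case: x => [[x1 x2] x3]; case: y => [[y1 y2] y3] /=.
by rewrite /pure_bracket /= scaleN1r; apply: pair3_eq => /=; ring.
Qed.

Lemma pure_bracket_linear2 z : linear (br z : L -> L).
Proof.
move=> c x y; rewrite !pure_bracketE /=.
have AE (q : rat) (t : K) : q *: t = in_alg K q * t by rewrite mulr_algl.
by apply: pair3_eq => /=; rewrite !AE; ring.
Qed.

Lemma pure_bracket_linear1 z : linear (br^~ z : L -> L).
Proof.
move=> c x y; rewrite !pure_bracketE /=.
have AE (q : rat) (t : K) : q *: t = in_alg K q * t by rewrite mulr_algl.
by apply: pair3_eq => /=; rewrite !AE; ring.
Qed.

Section Split.
Variables (F : numFieldType) (l : F).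
Hypothesis lsq : l * l = - ratr d%:R.

Definition quat_mx (e : F) (x : L) : 'M[F]_2 :=
  sl2_mx (q_emb w e x.1.1) (q_emb w e x.1.2) (q_emb w e x.2).

Lemma q_embZD (e : F) q x y : q_emb w e (q *: x + y) = ratr q * q_emb w e x + q_emb w e y.
Proof.
by rewrite /q_emb q_reD q_imD q_reZ q_imZ !rmorphD !rmorphM /=; ring.
Qed.

Lemma quat_mx_qlinear e : qlinear (quat_mx e).
Proof.
move=> q x y; rewrite /quat_mx /= !q_embZD; apply/matrixP.
by apply: ord2P; apply: ord2P; rewrite !mxE /=; ring.
Qed.

Lemma quat_mx_bracket (e : F) x y : e * e = - ratr d%:R ->
  quat_mx e (br x y) = quat_mx e x *m quat_mx e y - quat_mx e y *m quat_mx e x.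
Proof.
move=> esq; rewrite /quat_mx sl2_mx_bracket pure_bracketE /=.
have two t : q_emb w e (2 * t) = 2 * q_emb w e t.
  by rewrite !mulr_natl !mulr2n q_embD.
have subE s t : q_emb w e (s - t) = q_emb w e s - q_emb w e t.
  by apply: (addIr (q_emb w e t)); rewrite -q_embD !subrK.
by rewrite !two !subE !(q_embM wB wsq esq).
Qed.

(** The embeddings w -> l and w -> -l split K (x) F into F x F, one factor sl(2) for each. *)
Definition quat_iso (u : 'rV[F]_(\dim {:L})) : ('M[F]_2 * 'M[F]_2)%type :=
  (ext_lin (quat_mx l) u, ext_lin (quat_mx (- l)) u).

Let l0 : l != 0.
Proof.
apply/eqP => z; have /eqP := lsq.
by rewrite z mul0r eq_sym oppr_eq0 ratr_nat pnatr_eq0 -leqn0 leqNgt d0.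
Qed.

Let lNsq : - l * - l = - ratr d%:R.
Proof. by rewrite mulrNN. Qed.

Lemma quat_iso_vec x : quat_iso (ext_vec F x) = (quat_mx l x, quat_mx (- l) x).
Proof. by rewrite /quat_iso !ext_lin_vec //; apply: quat_mx_qlinear. Qed.

Lemma quat_iso_linear : linear quat_iso.
Proof. by move=> c u v; rewrite /quat_iso !ext_lin_linear. Qed.

(* The coordinates p_r, q_r of the preimage are recovered from the images
   p_r + q_r l and p_r - q_r l. *)
Definition quat_iso_inv (p : ('M[F]_2 * 'M[F]_2)%type) : 'rV[F]_(\dim {:L}) :=
  let c (A : 'M[F]_2) := ((A 1 0 - A 0 1) / 2, A 0 0, (A 0 1 + A 1 0) / 2) in
  let a := c p.1 in let b := c p.2 in
  ((a.1.1 + b.1.1) / 2) *: ext_vec F ((1, 0, 0) : L)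
  + ((a.1.1 - b.1.1) / (2 * l)) *: ext_vec F ((w, 0, 0) : L)
  + ((a.1.2 + b.1.2) / 2) *: ext_vec F ((0, 1, 0) : L)
  + ((a.1.2 - b.1.2) / (2 * l)) *: ext_vec F ((0, w, 0) : L)
  + ((a.2 + b.2) / 2) *: ext_vec F ((0, 0, 1) : L)
  + ((a.2 - b.2) / (2 * l)) *: ext_vec F ((0, 0, w) : L).

Lemma quat_iso_inv_linear : linear quat_iso_inv.
Proof.
move=> c p q; rewrite /quat_iso_inv /= !mxE.
do 6!move: (ext_vec F _) => ?.
by apply/rowP => i; rewrite !mxE; field; rewrite l0.
Qed.

Lemma quat_isoK : cancel quat_iso quat_iso_inv.
Proof.
move=> u; apply: (@ext_linear_eq F L _ (quat_iso_inv \o quat_iso) id) => // [|{u}x].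
  by move=> c u1 u2; rewrite /= quat_iso_linear quat_iso_inv_linear.
rewrite /= quat_iso_vec /quat_iso_inv /quat_mx !mxE /=.
have xE : x = re x.1.1 *: (1, 0, 0) + (im x.1.1 *: (w, 0, 0) + (re x.1.2 *: (0, 1, 0)
   + (im x.1.2 *: (0, w, 0) + (re x.2 *: (0, 0, 1) + im x.2 *: (0, 0, w))))) :> L.
  by apply: pair3_eq; rewrite /= !scaler0 ?addr0 ?add0r -?q_reE.
have vx : ext_vec F x = ratr (re x.1.1) *: ext_vec F ((1, 0, 0) : L)
  + (ratr (im x.1.1) *: ext_vec F ((w, 0, 0) : L)
  + (ratr (re x.1.2) *: ext_vec F ((0, 1, 0) : L)
  + (ratr (im x.1.2) *: ext_vec F ((0, w, 0) : L)
  + (ratr (re x.2) *: ext_vec F ((0, 0, 1) : L)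
  + ratr (im x.2) *: ext_vec F ((0, 0, w) : L))))).
  rewrite {1}xE !ext_vec_qlinear; do 5!congr (_ + _).
  by rewrite /ext_vec linearZ map_mxZ.
rewrite vx.
do 6!move: (ext_vec F _) => ?; rewrite /q_emb.
by apply/rowP => i; rewrite !mxE; field; rewrite l0.
Qed.

Lemma quat_iso_invK p : sl2xsl2 p -> quat_iso (quat_iso_inv p) = p.
Proof.
case: p => A B [/=]; rewrite /mxtrace !big_ord2.
move=> /eqP; rewrite addrC addr_eq0 => /eqP A1 /eqP; rewrite addrC addr_eq0 => /eqP B1.
have e1 e : q_emb w e 1 = 1 :> F.
  by rewrite /q_emb q_re1 // q_im1 // rmorph1 rmorph0 mul0r addr0.
have ew e : q_emb w e w = e :> F.
  by rewrite /q_emb q_rew // q_imw // rmorph1 rmorph0 mul1r add0r.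
have e0 e : q_emb w e 0 = 0 :> F.
  have /eqP := q_embD w e 0 0.
  by rewrite addr0 -subr_eq0 opprD addNKr oppr_eq0 => /eqP.
have ED e (u v : 'rV[F]_(\dim {:L})) :
    ext_lin (quat_mx e) (u + v) = ext_lin (quat_mx e) u + ext_lin (quat_mx e) v.
  by rewrite -[u]scale1r ext_lin_linear !scale1r.
have EV e c x : ext_lin (quat_mx e) (c *: ext_vec F x) = c *: quat_mx e x.
  rewrite -[c *: ext_vec F x]addr0 ext_lin_linear ext_lin_vec; last exact: quat_mx_qlinear.
  by rewrite /ext_lin big1 ?addr0 // => i _; rewrite mxE scale0r.
rewrite /quat_iso /quat_iso_inv !ED !EV /quat_mx /= !(e1, ew, e0).
by congr (_, _); apply/matrixP; apply: ord2P; apply: ord2P;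
  rewrite !mxE /= ?A1 ?B1; field; rewrite l0.
Qed.

Lemma quat_iso_tr u : sl2xsl2 (quat_iso u).
Proof.
split; rewrite /= /ext_lin linear_sum big1 // => i _; by rewrite linearZ /= sl2_mx_tr mulr0.
Qed.

Lemma quat_iso_sl2xsl2 : iso_sl2xsl2 br quat_iso.
Proof.
split.
- exact: quat_iso_linear.
- exact: can_inj quat_isoK.
- move=> p; split=> [/quat_iso_invK e|[u <-]]; last exact: quat_iso_tr.
  by exists (quat_iso_inv p).
move=> u v.
have b1 := pure_bracket_linear1; have b2 := pure_bracket_linear2.
have brl (p : ('M[F]_2 * 'M[F]_2)%type) : linear (sl2xsl2_bracket p).
  move=> c q r; rewrite /sl2xsl2_bracket /=.
  by congr (_, _) => /=; rewrite mulmxDr mulmxDl -scalemxAr -scalemxAl scalerBr opprD addrACA.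
have brr (p : ('M[F]_2 * 'M[F]_2)%type) :
    linear (fun q : ('M[F]_2 * 'M[F]_2)%type => sl2xsl2_bracket q p).
  move=> c q r; rewrite /sl2xsl2_bracket /=.
  by congr (_, _) => /=; rewrite mulmxDr mulmxDl -scalemxAr -scalemxAl scalerBr opprD addrACA.
(* Both sides are bilinear over F, so the identity spreads from rational vectors one argument at a
   time. *)
have step (x : L) : quat_iso (ext_bracket br (ext_vec F x) v) =
    sl2xsl2_bracket (quat_iso (ext_vec F x)) (quat_iso v).
  move: v; apply: ext_linear_eq => [c v v'|c v v'|y].
  - by rewrite ext_bracket_linear2 quat_iso_linear.
  - by rewrite quat_iso_linear brl.
  - by rewrite ext_bracket_vec // !quat_iso_vec /sl2xsl2_bracket /= !quat_mx_bracket.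
move: u; apply: ext_linear_eq => [c u u'|c u u'|x].
- by rewrite /ext_bracket ext_lin_linear quat_iso_linear.
- by rewrite quat_iso_linear brr.
- exact: step.
Qed.

End Split.
End Quaternions.

(** * The representation mu on V *)

Section Representation.
Variables (d : nat) (K : fieldExtType rat) (w : K).
Hypothesis d0 : (0 < d)%N.
Hypotheses (wB : basis_of {:K} [:: 1; w]) (wsq : w * w = - (d%:R : rat)%:A).
Variables (V : vectType rat) (iota : {linear K -> 'End(V)}).
Hypothesis iota_1 : iota 1 = \1%VF.
Variable theta : {linear 'rV[rat]_(4 + 4) -> V}.
Hypothesis theta_bij : bijective theta.
Hypothesis theta_w : forall u, theta (u *m kmx d 1%:M) = iota w (theta u).
Local Notation n := (\dim {:V}).
Local Notation vb := (vbasis {:V}).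
Local Notation vbP := (vbasisP {:V}).
Local Notation Th := (theta_mx theta).
Variable Ti : 'M[rat]_(n, 4 + 4).
Hypotheses (ThTi : Th *m Ti = 1%:M) (TiTh : Ti *m Th = 1%:M).
Local Notation std := (coord_mx theta Ti).
Local Notation L := (pure_quat K).
Local Notation br := (pure_bracket ((-1)%:A : K) 1).
Local Notation re := (q_re w).
Local Notation im := (q_im w).

Definition herm_rep (x : L) : 'M[rat]_4 := herm_mx d
  (re x.1.1) (im x.1.1) (re x.1.2) (im x.1.2) (re x.2) (im x.2).

Lemma herm_rep_linear : linear herm_rep.
Proof.
move=> c x y; rewrite /herm_rep /= !q_reD !q_imD !q_reZ !q_imZ.
by apply/matrixP; apply: ord4P; apply: ord4P; rewrite !mxE /=; ring.
Qed.

Lemma herm_rep_bracket x y :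
  herm_rep (br x y) = herm_rep y *m herm_rep x - herm_rep x *m herm_rep y.
Proof.
have reB (s t : K) : re (2 * (s - t)) = 2 * (re s - re t).
  by rewrite !mulr_natl !mulr2n !q_reD q_reN.
have imB (s t : K) : im (2 * (s - t)) = 2 * (im s - im t).
  by rewrite !mulr_natl !mulr2n !q_imD q_imN.
rewrite /herm_rep herm_mx_bracket pure_bracketE /=.
by rewrite !reB !imB !(q_reM wB wsq) !(q_imM wB wsq).
Qed.

(** The K-linear extension to K^4 of the rational action on Hermitian matrices. *)
Definition quat_rep (x : L) : 'End(V) := hommx vb vb (Ti *m dmx (herm_rep x) *m Th).

Lemma mxof_quat_rep x : mxof vb vb (quat_rep x) = Ti *m dmx (herm_rep x) *m Th.
Proof. by rewrite /quat_rep hommxK ?vbasisP. Qed.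

Lemma std_quat_rep x : std (quat_rep x) = dmx (herm_rep x).
Proof.
by rewrite /coord_mx mxof_quat_rep !mulmxA ThTi mul1mx -mulmxA ThTi mulmx1.
Qed.

Lemma stdD f g : std (f + g) = std f + std g.
Proof. by rewrite -[f]scale1r std_linear !scale1r. Qed.

Lemma quat_rep_linear : linear quat_rep.
Proof.
move=> c x y; apply: (std_inj TiTh).
by rewrite std_linear !std_quat_rep herm_rep_linear dmxD dmxZ.
Qed.

Lemma quat_rep_inj : injective quat_rep.
Proof.
move=> x y /(congr1 std); rewrite !std_quat_rep => /eq_block_mx[e _ _ _].
have e' i j : herm_rep x i j = herm_rep y i j by rewrite e.
move: (e' 0 1) (e' 0 2) (e' 1 2) (e' 3 0) (e' 3 1) (e' 3 2).
rewrite !mxE /= => a1 a2 a3 a4 a5 a6.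
have q_ext (s t : K) : re s = re t -> im s = im t -> s = t.
  by move=> r1 i1; rewrite (q_reE wB s) (q_reE wB t) r1 i1.
by apply: pair3_eq; apply: q_ext; lra.
Qed.

Lemma dmx_jmx X x : dmx X *m jmx d w x = jmx d w x *m dmx X.
Proof.
by rewrite /jmx mulmxDl mulmxDr mul_scalar_mx mul_mx_scalar -scalemxAl -scalemxAr
  dkmxM kdmxM mulmx1 mul1mx.
Qed.

Lemma quat_rep_lie_rep : lie_rep br quat_rep.
Proof.
split; first exact: quat_rep_linear.
move=> x y; apply: (std_inj TiTh).
rewrite (lie_comm_std theta_bij TiTh) !std_quat_rep !dmxM herm_rep_bracket.
by rewrite -scaleN1r dmxD dmxZ scaleN1r.
Qed.

(** Elements of K commute with each other and with the K-linear image of mu, so only the bracket of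
    the quaternion parts remains. *)
Lemma quat_rep_sum_rep (Z : 'End(V) -> Prop) :
  (forall z, Z z -> exists x, iota x = z) -> sum_rep br Z quat_rep.
Proof.
move=> ZK z z' x x' /ZK[y <-] /ZK[y' <-]; apply: (std_inj TiTh).
rewrite /sum_incl add0r (lie_comm_std theta_bij TiTh) !stdD.
rewrite !(std_iota wB iota_1 theta_bij theta_w TiTh) !std_quat_rep herm_rep_bracket.
rewrite -scaleN1r dmxD dmxZ scaleN1r -!dmxM.
have jj : jmx d w y *m jmx d w y' = jmx d w y' *m jmx d w y.
  by rewrite -!(jmxM wB wsq) mulrC.
have := (dmx_jmx (herm_rep x) y', dmx_jmx (herm_rep x') y).
move: (jmx d w y) (jmx d w y') (dmx _) (dmx _) jj => A A' B B' jj [e e'].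
by rewrite !mulmxDl !mulmxDr jj e e'; apply/matrixP => i j; rewrite !mxE; ring.
Qed.

(** The boosts come from the quaternions j, k and w i, whose 2 x 2 matrices are Hermitian. *)
Lemma herm_rep_boost : exists (a b : 'I_4 -> rat) (x : 'I_4 -> L),
  [/\ forall j, j != 0 -> a j != 0, forall j, j != 0 -> b j != 0 &
      forall j, j != 0 -> herm_rep (x j) = boost (a j) (b j) j].
Proof.
exists (fun j => if j == 3 then - (2 * d%:R) else 2), (fun j => if j == 3 then - 2 else 2).
exists (fun j => if j == 1 then (0, 1, 0) else if j == 2 then (0, 0, 1) else (w, 0, 0)).
have r0 : re 0 = 0 by apply: (addIr (re 0)); rewrite -q_reD !add0r.
have i0 : im 0 = 0 by apply: (addIr (im 0)); rewrite -q_imD !add0r.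
split=> j.
- by case: ifP => _ _ //; rewrite oppr_eq0 mulf_neq0 // pnatr_eq0 -lt0n.
- by case: ifP.
elim/ord4P: j => // _; rewrite /herm_rep /= ?r0 ?i0 ?(q_re1 wB) ?(q_im1 wB) ?(q_rew wB) ?(q_imw wB);
  apply/matrixP; apply: ord4P; apply: ord4P; rewrite !mxE /=; ring.
Qed.

(** The image of mu alone generates M_4(Q), for which V is two copies of Q^4; the element w of Z
    joins them. *)
Lemma quat_rep_irreducible (Z : 'End(V) -> Prop) : Z 0 -> Z (iota w) ->
  (0 < n)%N -> irreducible_sum_rep Z quat_rep.
Proof.
move=> Z0 Zw n0; split=> // U stU; have [->|Un0] := eqVneq U 0%VS; [by left|right].
have sub f u : (f @: U <= U)%VS -> theta u \in U -> theta (u *m std f) \in U.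
  by move=> fU uU; rewrite -(std_theta TiTh); apply: (subvP fU); apply: memv_img.
have x0 : quat_rep 0 = 0.
  have /eqP := quat_rep_linear 1 0 0; rewrite !scale1r addr0 -subr_eq0 opprD addNKr oppr_eq0.
  by move/eqP.
have [g gK Kg] := theta_bij.
pose P u := theta u \in U.
have PL c u v : P u -> P v -> P (c *: u + v).
  by move=> uU vU; rewrite /P linearP memvD // memvZ.
have PW u : P u -> P (u *m kmx d 1%:M).
  move=> uU; rewrite -(std_iotaw wB iota_1 theta_bij theta_w TiTh); apply: sub => //.
  by have := stU _ 0 Zw; rewrite /sum_incl x0 addr0.
have PX x u : P u -> P (u *m dmx (herm_rep x)).
  move=> uU; rewrite -std_quat_rep; apply: sub => //.
  by have := stU _ x Z0; rewrite /sum_incl add0r.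
have [a [b [y [a0 b0 yB]]]] := herm_rep_boost.
have PD i j u : P u -> P (u *m dmx (delta_mx i j)).
  move: u; apply: (@boosts_generate _ (fun X => forall u, P u -> P (u *m dmx X)) a b) => //.
  - by move=> X Y hX hY u uU; rewrite -dmxM mulmxA; apply/hY/hX.
  - move=> c X hX u uU; rewrite dmxZ -scalemxAr -[_ *: _]addr0; apply: PL; first exact: hX.
    by rewrite /P linear0 mem0v.
  - by move=> k k0 u uU; rewrite -yB //; apply: PX.
have all : forall u, P u.
  apply: (@transitive_rows _ 1 (- d%:R) P _ PL _ PD (g (vpick U))).
  - move=> s t /eqP; rewrite mul1r mulNr -subr_eq0 opprK.
    have q2 : 0 <= d%:R * t ^+ 2 :> rat by apply: mulr_ge0; rewrite ?ler0n ?sqr_ge0.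
    rewrite (paddr_eq0 (sqr_ge0 s) q2) sqrf_eq0 mulf_eq0 sqrf_eq0 pnatr_eq0 -leqn0 leqNgt d0 /=.
    by case/andP=> /eqP -> /eqP ->.
  - by move=> u /PW; rewrite /kmx scale_scalar_mx mulr1.
  - by rewrite /P Kg memv_pick.
  - apply: contra_neq Un0 => e; apply/eqP; rewrite -vpick0 -[vpick U]Kg e.
    by rewrite linear0.
by apply/vspaceP => v; rewrite memvf -[v]Kg; apply: all.
Qed.

(* The form on V given by H1_form(x^T Q, y^T Q) = x^T Q y, since [form_mx] is the
   inverse of Q^T. *)
Definition H1_form (v v' : V) : rat :=
  ((rVof vb v *m Ti) *m form_mx d *m (rVof vb v' *m Ti)^T) 0 0.

Lemma H1_form_skew f : std f *m form_mx d + form_mx d *m (std f)^T = 0 ->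
  forall v v', H1_form (f v) v' + H1_form v (f v') = 0.
Proof.
move=> sf v v'; rewrite /H1_form.
have fE u : rVof vb (f u) *m Ti = rVof vb u *m Ti *m std f.
  by rewrite (rVof_app vb vbP) /coord_mx !mulmxA -(mulmxA _ Ti) TiTh mulmx1.
rewrite !fE; move: (rVof vb v *m Ti) (rVof vb v' *m Ti) => u u'.
have -> : u *m std f *m form_mx d *m u'^T = u *m (std f *m form_mx d) *m u'^T.
  by rewrite !mulmxA.
have -> : u *m form_mx d *m (u' *m std f)^T = u *m (form_mx d *m (std f)^T) *m u'^T.
  by rewrite trmx_mul !mulmxA.
have := congr1 (fun M => (u *m M *m u'^T) 0 0) sf.
by rewrite mulmxDr mulmxDl mulmx0 mul0mx !mxE.
Qed.

Lemma quat_rep_form x :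
  std (quat_rep x) *m form_mx d + form_mx d *m (std (quat_rep x))^T = 0.
Proof.
rewrite std_quat_rep /dmx /form_mx tr_block_mx !trmx0 !mulmx_block.
rewrite !(mulmx0, mul0mx, addr0, add0r) add_block_mx !addr0 mulmxN mulNmx -opprD.
by rewrite /herm_rep herm_form // oppr0 block_mx0.
Qed.

Lemma H1_form_theta u u' : H1_form (theta u) (theta u') = (u *m form_mx d *m u'^T) 0 0.
Proof. by rewrite /H1_form -!mul_Th -!(mulmxA _ _ Ti) ThTi !mulmx1. Qed.

End Representation.

(** * The two eigenspaces of K as V(1) [x] V(1) *)

Lemma map_herm_mx (F G : comUnitRingType) (f : {rmorphism F -> G}) d p1 q1 p2 q2 p3 q3 :
  map_mx f (herm_mx d p1 q1 p2 q2 p3 q3) =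
  herm_mx d (f p1) (f q1) (f p2) (f q2) (f p3) (f q3).
Proof.
apply/matrixP; apply: ord4P; apply: ord4P;
  by rewrite !mxE /= ?rmorphN ?rmorphM ?rmorph0 ?rmorph_nat //= ?rmorphM ?rmorph_nat.
Qed.

Section Eigenspaces.
Variables (d : nat) (K : fieldExtType rat) (w : K).
Hypothesis d0 : (0 < d)%N.
Hypotheses (wB : basis_of {:K} [:: 1; w]) (wsq : w * w = - (d%:R : rat)%:A).
Variables (V : vectType rat) (iota : {linear K -> 'End(V)}).
Hypothesis iota_1 : iota 1 = \1%VF.
Variable theta : {linear 'rV[rat]_(4 + 4) -> V}.
Hypothesis theta_bij : bijective theta.
Hypothesis theta_w : forall u, theta (u *m kmx d 1%:M) = iota w (theta u).
Local Notation n := (\dim {:V}).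
Local Notation vb := (vbasis {:V}).
Local Notation vbP := (vbasisP {:V}).
Local Notation Th := (theta_mx theta).
Variable Ti : 'M[rat]_(n, 4 + 4).
Hypotheses (ThTi : Th *m Ti = 1%:M) (TiTh : Ti *m Th = 1%:M).
Local Notation std := (coord_mx theta Ti).
Local Notation L := (pure_quat K).
Local Notation br := (pure_bracket ((-1)%:A : K) 1).
Variables (F : numFieldType) (l : F).
Hypothesis lsq : l * l = - ratr d%:R.
Variable s : {rmorphism K -> F}.
Local Notation ThF := (map_mx ratr Th : 'M[F]_(4 + 4, n)).
Local Notation TiF := (map_mx ratr Ti : 'M[F]_(n, 4 + 4)).
Local Notation mu_ext := (ext_lin (F := F) (fun x => ext_end F (quat_rep d w theta Ti x))).
Local Notation V_eig := (char_space (fun x => mxof vb vb (iota x)) s).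

Let lsq' : l * l = - d%:R. Proof. by rewrite lsq ratr_nat. Qed.
Let ssq : s w * s w = - d%:R. Proof. by rewrite (q_morph_sqr wsq) ratr_nat. Qed.

Let l0 : l != 0.
Proof.
apply/eqP => z; have /eqP := lsq'.
by rewrite z mul0r eq_sym oppr_eq0 pnatr_eq0 -leqn0 leqNgt d0.
Qed.

Let FThTi : ThF *m TiF = 1%:M. Proof. by rewrite -map_mxM ThTi map_mx1. Qed.
Let FTiTh : TiF *m ThF = 1%:M. Proof. by rewrite -map_mxM TiTh map_mx1. Qed.

(** The general eigenvector of w for the eigenvalue s w, as (s w)^2 = -d. *)
Definition eig_row (c : 'rV[F]_4) : 'rV[F]_n := row_mx (s w *: c) c *m ThF.

Lemma eig_row_linear : linear eig_row.
Proof.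
move=> c x y; rewrite /eig_row scalemxAl -mulmxDl scale_row_mx add_row_mx.
by rewrite scalerDr !scalerA mulrC.
Qed.

Lemma eig_row_inj : injective eig_row.
Proof.
move=> x y /(congr1 (mulmx^~ TiF)); rewrite -!mulmxA FThTi !mulmx1.
by case/eq_row_mx.
Qed.

Lemma V_eigP (v : 'rV[F]_n) : (v <= V_eig)%MS <-> exists c, eig_row c = v.
Proof.
have jl : linear (fun x => mxof vb vb (iota x)) by move=> q x y; rewrite !linearP.
have j1 : mxof vb vb (iota 1) = 1%:M.
  apply/row_matrixP => i; rewrite row1 rowE mul_mxof iota_1 lfunE /= vecof_delta.
  by rewrite rVofE ?vbasisP.
rewrite (char_spaceP s v wB wsq jl j1) (mxof_std TiTh).
rewrite (std_iotaw wB iota_1 theta_bij theta_w TiTh) !map_mxM map_kmx map_mx1.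
have kE (a c : 'rV[F]_4) : row_mx a c *m kmx d 1%:M = row_mx (- d%:R *: c) a.
  by rewrite /kmx mul_row_block !mulmx0 add0r addr0 mulmx1 -scalemxAr mulmx1.
split=> [/eqP e|[c <-]].
  have : v *m TiF *m kmx d 1%:M = s w *: (v *m TiF).
    have := congr1 (mulmx^~ TiF) e.
    by rewrite -scalemxAl !mulmxA -!(mulmxA _ ThF TiF) FThTi mulmx1.
  rewrite -[v *m TiF]hsubmxK kE scale_row_mx => /eq_row_mx[_ e2].
  exists (rsubmx (v *m TiF)); rewrite /eig_row -e2 hsubmxK.
  by rewrite -mulmxA FTiTh mulmx1.
apply/eqP; rewrite /eig_row !mulmxA -(mulmxA _ ThF TiF) FThTi mulmx1 kE.
by rewrite -ssq -!scalerA -scale_row_mx scalemxAl.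
Qed.

Lemma ext_end_quat_rep (x : L) : ext_end F (quat_rep d w theta Ti x) =
  TiF *m dmx (map_mx ratr (herm_rep d w x)) *m ThF.
Proof. by rewrite /ext_end mxof_quat_rep !map_mxM map_dmx. Qed.

Lemma ext_end_quat_rep_qlinear :
  qlinear (fun x : L => ext_end F (quat_rep d w theta Ti x)).
Proof.
move=> q x y; rewrite (quat_rep_linear d w ThTi TiTh q x y) /ext_end linearP /=.
by rewrite map_mxD map_mxZ.
Qed.

Lemma eig_row_act c X : eig_row c *m (TiF *m dmx X *m ThF) = eig_row (c *m X).
Proof.
rewrite /eig_row !mulmxA -(mulmxA _ ThF TiF) FThTi mulmx1 /dmx mul_row_block.
by rewrite !mulmx0 addr0 add0r -scalemxAl.
Qed.

(** [dmx X] acts on the parameter c by X whatever s is, so one choice of l, made independently of s,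
    serves both eigenspaces. *)
Definition eig_tensor (T : 'M[F]_2) : 'rV[F]_n := eig_row (herm_coord l T).

Lemma herm_coord_linear : linear (herm_coord l).
Proof.
by move=> c T U; apply/rowP; apply: ord4P; rewrite !mxE /=; field.
Qed.

Lemma herm_coord_bij : bijective (herm_coord l).
Proof.
pose g (c : 'rV[F]_4) : 'M[F]_2 := \matrix_(i, j) nth 0 (nth [::]
  [:: [:: c 0 0 + c 0 1; c 0 2 - c 0 3 / l]; [:: c 0 2 + c 0 3 / l; c 0 0 - c 0 1]] i) j.
exists g => [T|c].
  by apply/matrixP; apply: ord2P; apply: ord2P; rewrite !mxE /=; field; rewrite ?l0.
by apply/rowP; apply: ord4P; rewrite !mxE /=; field; rewrite ?l0.
Qed.

Lemma eig_tensor_act (u : 'rV[F]_(\dim {:L})) T :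
  eig_tensor (V1V1_act (quat_iso w l u) T) = eig_tensor T *m mu_ext u.
Proof.
move: u; apply: ext_linear_eq => [c u v|c u v|x].
- rewrite (quat_iso_linear w l c u v) /V1V1_act /= linearD linearZ /= mulmxDl mulmxDr.
  rewrite -scalemxAl -scalemxAr addrACA -scalerDr.
  by rewrite /eig_tensor herm_coord_linear eig_row_linear.
- by rewrite ext_lin_linear mulmxDr -scalemxAr.
rewrite quat_iso_vec ext_lin_vec; last exact: ext_end_quat_rep_qlinear.
rewrite ext_end_quat_rep eig_row_act /eig_tensor /V1V1_act /quat_mx /=.
have u2 : (2 : F) \is a GRing.unit by rewrite unitfE pnatr_eq0.
have /= e p1 q1 p2 q2 p3 q3 := @herm_coord_equivariant F d l p1 q1 p2 q2 p3 q3 T lsq' u2.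
by rewrite /q_emb e /herm_rep map_herm_mx.
Qed.

Lemma V_eig_iso : iso_V1V1 (quat_iso w l) mu_ext V_eig.
Proof.
have tl : linear eig_tensor.
  by move=> c T U; rewrite /eig_tensor herm_coord_linear eig_row_linear.
pose lin := GRing.isSemilinear.Build _ _ _ _ eig_tensor (GRing.semilinear_linear tl).
pose eta : {linear 'M[F]_2 -> 'rV[F]_n} := HB.pack eig_tensor lin.
have [g gK Kg] := herm_coord_bij.
exists eta; split.
- by move=> T U /eig_row_inj /(can_inj gK).
- move=> v; rewrite V_eigP; split=> [[c <-]|[T <-]]; last by exists (herm_coord l T).
  by exists (g c); rewrite /= /eig_tensor Kg.
- exact: eig_tensor_act.
Qed.

(** The boosts in the image of mu generate all elementary matrices over F, and these carry a nonzero
    coordinate of a vector of U to every position. *)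
Lemma V_eig_irreducible :
  irreducible_subrep (fun X => exists u, mu_ext u = X) V_eig.
Proof.
have [eta [eta_inj etaV eta_act]] := V_eig_iso.
split.
- apply/eqP => V0.
  have : (eta 1%:M <= V_eig)%MS by apply/etaV; exists 1%:M.
  rewrite V0 submx0 => /eqP e; have /eta_inj/matrixP/(_ 0 0) : eta 1%:M = eta 0 by rewrite linear0.
  by rewrite !mxE /= => /eqP; rewrite oner_eq0.
- move=> X [u <-]; apply/rV_subP => v /submxP[y ->]; rewrite mulmxA.
  have /etaV[T <-] : (y *m V_eig <= V_eig)%MS := submxMl _ _.
  by rewrite -eta_act; apply/etaV; eexists.
move=> U UV stU; have [->|Un0] := eqVneq U 0; [by left|right].
have PX x (v : 'rV[F]_n) : (v <= U)%MS ->
    (v *m (TiF *m dmx (map_mx ratr (herm_rep d w x)) *m ThF) <= U)%MS.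
  move=> vU; rewrite -ext_end_quat_rep -(ext_lin_vec x ext_end_quat_rep_qlinear).
  apply: submx_trans (submxMr _ vU) _; apply: stU; eexists; reflexivity.
have [a [b [y [a0 b0 yB]]]] := herm_rep_boost d0 wB.
have dM (X Y : 'M[F]_4) : TiF *m dmx (X *m Y) *m ThF =
    (TiF *m dmx X *m ThF) *m (TiF *m dmx Y *m ThF).
  by rewrite !mulmxA -(mulmxA _ ThF TiF) FThTi mulmx1 -(mulmxA TiF (dmx X)) dmxM.
have PD i j (v : 'rV[F]_n) : (v <= U)%MS -> (v *m (TiF *m dmx (delta_mx i j) *m ThF) <= U)%MS.
  move: v; apply: (@boosts_generate _ (fun X => forall v : 'rV[F]_n, (v <= U)%MS ->
     (v *m (TiF *m dmx X *m ThF) <= U)%MS) (ratr \o a) (ratr \o b)).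
  - by move=> X Y hX hY v vU; rewrite dM mulmxA; apply/hY/hX.
  - move=> c X hX v vU; rewrite dmxZ -scalemxAr -scalemxAl -scalemxAr.
    by apply/scalemx_sub/hX.
  - by move=> k k0; rewrite /= fmorph_eq0 a0.
  - by move=> k k0; rewrite /= fmorph_eq0 b0.
  - move=> k k0 v vU; have := PX (y k) v vU; rewrite yB // /boost map_mxD !map_mxZ.
    by rewrite !map_delta_mx.
have [i ri] : exists i, row i U != 0.
  apply/existsP; apply: contraNT Un0 => /existsPn r0; apply/eqP/row_matrixP => i.
  by rewrite row0; apply/eqP/negbNE/r0.
have /V_eigP[c cE] : (row i U <= V_eig)%MS by apply: submx_trans (row_sub _ _) UV.
have [j cj] : exists j, c 0 j != 0.
  apply/existsP; apply: contraNT ri => /existsPn c0; apply/eqP; rewrite -cE.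
  rewrite (_ : c = 0); first by rewrite /eig_row scaler0 row_mx0 mul0mx.
  by apply/rowP => k; rewrite mxE; apply/eqP/negbNE/c0.
have Uk k : (eig_row (delta_mx 0 k) <= U)%MS.
  have := PD j k (row i U) (row_sub _ _); rewrite -cE eig_row_act.
  have -> : c *m delta_mx j k = c 0 j *: delta_mx 0 k.
    apply/rowP => m; rewrite !mxE (bigD1 j) //= big1 => [|t tj].
      by rewrite mxE eqxx addr0.
    by rewrite mxE (negPf tj) mulr0.
  have e : eig_row (c 0 j *: delta_mx 0 k) = c 0 j *: eig_row (delta_mx 0 k).
    rewrite -[c 0 j *: delta_mx 0 k]addr0 eig_row_linear.
    by rewrite /eig_row scaler0 row_mx0 mul0mx addr0.
  by rewrite e => /(scalemx_sub (c 0 j)^-1); rewrite scalerA mulVf // scale1r.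
apply/rV_subP => v /V_eigP[x <-]; rewrite [x]row_sum_delta (linear_sum_prop _ _ eig_row_linear).
by apply: summx_sub => k _; apply/scalemx_sub/Uk.
Qed.

End Eigenspaces.

Unset Implicit Arguments.

Theorem proposition7p10 (R : realType) (K : fieldExtType rat)
    (V : vectType rat) (iota : {linear K -> 'End(V)})
    (K_imaginary : imaginary_quadratic K)
    (V_dim : \dim {:V} = 8%N)
    (iota_inj : injective iota)
    (iota_1 : iota 1 = \1%VF)
    (iota_mul : forall x y, iota (x * y) = (iota x \o iota y)%VF) :
  exists (E : fieldExtType rat) (a : rat) (A : abelian_variety R 4)
         (theta : {linear 'rV[rat]_(4.*2) -> V})
         (mu : {linear pure_quat E -> 'End(V)}),
    let br := pure_bracket (a%:A : E) 1 in
    let mu_ext := ext_lin (fun x => ext_end algC (mu x)) in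
    let V_eig (s : {rmorphism K -> algC}) :=
      char_space (fun x => passmx.mxof (vbasis {:V}) (vbasis {:V}) (iota x)) s in
    let Z_mt := centre (mt_alg A theta) in
    let Z_hdg := centre (hdg_alg A theta) in
    [/\ imaginary_quadratic E,
        a < 0,
        [/\ bijective theta,
            simple_av A,
            anti_weil A &
            forall f, hodge_end A theta f <-> exists x, iota x = f],
        lie_rep br mu /\ injective mu &
        [/\ exists Phi, iso_sl2xsl2 br Phi /\
              forall s : {rmorphism K -> algC},
                irreducible_subrep (fun X => exists u, mu_ext u = X) (V_eig s) /\
                iso_V1V1 Phi mu_ext (V_eig s),
            sum_rep br Z_mt mu /\ irreducible_sum_rep Z_mt mu &
            sum_rep br Z_hdg mu /\
            exists phi, polarization_form A theta phi /\
              forall z x v w, Z_hdg z ->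
                phi (sum_incl mu z x v) w + phi v (sum_incl mu z x w) = 0]].
Proof.
have [d [w [d0 wB wsq]]] := imaginary_quadratic_gen K_imaginary.
have [b [b_gt0 b_lt b_indep]] := small_real_independent R.
have ww v : iota w (iota w v) = - d%:R *: v.
  rewrite -comp_lfunE -iota_mul wsq linearN linearZ /= iota_1 opp_lfunE scale_lfunE id_lfunE.
  by rewrite scaleNr.
have [theta [theta_bij theta_w]] := ex_theta ww d0 V_dim.
have [Ti [ThTi TiTh]] := Th_inverse theta_bij.
pose lin := GRing.isSemilinear.Build _ _ _ _ (quat_rep d w theta Ti)
  (GRing.semilinear_linear (quat_rep_linear d w ThTi TiTh)).
pose mu : {linear pure_quat K -> 'End(V)} := HB.pack (quat_rep d w theta Ti) lin.
pose A := prop_av d0 b_gt0 b_lt.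
(* Fixed before s is given; the choice of root only orders the two factors sl(2). *)
pose l : algC := sqrtC (- d%:R).
have lsq : l * l = - ratr d%:R by rewrite -expr2 sqrtCK ratr_nat.
exists K, (-1), A, (theta : {linear 'rV[rat]_(4.*2) -> V}), mu => br mu_ext V_eig Z_mt Z_hdg.
have Zmt_sub z : Z_mt z -> exists x, iota x = z.
  apply: (centre_sub b_indep wB iota_1 theta_bij theta_w ThTi TiTh) => f.
  exact: hdg_sub_mt.
have Zhdg_sub z : Z_hdg z -> exists x, iota x = z.
  exact: (centre_sub b_indep wB iota_1 theta_bij theta_w ThTi TiTh).
split=> //.
- split=> //.
  + exact: (prop_av_simple d0 b_gt0 b_lt b_indep).
  + exact: (prop_av_anti_weil d0 b_gt0 b_lt b_indep wB wsq K_imaginary).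
  + exact: (hodge_end_iota d0 b_gt0 b_lt b_indep wB iota_1 theta_bij theta_w ThTi TiTh).
- split; first exact: (quat_rep_lie_rep wB wsq theta_bij ThTi TiTh).
  exact: (quat_rep_inj wB ThTi).
split.
- exists (quat_iso w l); split; first exact: (quat_iso_sl2xsl2 wB wsq d0 lsq).
  move=> s; split.
    exact: (V_eig_irreducible d0 wB wsq iota_1 theta_bij theta_w ThTi TiTh lsq).
  exact: (V_eig_iso d0 wB wsq iota_1 theta_bij theta_w ThTi TiTh lsq).
- split; first exact: (quat_rep_sum_rep wB wsq iota_1 theta_bij theta_w ThTi TiTh).
  apply: (quat_rep_irreducible d0 wB iota_1 theta_bij theta_w ThTi TiTh).
  + split=> [p _|f _]; last by rewrite /lie_comm comp_lfun0l comp_lfun0r subrr.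
    rewrite mx_gradE (mxof_std TiTh 0) (std0 theta_bij TiTh).
    by rewrite mulmx0 mul0mx mulmx0 mxtrace0.
  + exact: (iotaw_centre d0 b_gt0 b_lt b_indep wB iota_1 theta_bij theta_w ThTi TiTh).
  + by rewrite V_dim.
split; first exact: (quat_rep_sum_rep wB wsq iota_1 theta_bij theta_w ThTi TiTh).
exists (H1_form d Ti); split.
  exists (Qmx d); split; first exact: Qmx_riemann.
  move=> QQ x y; rewrite (H1_form_theta d ThTi) trmx_mul trmxK.
  rewrite -!mulmxA (mulmxA (form_mx d)) form_Q // mul1mx //.
move=> z x v v' Zz; apply: (H1_form_skew TiTh).
rewrite /sum_incl (stdD theta Ti) linearD mulmxDl mulmxDr addrACA.
rewrite (hdg_form ThTi TiTh Zz.1) // add0r.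
exact: quat_rep_form.
Qed.
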